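(* If there exists a planar oriented graph that is not $2$-dicolourable, then deciding whether a given planar oriented graph is $2$-dicolourable is NP-complete.
   Context: An oriented graph is a digraph obtained from a finite simple graph (its underlying graph) by replacing each edge by exactly one of the two possible arcs; it is planar if its underlying graph is planar. A digraph is $2$-dicolourable if its vertex set can be partitioned into $2$ subsets each inducing an acyclic subdigraph (no directed cycle). *)

(* Defs.v *)
From HB Require Import structures.
From mathcomp Require Import all_boot all_order all_algebra.
From mathcomp Require Import all_classical all_reals all_analysis.
Import numFieldNormedType.Exports.

Set Implicit Arguments.
Unset Strict Implicit.
Unset Printing Implicit Defensive.

Import Order.TTheory GRing.Theory Num.Theory.

(** * Graphs *)

Record simple_graph := SimpleGraph {
  vertex :> finType;
  adj : rel vertex;
  adj_sym : symmetric adj;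
  adj_irrefl : irreflexive adj }.

Definition edges (G : simple_graph) : {set {set G}} :=
  [set E : {set G} | [exists u, exists v, adj u v && (E == [set u; v])]].

(** A drawing of [G] in the plane [R * R]: the vertices are distinct points,
    and an edge [E] is drawn as the simple arc [gamma E], parametrized by
    [0, 1]. The arc joins the two ends of [E], and its interior contains no
    vertex and no point of the interior of another edge. *)
Definition plane_drawing (R : realType) (G : simple_graph)
    (pt : G -> R * R) (gamma : {set G} -> R -> R * R) : Prop :=
  [/\ injective pt,
      forall E, E \in edges G ->
        ({within `[0%R, 1%R], continuous (gamma E)})%classic /\
        {in `[0%R, 1%R]%R &, injective (gamma E)},
      forall u v, adj u v ->
        (gamma [set u; v] 0%R = pt u /\ gamma [set u; v] 1%R = pt v) \/
        (gamma [set u; v] 0%R = pt v /\ gamma [set u; v] 1%R = pt u),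
      forall E (t : R) v, E \in edges G -> t \in `]0%R, 1%R[%R -> gamma E t <> pt v &
      forall E F (s t : R), E \in edges G -> F \in edges G -> E != F ->
        s \in `]0%R, 1%R[%R -> t \in `]0%R, 1%R[%R -> gamma E s <> gamma F t].

Definition planar (R : realType) (G : simple_graph) : Prop :=
  exists pt gamma, @plane_drawing R G pt gamma.

Record oriented_graph := OrientedGraph {
  underlying :> simple_graph;
  arc : rel underlying;
  arc_adj : forall u v, arc u v -> adj u v;
  arc_orient : forall u v, adj u v -> arc u v (+) arc v u }.

Definition induced_rel (T : finType) (e : rel T) (A : {set T}) : rel T :=
  [rel u v | [&& u \in A, v \in A & e u v]].

Definition acyclic (T : finType) (e : rel T) : Prop :=
  forall c : seq T, c != [::] -> ~ ucycle e c.

(** The parts of the partition are the colour classes; they may be empty. *)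
Definition dicolourable (k : nat) (D : oriented_graph) : Prop :=
  exists col : {ffun D -> 'I_k},
    forall i : 'I_k, acyclic (induced_rel (@arc D) [set v | col v == i]).

(** * Deterministic multitape Turing machines *)

Definition word := seq bool.

Section Tapes.
Variable A : Type.

(** A two-way infinite tape; [None] is the blank symbol, and the cells beyond
    those listed are blank. The cells of [tape_left] are listed starting from
    the one next to the head. *)
Record tape := Tape {
  tape_left : seq (option A);
  tape_head : option A;
  tape_right : seq (option A) }.

Inductive direction := MoveLeft | Stay | MoveRight.

Definition tape_write (a : option A) (tp : tape) : tape :=
  Tape (tape_left tp) a (tape_right tp).

Definition tape_move (d : direction) (tp : tape) : tape :=
  let: Tape l h r := tp in
  match d with
  | MoveLeft => Tape (behead l) (head None l) (h :: r)
  | Stay => tp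
  | MoveRight => Tape (h :: l) (head None r) (behead r)
  end.

Definition tape_of (s : seq A) : tape :=
  let cells := map some s in Tape [::] (head None cells) (behead cells).

End Tapes.

(** The tape alphabet consists of the blank, the two bits and the auxiliary
    symbols [tm_aux]. The machine halts when [tm_delta] is [None]. *)
Record machine := Machine {
  tm_extra_tapes : nat;
  tm_aux : finType;
  tm_state : finType;
  tm_start : tm_state;
  tm_delta : tm_state -> {ffun 'I_tm_extra_tapes.+1 -> option (bool + tm_aux)} ->
    option (tm_state *
            {ffun 'I_tm_extra_tapes.+1 -> option (bool + tm_aux) * direction}) }.

Section Runs.
Variable M : machine.

Notation symbol := (bool + tm_aux M)%type.

Record config := Config {
  cfg_state : tm_state M;
  cfg_tapes : 'I_(tm_extra_tapes M).+1 -> tape symbol }.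

(** The [i]-th input word is on tape [i], with the head on its first letter. *)
Definition initial (ws : seq word) : config :=
  Config (tm_start M) (fun i => tape_of (map inl (nth [::] ws i))).

Definition step (c : config) : option config :=
  if tm_delta (cfg_state c) [ffun i => tape_head (cfg_tapes c i)]
    is Some (q, act)
  then Some (Config q (fun i =>
         tape_move (act i).2 (tape_write (act i).1 (cfg_tapes c i))))
  else None.

Definition halted (c : config) : Prop := step c = None.

Definition run (t : nat) (c : config) : config :=
  iter t (fun c => odflt c (step c)) c.

Fixpoint leading_bits (s : seq (option symbol)) : word :=
  if s is Some (inl b) :: s' then b :: leading_bits s' else [::].

(** The output is the block of bits on tape 0 that starts under the head. *)
Definition output (c : config) : word :=
  let tp := cfg_tapes c ord0 in leading_bits (tape_head tp :: tape_right tp).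

Definition outputs_within (t : nat) (ws : seq word) (out : word) : Prop :=
  let c := run t (initial ws) in halted c /\ output c = out.

End Runs.

(** * Polynomial time and NP *)

Definition poly_time_fun (f : word -> word) : Prop :=
  exists (M : machine) (p : {poly nat}), forall x,
    outputs_within M p.[size x]%R [:: x] (f x).

Definition poly_time_rel (V : word -> word -> bool) : Prop :=
  exists (M : machine) (p : {poly nat}), forall x w,
    outputs_within M p.[(size x + size w)%N]%R [:: x; w] [:: V x w].

(** A decision problem consists of its set of instances, an encoding of them
    as words, and the yes-instances. A language is the case where the instances
    are all words, encoded by themselves. *)
Record problem := Problem {
  instance : Type;
  encode : instance -> word;
  yes : instance -> Prop }.

Definition in_NP (P : problem) : Prop :=
  exists2 V : word -> word -> bool, poly_time_rel V &
  exists p : {poly nat}, forall I : instance P,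
    yes I <->
    exists2 w : word, (size w <= p.[size (encode I)]%R)%N & V (encode I) w.

(** A polynomial-time many-one (Karp) reduction, computed on encodings. *)
Definition reduces_to (P Q : problem) : Prop :=
  exists2 f : word -> word, poly_time_fun f &
  forall I : instance P, exists2 J : instance Q,
    f (encode I) = encode J & (yes I <-> yes J).

Definition NP_complete (Q : problem) : Prop :=
  in_NP Q /\ forall P : problem, in_NP P -> reduces_to P Q.

(** * The dicolouring problem on planar oriented graphs *)

(** The number of vertices in unary, a separator, then the adjacency matrix
    row by row. *)
Definition encode_digraph (T : finType) (e : rel T) : word :=
  nseq #|T| true ++ false :: [seq e u v | u <- enum T, v <- enum T].

Definition planar_oriented_graph (R : realType) : Type :=
  {D : oriented_graph | planar R D}.

Definition planar_dicolourability (R : realType) (k : nat) : problem :=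
  @Problem (planar_oriented_graph R)
    (fun D => encode_digraph (@arc (sval D)))
    (fun D => dicolourable k (sval D)).

(* Main.v *)
Require Import Defs.
From HB Require Import structures.
From mathcomp Require Import all_boot all_order all_algebra.
From mathcomp Require Import all_classical all_reals all_analysis.
From mathcomp Require Import ring lra zify.
Import numFieldNormedType.Exports.

Set Implicit Arguments.
Unset Strict Implicit.
Unset Printing Implicit Defensive.

Import Order.TTheory GRing.Theory Num.Theory.

(** The problem is in NP because a digraph is acyclic exactly when its vertices
    carry natural numbers, the ranks, that increase along the arcs: the two
    colours and the ranks inside the colour classes, written in unary, are a
    certificate ([dicolourable2P], [dicolourability_NP]).

    For hardness, satisfiability of CNF formulas is reduced to 2-dicolouring.
    A planar oriented graph that is not 2-dicolourable yields an edge-minimal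
    one, [D]. Replace an edge [uv] of [D] by a path through a new vertex [w].
    In a 2-dicolouring [u] and [w] must differ, since otherwise ranks would
    increase from [u] through [w] to [v] and [D] would be 2-dicolourable. By
    minimality [D] without [uv] has a 2-dicolouring; [u] and [v] agree in it,
    so that giving [w] the other colour creates no monochromatic arc at [w].
    Two copies in series, glued at [w], thus force their two ends to agree and
    carry no monochromatic path from one end to the other ([slot_gadget]).

    To serve as an edge of a planar graph this gadget has to be drawn with both
    ends on its outer face. An arbitrary drawing of [D] is turned inside out at
    [u]: the last crossings of the edges at [u] with a small circle around [u]
    replace [u], an inversion maps the outside of the circle to a half-plane,
    and there the edges are joined to [u] and [w] by segments
    ([subdivided_drawing]).

    The unit edges of a rectangular grid are then used as slots, each of them
    empty, a single arc, or a gadget ([host_graph]). Gadgets are wires of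
    constant colour, and a directed cycle of arcs through wires says that these
    wires are not all equal. With such constraints two crossing wires can be
    decoupled, so the incidence matrix of a CNF formula can be laid out as a
    crossbar, one column per variable and one row per clause, that is
    2-dicolourable exactly when the formula is satisfiable ([cnf_graphP]).

    The tableau of a Turing machine gives, for every problem in NP, CNF formulas
    with incidence matrices that are computed uniformly ([cook_levin]). All
    the numbers and bits involved are values of terms built from variables,
    sums, differences, bounded sums and bits of the input, and the values of such
    terms are computed in polynomial time by machines that keep numbers in unary
    on their tapes ([print_outputs]). This makes both the reduction and the
    verification of certificates polynomial. *)

(** * Continuous curves and drawings *)

Local Open Scope ring_scope.
Section Ctn.
Variable R : realType.
Implicit Types f g : R -> R.
Definition ctn f := (continuous f)%classic.

Lemma ctn_cst a : ctn (fun=> a). Proof. exact: cst_continuous. Qed.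
Lemma ctn_id : ctn id. Proof. by move=> x; exact: cvg_id. Qed.
Lemma ctnD f g : ctn f -> ctn g -> ctn (fun t => f t + g t).
Proof. by move=> cf cg x; apply: (@continuousD _ _ _ f g x); [exact: cf|exact: cg]. Qed.
Lemma ctnN f : ctn f -> ctn (fun t => - f t).
Proof. by move=> cf x; apply: (@continuousN _ _ _ f x); exact: cf. Qed.
Lemma ctnM f g : ctn f -> ctn g -> ctn (fun t => f t * g t).
Proof. by move=> cf cg x; apply: (@continuousM _ _ f g x); [exact: cf|exact: cg]. Qed.
Lemma ctnV f : (forall t, f t != 0) -> ctn f -> ctn (fun t => (f t)^-1).
Proof. by move=> f0 cf x; apply: (@continuousV _ _ f x); [exact: f0|exact: cf]. Qed.
Lemma ctn_comp f g : ctn f -> ctn g -> ctn (fun t => f (g t)).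
Proof. by move=> cf cg x; apply: (@continuous_comp _ _ _ g f x); [exact: cg|exact: cf]. Qed.
Lemma ctn_max f g : ctn f -> ctn g -> ctn (fun t => Num.max (f t) (g t)).
Proof. by move=> cf cg x; apply: (@continuous_max _ _ f g x); [exact: cf|exact: cg]. Qed.
Lemma ctn_min f g : ctn f -> ctn g -> ctn (fun t => Num.min (f t) (g t)).
Proof. by move=> cf cg x; apply: (@continuous_min _ _ f g x); [exact: cf|exact: cg]. Qed.

(** Curves are only given on the unit interval; composing with [clamp] turns
    continuity there into continuity everywhere, which composes freely. *)
Definition clamp (t : R) := Num.max 0 (Num.min 1 t).
Lemma clampE t : 0 <= t <= 1 -> clamp t = t.
Proof. by rewrite /clamp => /andP[t0 t1]; rewrite (min_idPr t1) (max_idPr t0). Qed.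
Lemma clamp_itv t : 0 <= clamp t <= 1.
Proof. by rewrite /clamp le_max lexx /= ge_max ler01 /= ge_min lexx. Qed.
Lemma ctn_clamp : ctn clamp.
Proof. by apply: ctn_max; [exact: ctn_cst | apply: ctn_min; [exact: ctn_cst | exact: ctn_id]]. Qed.

Lemma within_clamp (c : R -> R * R) :
  {within `[0, 1], continuous c}%classic ->
  ctn (fun t => (c (clamp t)).1) /\ ctn (fun t => (c (clamp t)).2).
Proof.
move=> /subspace_continuousP cc.
have H : forall t : R, ((c (clamp x)) @[x --> t] --> c (clamp t))%classic.
  move=> t; apply: (@cvg_comp _ _ _ clamp c (nbhs t) (within `[0,1] (nbhs (clamp t)))%classic _ _ (cc _ _)).
    move=> B wB; have H : nbhs t (fun x => clamp x \in `[0, 1]%R -> B (clamp x)) := ctn_clamp wB.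
    apply: (@filterS _ (nbhs t) _ _ (fun x => B (clamp x)) _ H) => x; apply.
    by rewrite in_itv /= clamp_itv.
  by rewrite /= in_itv /= clamp_itv.
split=> t.
  exact: (@cvg_comp _ _ _ (fun x => c (clamp x)) fst _ _ _ (H t) cvg_fst).
exact: (@cvg_comp _ _ _ (fun x => c (clamp x)) snd _ _ _ (H t) cvg_snd).
Qed.

Lemma within_ctn (f1 f2 : R -> R) : ctn f1 -> ctn f2 ->
  {within `[0, 1], continuous (fun t => (f1 t, f2 t) : R * R)}%classic.
Proof. by move=> c1 c2; apply: continuous_subspaceT => t; exact: (@cvg_pair _ _ _ (nbhs t) (nbhs (f1 t)) (nbhs (f2 t)) _ _ _ f1 f2 (c1 t) (c2 t)). Qed.
End Ctn.

Section Drawn.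
Variable R : realType.
(** Unlike [plane_drawing], the curves are indexed by ordered pairs, so that the
    end at which a curve starts is known, and they are continuous on the whole
    line. The relation [e] need not be symmetric: it is enough for planarity that
    each edge occurs in one direction ([planar_drawn]). *)
Record drawn (V : Type) (e : V -> V -> Prop) (P : V -> R * R) (c : V -> V -> R -> R * R) : Prop := Drawn {
  drawn_inj : injective P;
  drawn_ctn : forall u v, e u v -> ctn (fun t => (c u v t).1) /\ ctn (fun t => (c u v t).2);
  drawn_simple : forall u v, e u v -> {in `[0, 1] &, injective (c u v)};
  drawn_ends : forall u v, e u v -> c u v 0 = P u /\ c u v 1 = P v;
  drawn_vertex : forall u v w t, e u v -> 0 < t < 1 -> c u v t <> P w;
  drawn_cross : forall u v u' v' s t, e u v -> e u' v' -> 0 < s < 1 -> 0 < t < 1 ->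
    c u v s = c u' v' t -> (u = u' /\ v = v') \/ (u = v' /\ v = u') }.

Lemma planar_drawn (G : simple_graph) (e : G -> G -> bool) P c :
  (forall u v, adj u v -> e u v || e v u) -> (forall u v, e u v -> adj u v) ->
  drawn e P c -> planar R G.
Proof.
move=> adje eadj d.
pose gam (E : {set G}) := if [pick uv : G * G | e uv.1 uv.2 && (E == [set uv.1; uv.2])] is Some uv
  then c uv.1 uv.2 else fun _ => (0, 0).
have gamP E : E \in edges G -> exists u v, [/\ e u v, E = [set u; v] & gam E = c u v].
  rewrite inE => /existsP[u /existsP[v /andP[uv /eqP ->]]]; rewrite /gam.
  case: pickP => [[a b] /= /andP[ab /eqP ->]|].
    by exists a, b.
  case/orP: (adje _ _ uv) => uv'; first by move/(_ (u, v)); rewrite /= uv' eqxx.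
  by move/(_ (v, u)); rewrite /= uv' finset.setUC eqxx.
exists P, gam; split.
- exact: drawn_inj d.
- move=> E /gamP[u [v [uv _ ->]]]; split; last exact: drawn_simple d _ _ uv.
  have [c1 c2] := drawn_ctn d uv.
  have -> : c u v = (fun t => ((c u v t).1, (c u v t).2)) by apply/funext => t; case: (c u v t).
  exact: within_ctn.
- move=> u v uv; have : [set u; v] \in edges G.
    by rewrite inE; apply/existsP; exists u; apply/existsP; exists v; rewrite uv eqxx.
  case/gamP => a [b [ab eqE ->]]; have [-> ->] := drawn_ends d ab.
  have nab : a != b by apply/eqP => abE; move: (eadj _ _ ab); rewrite abE adj_irrefl.
  have := finset.set21 a b; rewrite -eqE !inE => /orP[]/eqP au; have := finset.set22 a b; rewrite -eqE !inE => /orP[]/eqP bv;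
    move: nab; rewrite au bv ?eqxx // => _; by [left|right].
- move=> E t v /gamP[a [b [ab _ ->]]]; rewrite in_itv /= => tI; exact: drawn_vertex d _ _ _ _ ab tI.
move=> E F s t /gamP[a [b [ab -> ->]]] /gamP[a' [b' [ab' -> ->]]] nEF; rewrite !in_itv /= => sI tI eq_st.
by case: (drawn_cross d ab ab' sI tI eq_st) => -[ea eb]; move: nEF; rewrite ea eb ?eqxx // finset.setUC eqxx.
Qed.

(** A curve of a plane drawing may run either way; it is reversed when it does
    not start at the first vertex of the ordered pair. *)
Lemma drawn_planar (G : simple_graph) : planar R G ->
  exists P c, drawn (fun u v : G => adj u v) P c.
Proof.
case=> pt [gam [injp simp ends vert cross]].
pose c u v t := let g := gam [set u; v] in if g 0 == pt u then g (clamp t) else g (clamp (1 - t)).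
have edgeI u v : adj u v -> [set u; v] \in edges G.
  by move=> uv; rewrite inE; apply/existsP; exists u; apply/existsP; exists v; rewrite uv eqxx.
have nadj u v : adj u v -> (pt v == pt u) = false.
  by move=> uv; apply/eqP => /injp vu; move: uv; rewrite vu adj_irrefl.
have c01 (t : R) : 0 <= t <= 1 -> 0 <= 1 - t <= 1 by move=> ?; lra.
have c01' (t : R) : 0 < t < 1 -> 0 < 1 - t < 1 by move=> ?; lra.
have cl (t : R) : 0 < t < 1 -> clamp t = t by move=> ?; apply: clampE; lra.
exists pt, c; split => //.
- move=> u v uv; have [cc _] := simp _ (edgeI _ _ uv); have [c1 c2] := within_clamp cc.
  rewrite /c; case: (gam [set u; v] 0 == pt u); split => //.
    apply: (@ctn_comp R _ (fun t => 1 - t) c1); apply: ctnD; [exact: ctn_cst | apply: ctnN; exact: ctn_id].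
  apply: (@ctn_comp R _ (fun t => 1 - t) c2); apply: ctnD; [exact: ctn_cst | apply: ctnN; exact: ctn_id].
- move=> u v uv s t; rewrite !in_itv /= => sI tI; have [_ ij] := simp _ (edgeI _ _ uv).
  have sI' := c01 _ sI; have tI' := c01 _ tI.
  rewrite /c; case: ifP => _; rewrite !clampE // => /ij; rewrite !in_itv /= => H; first exact: H.
  by have := H sI' tI'; lra.
- move=> u v uv; rewrite /c subr0 subrr !clampE ?lexx ?ler01 //.
  by case: (ends _ _ uv) => -[-> ->]; rewrite ?eqxx ?nadj.
- move=> u v w t uv tI; have tI' := c01' _ tI; rewrite /c; case: ifP => _; rewrite !cl //;
    by apply: vert (edgeI _ _ uv) _; rewrite in_itv.
move=> u v u' v' s t uv uv' sI tI; have sI' := c01' _ sI; have tI' := c01' _ tI.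
have [eE _|nE] := eqVneq [set u; v] [set u'; v'].
  have nab : u != v by apply/eqP => abE; move: uv; rewrite abE adj_irrefl.
  have := finset.set21 u v; rewrite eE !inE => /orP[]/eqP au; have := finset.set22 u v; rewrite eE !inE => /orP[]/eqP bv;
    move: nab; rewrite au bv ?eqxx // => _; by [left|right].
have H a b : 0 < a < 1 -> 0 < b < 1 -> gam [set u; v] a <> gam [set u'; v'] b.
  by move=> aI bI; apply: cross => //; rewrite ?edgeI ?in_itv.
by rewrite /c; case: ifP => _; case: ifP => _; rewrite !cl // => /H; case.
Qed.
End Drawn.

Section Exit.
Variable R : realType.

(** The times at which the curve is inside form a compact set; the exit time is its
    maximum. *)
Lemma last_exit (f : R -> R) (r : R) : ctn f -> f 0 <= r < f 1 ->
  exists tau, [/\ 0 <= tau < 1, f tau = r & forall t, tau < t <= 1 -> r < f t].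
Proof.
move=> cf /andP[f0 f1].
have cA : compact (`[0, 1] `&` f @^-1` [set x : R | x <= r])%classic.
  apply: compact_closedI; first exact: segment_compact.
  by move/continuous_closedP: cf; apply; exact: closed_le.
have A0 : (`[0, 1] `&` f @^-1` [set x : R | (x <= r)%R] !=set0)%classic.
  by exists 0; split => //=; rewrite in_itv /= lexx ler01.
have ci : {within (`[0, 1] `&` f @^-1` [set x : R | x <= r]), continuous id}%classic.
  by apply: continuous_subspaceT; exact: ctn_id.
have [tau] := compact_EVT_max A0 cA ci.
rewrite inE /= in_itv /= => -[/andP[t0 t1] ft] tmax.
have out t : tau < t <= 1 -> r < f t.
  move=> /andP[tt t1']; rewrite ltNge; apply/negP => ftr.
  have : t <= tau by apply: (tmax t); rewrite inE /= in_itv /=; split => //; rewrite t1' (le_trans t0 (ltW tt)).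
  by rewrite leNgt tt.
have tlt1 : tau < 1.
  by rewrite lt_neqAle t1 andbT; apply: contraTneq f1 => <-; rewrite -leNgt.
exists tau; split; rewrite ?t0 //.
have mm : Num.min (f tau) (f 1) <= r <= Num.max (f tau) (f 1).
  by rewrite ge_min ft /= le_max (ltW f1) orbT.
have [s sI fs] := IVT t1 (continuous_subspaceT cf) mm.
move: sI; rewrite in_itv /= => /andP[ts s1].
have [st|ne] := eqVneq s tau; first by rewrite -st.
by have := out s; rewrite fs ltxx lt_neqAle eq_sym ne ts s1 => /(_ isT).
Qed.

(** Lets finitely many choices of a sufficiently small number be made at once. *)
Lemma fin_small (I : finType) (Q : I -> R -> Prop) :
  (forall i, exists2 m, 0 < m & forall x, 0 < x <= m -> Q i x) ->
  exists2 m, 0 < m & forall x, 0 < x <= m -> forall i, Q i x.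
Proof.
move=> H.
have [m m0 Hm] : exists2 m, 0 < m & forall x, 0 < x <= m -> forall i, i \in enum I -> Q i x.
  elim: (enum I) => [|i s [m m0 IH]]; first by exists 1.
  have [k k0 Hk] := H i; exists (Num.min m k); first by rewrite lt_min m0.
  move=> x /andP[x0]; rewrite le_min => /andP[xm xk] j; rewrite inE => /orP[/eqP ->|js].
    by apply: Hk; rewrite x0.
  by apply: IH; rewrite // x0.
by exists m => // x xm i; apply: Hm; rewrite ?mem_enum.
Qed.

Lemma ctn_bound (f : R -> R) : ctn f -> exists2 M, 0 < M & forall t, 0 <= t <= 1 -> `|f t| <= M.
Proof.
move=> cf.
have [s1 _ H1] := @EVT_max R f 0 1 ler01 (continuous_subspaceT cf).
have [s2 _ H2] := @EVT_min R f 0 1 ler01 (continuous_subspaceT cf).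
exists (`|f s1| + `|f s2| + 1); first by rewrite ltr_wpDl // addr_ge0.
move=> t tI; have := H1 t; have := H2 t; rewrite in_itv /= tI => /(_ isT) A /(_ isT) B.
have := ler_norm (f s1); have := ler_norm (- f s2); rewrite normrN.
have := normr_ge0 (f s1); have := normr_ge0 (f s2).
rewrite ler_norml; move: (`|f s1|) (`|f s2|) => p q; lra.
Qed.

Lemma ctn_pos (f : R -> R) : ctn f -> (forall t, 0 <= t <= 1 -> 0 < f t) ->
  exists2 m, 0 < m & forall t, 0 <= t <= 1 -> m <= f t.
Proof.
move=> cf fp; have [s sI H] := @EVT_min R f 0 1 ler01 (continuous_subspaceT cf).
move: sI; rewrite in_itv /= => sI; exists (f s); first exact: fp.
by move=> t tI; apply: H; rewrite in_itv.
Qed.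
End Exit.

(** * Turning a drawing inside out *)

(** With [o] as origin, [b] is a point of the circle of radius [r] about the origin. The
    map [(invX, invY)] is the inversion about [b], followed by a similarity:
    it sends the circle to the line [invY = 0] and its outside to the
    half-plane [0 < invY], except that [b] goes to infinity. *)
Section Invert.
Variables (R : realType) (o b : R * R).
(** The squared distances to [o + b] and to [o]. *)
Definition offb (z : R * R) := (z.1 - o.1 - b.1) ^+ 2 + (z.2 - o.2 - b.2) ^+ 2.
Definition offo (z : R * R) := (z.1 - o.1) ^+ 2 + (z.2 - o.2) ^+ 2.
Definition invX z := (b.1 * (z.2 - o.2) - b.2 * (z.1 - o.1)) / offb z.
Definition invY z := (offo z - (b.1 ^+ 2 + b.2 ^+ 2)) / (2 * offb z).

(** The inverted vector is the vector from [o + b] divided by its squared length;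
    it is an affine function of [invX] and [invY], and its own squared length
    recovers the one of the original vector. *)
Lemma inv_inj z z' : 0 < b.1 ^+ 2 + b.2 ^+ 2 -> offb z != 0 -> offb z' != 0 ->
  invX z = invX z' -> invY z = invY z' -> z = z'.
Proof.
move=> r0 n0 n0'.
pose A z := (z.1 - o.1 - b.1) / offb z; pose B z := (z.2 - o.2 - b.2) / offb z.
have AE y : offb y != 0 -> A y = (b.1 * (invY y - 1 / 2) - b.2 * invX y) / (b.1 ^+ 2 + b.2 ^+ 2).
  move=> ny; have r1 : b.1 ^+ 2 + b.2 ^+ 2 != 0 by rewrite gt_eqF.
  apply: (mulIf r1); rewrite divfK // /A /invX /invY.
  have -> : offo y = offb y + 2 * (b.1 * (y.1 - o.1 - b.1) + b.2 * (y.2 - o.2 - b.2)) + (b.1 ^+ 2 + b.2 ^+ 2).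
    by rewrite /offo /offb; ring.
  move: ny; move: (offb y) => n ny; field; exact: ny.
have BE y : offb y != 0 -> B y = (b.2 * (invY y - 1 / 2) + b.1 * invX y) / (b.1 ^+ 2 + b.2 ^+ 2).
  move=> ny; have r1 : b.1 ^+ 2 + b.2 ^+ 2 != 0 by rewrite gt_eqF.
  apply: (mulIf r1); rewrite divfK // /B /invX /invY.
  have -> : offo y = offb y + 2 * (b.1 * (y.1 - o.1 - b.1) + b.2 * (y.2 - o.2 - b.2)) + (b.1 ^+ 2 + b.2 ^+ 2).
    by rewrite /offo /offb; ring.
  move: ny; move: (offb y) => n ny; field; exact: ny.
have nE y : offb y != 0 -> offb y = (A y ^+ 2 + B y ^+ 2)^-1.
  move=> ny; apply: invr_inj; rewrite invrK /A /B !expr_div_n -mulrDl.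
  by rewrite -/(offb y) expr2 invfM mulrA mulfV // mul1r.
move=> eX eY.
have eA : A z = A z' by rewrite !AE // eX eY.
have eB : B z = B z' by rewrite !BE // eX eY.
have en : offb z = offb z' by rewrite nE // (nE z') // eA eB.
move: eA eB; rewrite /A /B en => /(mulIf (invr_neq0 n0')) e1 /(mulIf (invr_neq0 n0')) e2.
by case: z z' e1 e2 {eX eY en n0 n0'} => z1 z2 [z1' z2'] /= e1 e2; congr pair; lra.
Qed.

Lemma offb_neq0 z : z <> (o.1 + b.1, o.2 + b.2) -> offb z != 0.
Proof.
move=> nz; apply/negP => /eqP n0; apply: nz; case: z n0 => z1 z2; rewrite /offb /= => n0.
have := sqr_ge0 (z1 - o.1 - b.1); have := sqr_ge0 (z2 - o.2 - b.2) => s2 s1.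
have /eqP : (z1 - o.1 - b.1) ^+ 2 = 0 by lra.
have /eqP : (z2 - o.2 - b.2) ^+ 2 = 0 by lra.
rewrite !sqrf_eq0 => /eqP e2 /eqP e1; congr pair; lra.
Qed.
End Invert.

Section CirclePoint.
Variable R : realType.
(** The inversion is about a point of the circle that no edge passes at its last exit.
    The rational parametrization gives infinitely many points of the circle, hence one
    off any finite set. *)
Lemma circle_avoid (I : finType) (a : I -> R * R) (r : R) : 0 < r ->
  exists b : R * R, b.1 ^+ 2 + b.2 ^+ 2 = r ^+ 2 /\ forall i, a i <> b.
Proof.
move=> r0; pose d (n : nat) : R := 1 + n%:R ^+ 2.
pose be (n : nat) : R * R := (r * (1 - n%:R ^+ 2) / d n, r * (2 * n%:R) / d n).
have d0 n : d n != 0 by rewrite gt_eqF // /d ltr_wpDr // sqr_ge0.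
have beC n : (be n).1 ^+ 2 + (be n).2 ^+ 2 = r ^+ 2.
  rewrite /be /=; have := d0 n; rewrite /d => H; field; exact: H.
have be_inj n m : be n = be m -> n = m.
  move=> [] e1 e2; have rn : r != 0 by rewrite gt_eqF.
  have g k : 2 * r / d k = r + r * (1 - k%:R ^+ 2) / d k.
    by have := d0 k; rewrite /d => H; field.
  have dE : d n = d m.
    have : 2 * r / d n = 2 * r / d m by rewrite !g e1.
    have r2 : 2 * r != 0 by rewrite mulf_neq0 // pnatr_eq0.
    by move/(mulfI r2)/invr_inj.
  move: e2; rewrite dE => /(mulIf (invr_neq0 (d0 m))) /(mulfI rn).
  have t0 : (2 : R) != 0 by rewrite pnatr_eq0.
  by move/(mulfI t0)/eqP; rewrite eqr_nat => /eqP.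
have [n Hn] : exists n : 'I_#|I|.+1, forall i, a i <> be n.
  apply: contrapT => H.
  have /choice[f Hf] : forall n : 'I_#|I|.+1, exists i, a i = be n.
    by move=> n; apply: contrapT => Hn; apply: H; exists n => i e; apply: Hn; exists i.
  have fi : injective f by move=> n m e; apply/val_inj/be_inj; rewrite -!Hf e.
  by have := leq_card f fi; rewrite card_ord ltnn.
by exists (be n).
Qed.
End CirclePoint.
(** The edges of [G] after the edge [uv] is replaced by the two edges from the new
    vertex [None]; the edges at [u] only occur directed away from [u], the one between
    [None] and [v] only towards [v], all others in both directions. *)
Definition sube (G : simple_graph) (u v : G) (x y : option G) : bool :=
  match x, y with
  | Some a, Some b => [&& adj a b, b != u & ~~ ((a == u) && (b == v))]
  | Some a, None => a == u
  | None, Some b => b == v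
  | None, None => false
  end.
(** The region between the segment from (0, 0) to (1, 0) and the two lines of slopes
    1 and -1 through its ends. Two affine images of it fit side by side into a
    [diamond]. *)
Definition halfdiamond (R : realType) (z : R * R) := [&& 0 <= z.2, z.2 < z.1 & z.2 < 1 - z.1].

Section Sub.
Variable R : realType.
Variables (G : simple_graph) (P : G -> R * R) (c : G -> G -> R -> R * R) (u : G).
Hypothesis D : drawn (fun x y : G => adj x y) P c.

(** Only finitely many vertices and compact curves have to be kept away from [u]. *)
Lemma small_radius : exists2 r, 0 < r & [/\ forall x, x != u -> r ^+ 2 < offo (P u) (P x) &
  forall x y t, adj x y -> x != u -> y != u -> 0 <= t <= 1 -> r ^+ 2 < offo (P u) (c x y t)].
Proof.
have op z : z <> P u -> 0 < offo (P u) z.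
  move=> nz; have : offo (P u) z != 0.
    have := @offb_neq0 R (P u) (0, 0) z; rewrite /offb /offo /= !subr0 !addr0.
    by apply; move: nz; case: (P u).
  by rewrite lt_neqAle eq_sym => ->; rewrite addr_ge0 // sqr_ge0.
have [m m0 Hm] : exists2 m, 0 < m & forall x : R, 0 < x <= m -> forall a : G, a != u -> x < offo (P u) (P a).
  apply: (fin_small (Q := fun a x => a != u -> x < offo (P u) (P a))) => a.
  have [->|au] := eqVneq a u; first by exists 1.
  have o0 : 0 < offo (P u) (P a) by apply: op => /(drawn_inj D) /eqP; rewrite (negbTE au).
  exists (offo (P u) (P a) / 2); first by rewrite divr_gt0.
  by move=> x xm _; lra.
have [k k0 Hk] : exists2 m, 0 < m & forall x : R, 0 < x <= m -> forall a : G * G,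
    adj a.1 a.2 -> a.1 != u -> a.2 != u -> forall t, 0 <= t <= 1 -> x < offo (P u) (c a.1 a.2 t).
  apply: (fin_small (Q := fun a x => adj a.1 a.2 -> a.1 != u -> a.2 != u ->
     forall t, 0 <= t <= 1 -> x < offo (P u) (c a.1 a.2 t))) => -[x y] /=.
  have [[xy [xu yu]]|H] := pselect (adj x y /\ x != u /\ y != u); last first.
    by exists 1 => // ? _ ? ? ?; case: H.
  have [c1 c2] := drawn_ctn D xy; have [e0 e1] := drawn_ends D xy.
  have cf : ctn (fun t => offo (P u) (c x y t)).
    rewrite /offo; apply: ctnD; (apply: ctnM; apply: ctnD => //; exact: ctn_cst).
  have [t tI|m' m'0 Hm'] := ctn_pos cf.
    apply: op => e; case/andP: tI; rewrite le_eqVlt => /orP[/eqP t0|t0].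
      by move: e; rewrite -t0 e0 => /(drawn_inj D)/eqP; rewrite (negbTE xu).
    rewrite le_eqVlt => /orP[/eqP t1|t1].
      by move: e; rewrite t1 e1 => /(drawn_inj D)/eqP; rewrite (negbTE yu).
    by apply: (drawn_vertex D xy _ e); rewrite t0.
  exists (m' / 2); first by rewrite divr_gt0.
  by move=> z zm _ _ _ t /Hm'; lra.
(* A radius of at most 1 is at least its square. *)
pose w := Num.min 1 (Num.min m k).
have w0 : 0 < w by rewrite !lt_min ltr01 m0.
have wle1 : w <= 1 by rewrite /w ge_min lexx.
have w1 : w ^+ 2 <= w by rewrite expr2 ler_piMr // ltW.
have wm : w ^+ 2 <= m by apply: le_trans w1 _; rewrite /w !ge_min lexx orbT.
have wk : w ^+ 2 <= k by apply: le_trans w1 _; rewrite /w !ge_min lexx !orbT.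
have w20 : 0 < w ^+ 2 by rewrite exprn_gt0.
exists w => //; split=> [x xu|x y t xy xu yu tI]; first by apply: Hm => //; rewrite w20.
by apply: (Hk _ _ (x, y)) => //; rewrite w20.
Qed.

(** After its last exit from the disc an edge at [u] stays outside, so that its tail
    survives the inversion; the part before is discarded. *)
Lemma exits r : 0 < r -> (forall x, x != u -> r ^+ 2 < offo (P u) (P x)) ->
  exists tau : G -> R, forall v, adj u v ->
    [/\ 0 < tau v < 1, offo (P u) (c u v (tau v)) = r ^+ 2 &
        forall t, tau v < t <= 1 -> r ^+ 2 < offo (P u) (c u v t)].
Proof.
move=> r0 far; have /choice[tau Ht] : forall v, exists tau : R, adj u v ->
    [/\ 0 < tau < 1, offo (P u) (c u v tau) = r ^+ 2 &
        forall t, tau < t <= 1 -> r ^+ 2 < offo (P u) (c u v t)]; last by exists tau.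
move=> v; have [uv|] := boolP (adj u v); last by exists 0.
have [c1 c2] := drawn_ctn D uv; have [e0 e1] := drawn_ends D uv.
have cf : ctn (fun t => offo (P u) (c u v t)).
  by rewrite /offo; apply: ctnD; (apply: ctnM; apply: ctnD => //; exact: ctn_cst).
have o0 : offo (P u) (P u) = 0 by rewrite /offo !subrr expr0n /= addr0.
have [|tau [/andP[t0 t1] ft out]] := @last_exit R _ (r ^+ 2) cf.
  rewrite e0 e1 o0 sqr_ge0 /=; apply: far; apply/eqP => vu; move: uv; rewrite vu adj_irrefl //.
exists tau => _; split => //; rewrite t1 andbT lt_neqAle t0 andbT.
apply/eqP => t0'; move: ft; rewrite -t0' e0 o0 => /eqP; rewrite eq_sym expf_eq0 /= gt_eqF //.
Qed.

Section Placed.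
Variables (r : R) (tau : G -> R) (b : R * R).
Hypothesis r0 : 0 < r.
Hypothesis far : forall x, x != u -> r ^+ 2 < offo (P u) (P x).
Hypothesis farc : forall x y t, adj x y -> x != u -> y != u -> 0 <= t <= 1 ->
  r ^+ 2 < offo (P u) (c x y t).
Hypothesis tauP : forall v, adj u v ->
    [/\ 0 < tau v < 1, offo (P u) (c u v (tau v)) = r ^+ 2 &
        forall t, tau v < t <= 1 -> r ^+ 2 < offo (P u) (c u v t)].
Hypothesis bC : b.1 ^+ 2 + b.2 ^+ 2 = r ^+ 2.
Hypothesis bN : forall v, adj u v -> c u v (tau v) <> ((P u).1 + b.1, (P u).2 + b.2).

Let r2 : 0 < r ^+ 2. Proof. by rewrite exprn_gt0. Qed.
Let br : 0 < b.1 ^+ 2 + b.2 ^+ 2. Proof. by rewrite bC. Qed.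

Lemma out_offb z : r ^+ 2 < offo (P u) z -> offb (P u) b z != 0.
Proof.
move=> oz; apply: offb_neq0 => zb; move: oz; rewrite zb /offo /=.
have -> : ((P u).1 + b.1 - (P u).1) ^+ 2 + ((P u).2 + b.2 - (P u).2) ^+ 2 = r ^+ 2 by rewrite -bC; ring.
by rewrite ltxx.
Qed.

Lemma offb_gt0 z : offb (P u) b z != 0 -> 0 < offb (P u) b z.
Proof. by move=> nz; rewrite lt_neqAle eq_sym nz addr_ge0 // sqr_ge0. Qed.
Lemma out_invY z : r ^+ 2 < offo (P u) z -> 0 < invY (P u) b z.
Proof.
move=> oz; rewrite /invY bC divr_gt0 ?subr_gt0 // mulr_gt0 // offb_gt0 //; exact: out_offb.
Qed.

(** An edge at [u] is reparametrized: it waits at its exit point during the first half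
    of the time, while a segment is drawn, and runs through its tail during the second. *)
Definition stretch v (t : R) := tau v + Num.max 0 (2 * t - 1) * (1 - tau v).
Definition tailed x y t := c x y (if x == u then stretch y t else t).

Lemma stretch1 v t : 2 * t <= 1 -> stretch v t = tau v.
Proof. by move=> t2; rewrite /stretch max_l ?mul0r ?addr0 //; lra. Qed.
Lemma stretch2 v t : 1 < 2 * t -> stretch v t = tau v + (2 * t - 1) * (1 - tau v).
Proof. by move=> t2; rewrite /stretch max_r //; lra. Qed.
Lemma stretch_itv v t : adj u v -> 1 < 2 * t -> t <= 1 ->
  tau v < stretch v t <= 1 /\ (t < 1 -> stretch v t < 1).
Proof.
move=> /tauP[/andP[a0 a1] _ _] t2 t1; rewrite stretch2 //; split; first by apply/andP; split; nra.
by move=> t1'; nra.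
Qed.

Lemma tailed_off x y t : adj x y -> y != u -> 0 <= t <= 1 -> offb (P u) b (tailed x y t) != 0.
Proof.
move=> xy yu tI; rewrite /tailed; case: (eqVneq x u) xy => [->|xu] xy; last first.
  by apply: out_offb; exact: farc.
have [a0 a1 a2] := tauP xy.
have [t2|t2] := leP (2 * t) 1; first by rewrite stretch1 //; apply: offb_neq0; exact: bN.
have t1 : t <= 1 by case/andP: tI.
by apply: out_offb; apply: a2; have [] := stretch_itv xy t2 t1.
Qed.

Lemma tailed_ctn x y : adj x y -> y != u ->
  ctn (fun t => invX (P u) b (tailed x y (clamp t))) /\ ctn (fun t => invY (P u) b (tailed x y (clamp t))).
Proof.
move=> xy yu; have [c1 c2] := drawn_ctn D xy.
pose s t := if x == u then stretch y (clamp t) else clamp t.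
have cs : ctn s.
  rewrite /s; case: (x == u); last exact: ctn_clamp.
  rewrite /stretch; apply: ctnD; first exact: ctn_cst.
  apply: ctnM; last exact: ctn_cst.
  apply: ctn_max; first exact: ctn_cst.
  apply: ctnD; last exact: ctn_cst.
  by apply: ctnM; [exact: ctn_cst|exact: ctn_clamp].
have d1 : ctn (fun t => (tailed x y (clamp t)).1) := ctn_comp c1 cs.
have d2 : ctn (fun t => (tailed x y (clamp t)).2) := ctn_comp c2 cs.
have no t : offb (P u) b (tailed x y (clamp t)) != 0 by apply: tailed_off => //; exact: clamp_itv.
have cb : ctn (fun t => offb (P u) b (tailed x y (clamp t))).
  by rewrite /offb; apply: ctnD; (apply: ctnM; (do 2 (apply: ctnD; last exact: ctn_cst))).
have co : ctn (fun t => offo (P u) (tailed x y (clamp t))).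
  by rewrite /offo; apply: ctnD; (apply: ctnM; (apply: ctnD; last exact: ctn_cst)).
split.
  rewrite /invX; apply: ctnM; last by apply: ctnV.
  apply: ctnD; last apply: ctnN; (apply: ctnM; first exact: ctn_cst); by apply: ctnD => //; exact: ctn_cst.
rewrite /invY; apply: ctnM; first by apply: ctnD => //; exact: ctn_cst.
apply: ctnV => [t|]; first by rewrite mulf_neq0 // pnatr_eq0.
by apply: ctnM => //; exact: ctn_cst.
Qed.

(** The inverted drawing is bounded, hence it can be shrunk into a box of half-width
    1/16. *)
Lemma small_scale : exists2 e, 0 < e &
  (forall x, x != u -> e * `|invX (P u) b (P x)| <= 16^-1 /\ e * `|invY (P u) b (P x)| <= 16^-1) /\
  (forall x y t, adj x y -> y != u -> 0 <= t <= 1 ->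
    e * `|invX (P u) b (tailed x y t)| <= 16^-1 /\ e * `|invY (P u) b (tailed x y t)| <= 16^-1).
Proof.
have aux (M N : R) : 0 < M -> 0 <= N <= M -> forall e, 0 < e <= (16 * M)^-1 -> e * N <= 16^-1.
  move=> M0 /andP[N0 NM] e /andP[e0]; rewrite invfM => eM.
  apply: le_trans (_ : e * M <= _); first by rewrite ler_pM2l.
  apply: le_trans (_ : (16^-1 * M^-1) * M <= _); first by rewrite ler_pM2r.
  by rewrite divfK // gt_eqF.
have [m m0 Hm] : exists2 m, 0 < m & forall e, 0 < e <= m -> forall x,
   e * `|invX (P u) b (P x)| <= 16^-1 /\ e * `|invY (P u) b (P x)| <= 16^-1.
  apply: (fin_small (Q := fun x e => e * `|invX (P u) b (P x)| <= 16^-1 /\ e * `|invY (P u) b (P x)| <= 16^-1)) => x.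
  set p := `|_|; set q := `|_|; have p0 : 0 <= p by exact: normr_ge0. have q0 : 0 <= q by exact: normr_ge0.
  have M0 : 0 < 1 + p + q by lra.
  exists (16 * (1 + p + q))^-1; first by rewrite invr_gt0 mulr_gt0.
  by move=> e eI; split; apply: (aux _ _ M0 _ _ eI); lra.
have [k k0 Hk] : exists2 m, 0 < m & forall e, 0 < e <= m -> forall xy : G * G,
   adj xy.1 xy.2 -> xy.2 != u -> forall t, 0 <= t <= 1 ->
   e * `|invX (P u) b (tailed xy.1 xy.2 t)| <= 16^-1 /\ e * `|invY (P u) b (tailed xy.1 xy.2 t)| <= 16^-1.
  apply: (fin_small (Q := fun xy e => adj xy.1 xy.2 -> xy.2 != u -> forall t, 0 <= t <= 1 ->
   e * `|invX (P u) b (tailed xy.1 xy.2 t)| <= 16^-1 /\ e * `|invY (P u) b (tailed xy.1 xy.2 t)| <= 16^-1)) => -[x y] /=.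
  have [[xy yu]|H] := pselect (adj x y /\ y != u); last by exists 1 => // ? _ ? ?; case: H.
  have [c1 c2] := tailed_ctn xy yu.
  have [M M0 HM] := ctn_bound c1; have [N N0 HN] := ctn_bound c2.
  have MN : 0 < M + N by rewrite addr_gt0.
  exists (16 * (M + N))^-1; first by rewrite invr_gt0 mulr_gt0.
  move=> e eI _ _ t tI; have := HM t tI; have := HN t tI; rewrite clampE //.
  move=> h1 h2; split; apply: (aux _ _ MN _ _ eI); rewrite normr_ge0 /=.
    by apply: le_trans h2 _; rewrite lerDl ltW.
  by apply: le_trans h1 _; rewrite lerDr ltW.
exists (Num.min m k); first by rewrite lt_min m0.
have mk0 : 0 < Num.min m k by rewrite lt_min m0.
split=> [x _|x y t xy yu tI]; first by apply: Hm; rewrite mk0 ge_min lexx.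
by apply: (Hk _ _ (x, y)) => //; rewrite mk0 ge_min lexx orbT.
Qed.
Variable e : R.
Hypothesis e0 : 0 < e.
Hypothesis eP : forall x, x != u -> e * `|invX (P u) b (P x)| <= 16^-1 /\ e * `|invY (P u) b (P x)| <= 16^-1.
Hypothesis eC : forall x y t, adj x y -> y != u -> 0 <= t <= 1 ->
    e * `|invX (P u) b (tailed x y t)| <= 16^-1 /\ e * `|invY (P u) b (tailed x y t)| <= 16^-1.

(** The box stands on the point (1/2, 1/4), inside the half diamond: the images of the
    exit points lie on the line of height 1/4, everything else lies above it. *)
Definition flat z := (1 / 2 + e * invX (P u) b z, 1 / 4 + e * invY (P u) b z).
Definition exitx v := (flat (c u v (tau v))).1.
(** A segment from [(x0, 0)] up to the image of the exit point, followed by the image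
    of the tail. *)
Definition arm (x0 : R) v (t : R) :=
  (x0 + Num.min 1 (2 * t) * ((flat (tailed u v t)).1 - x0), Num.min 1 (2 * t) * (flat (tailed u v t)).2).

Lemma flat_inj z z' : offb (P u) b z != 0 -> offb (P u) b z' != 0 -> flat z = flat z' -> z = z'.
Proof.
move=> nz nz' [] h1 h2; have en : e != 0 by rewrite gt_eqF.
by apply: (inv_inj br nz nz'); apply: (mulfI en); lra.
Qed.

Lemma flat_bound z : e * `|invX (P u) b z| <= 16^-1 -> e * `|invY (P u) b z| <= 16^-1 ->
  [/\ 7 / 16 <= (flat z).1, (flat z).1 <= 9 / 16 & (flat z).2 <= 5 / 16].
Proof.
have k x : e * `|x| = `|e * x| by rewrite normrM (gtr0_norm e0).
rewrite !k !ler_norml => /andP[h1 h2] /andP[h3 h4].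
by rewrite /flat /=; split; lra.
Qed.

Lemma flat_high z : r ^+ 2 < offo (P u) z -> 1 / 4 < (flat z).2.
Proof. by move=> /out_invY h; rewrite /flat /= ltrDl mulr_gt0. Qed.
Lemma high_half z : r ^+ 2 < offo (P u) z -> e * `|invX (P u) b z| <= 16^-1 ->
  e * `|invY (P u) b z| <= 16^-1 -> halfdiamond (flat z).
Proof.
move=> h1 h2 h3; have [k1 k2 k3] := flat_bound h2 h3; have k4 := flat_high h1.
by rewrite /halfdiamond; apply/and3P; split; lra.
Qed.

Lemma exit_low v : adj u v -> (flat (c u v (tau v))).2 = 1 / 4.
Proof. by case/tauP => _ h _; rewrite /flat /= /invY h bC subrr mul0r mulr0 addr0. Qed.
Lemma adj_neq (x y : G) : adj x y -> y != x.
Proof. by move=> xy; apply/eqP => xyE; move: xy; rewrite xyE adj_irrefl. Qed.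
Lemma exitx_bound v : adj u v -> 7 / 16 <= exitx v <= 9 / 16.
Proof.
move=> uv; have h0 : 0 <= (0 : R) <= 1 by rewrite lexx ler01.
have [h1 h2] := eC uv (adj_neq uv) h0; move: h1 h2; rewrite /tailed eqxx stretch1 ?mulr0 // => h1 h2.
by have [k1 k2 _] := flat_bound h1 h2; rewrite /exitx k1.
Qed.

Lemma armP x0 v t : adj u v -> t <= 1 ->
  (2 * t <= 1 /\ arm x0 v t = (x0 + 2 * t * (exitx v - x0), t / 2)) \/
  [/\ 1 < 2 * t, arm x0 v t = flat (c u v (stretch v t)), tau v < stretch v t <= 1, t < 1 -> stretch v t < 1 &
      halfdiamond (arm x0 v t) /\ 1 / 4 < (arm x0 v t).2].
Proof.
move=> uv t1; have [t2|t2] := leP (2 * t) 1; [left|right].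
  split=> //; rewrite /arm /tailed eqxx stretch1 // exit_low // min_r //; congr pair; by field.
have aE : arm x0 v t = flat (c u v (stretch v t)).
  by rewrite /arm /tailed eqxx min_l ?ltW // !mul1r addrC subrK -surjective_pairing.
have [s1 s2] := stretch_itv uv t2 t1.
have [_ _ /(_ _ s1) out] := tauP uv.
split=> //; rewrite aE; split; last exact: flat_high.
have tI : 0 <= t <= 1 by rewrite t1 andbT; lra.
have [h1 h2] := eC uv (adj_neq uv) tI; move: h1 h2; rewrite /tailed eqxx => h1 h2.
exact: high_half.
Qed.

Lemma arm_half x0 v t : adj u v -> 0 < t <= 1 -> (x0 = 0 \/ x0 = 1) -> halfdiamond (arm x0 v t) /\ 0 < (arm x0 v t).2.
Proof.
move=> uv /andP[t0 t1] x01; case: (armP x0 uv t1) => [[t2 ->]|[_ _ _ _ [h h']]]; last by split=> //; lra.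
have /andP[h1 h2] := exitx_bound uv; rewrite /halfdiamond /=.
by case: x01 => ->; (split; first apply/and3P; last lra); split; nra.
Qed.

Lemma arm_inj x0 v : adj u v -> {in `[0, 1] &, injective (arm x0 v)}.
Proof.
move=> uv s t; rewrite !in_itv /= => /andP[s0 s1] /andP[t0 t1].
have [/andP[a0 a1] _ out] := tauP uv.
case: (armP x0 uv s1) => [[s2 ->]|[s2 sE sI _ [_ sh]]]; case: (armP x0 uv t1) => [[t2 ->]|[t2 tE tI _ [_ th]]].
- by case=> _; lra.
- by move=> E; move: th; rewrite -E /=; lra.
- by move=> E; move: sh; rewrite E /=; lra.
rewrite sE tE => /flat_inj; rewrite !out_offb ?out // => /(_ isT isT).
move/(drawn_simple D uv); rewrite !in_itv /= => H.
have : stretch v s = stretch v t by apply: H; [case/andP: sI|case/andP: tI]; lra.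
by rewrite !stretch2 // => /addrI /(mulIf _) H'; have : 1 - tau v != 0 by [lra]; move/H'; lra.
Qed.

Definition sub_pos (x : option G) : R * R :=
  if x is Some a then if a == u then (0, 0) else flat (P a) else (1, 0).
Definition sub_curve (x y : option G) (t : R) : R * R :=
  match x, y with
  | Some a, Some a' => if a == u then arm 0 a' (clamp t) else flat (tailed a a' (clamp t))
  | None, Some a => arm 1 a (clamp t)
  | _, None => (t, 0)
  end.

(** A point of a curve is on the part above height 1/4, which comes from the old drawing,
    on a segment from (0, 0), on the segment from (1, 0), or on the base. *)
Lemma sub_curve_cases v x y t : adj u v -> sube u v x y -> 0 < t < 1 ->
  [\/ exists a a' s, [/\ (x = Some a /\ y = Some a') \/ [/\ x = None, y = Some v, a = u & a' = v],
        adj a a', 0 < s < 1, r ^+ 2 < offo (P u) (c a a' s) &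
        sub_curve x y t = flat (c a a' s) /\ halfdiamond (sub_curve x y t)],
      exists a', [/\ x = Some u, y = Some a', adj u a', a' != v & 2 * t <= 1 /\ sub_curve x y t = (2 * t * exitx a', t / 2)],
      [/\ x = None, y = Some v, 2 * t <= 1 & sub_curve x y t = (1 + 2 * t * (exitx v - 1), t / 2)]
    | [/\ x = Some u, y = None & sub_curve x y t = (t, 0)]].
Proof.
move=> uv xy tI; have /andP[t0 t1] := tI; have tI' : 0 <= t <= 1 by rewrite !ltW.
case: x xy => [a|]; case: y => [a'|] //=.
- case/and3P => aa' a'u nav; rewrite clampE //; case: (eqVneq a u) aa' nav => [->|au] aa' nav.
    case: (armP 0 aa' (ltW t1)) => [[t2 aE]|[t2 aE sI sI' [h _]]].
      apply: Or42; exists a'; split=> //; split => //; rewrite aE; congr pair; ring.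
    have [/andP[b0 _] _ out] := tauP aa'.
    apply: Or41; exists u, a', (stretch a' t); split=> //; [by left| |exact: out].
    by rewrite sI' // andbT; case/andP: sI => /(lt_trans b0).
  apply: Or41; exists a, a', t; split=> //; [by left|exact: farc|].
  have [h1 h2] := eC aa' a'u tI'; move: h1 h2; rewrite /tailed (negbTE au) => h1 h2.
  by split=> //; apply: high_half => //; exact: farc.
- by move/eqP->; apply: Or44.
move/eqP->; rewrite clampE //; case: (armP 1 uv (ltW t1)) => [[t2 aE]|[t2 aE sI sI' [h _]]].
  by apply: Or43; split.
have [/andP[b0 _] _ out] := tauP uv.
apply: Or41; exists u, v, (stretch v t); split=> //; [by right| |exact: out].
by rewrite sI' // andbT; case/andP: sI => /(lt_trans b0).
Qed.

(** All segments from (0, 0) meet only there. The segment from (1, 0) stays to the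
    right of them because [v] is the neighbour of [u] whose exit point has the image
    farthest to the right; this choice of [v] is what makes the drawing planar. *)
Lemma sub_drawn v : adj u v -> (forall x, adj u x -> exitx x <= exitx v) ->
  drawn (sube u v) sub_pos sub_curve.
Proof.
move=> uv vmax.
have flatP_high a : a != u -> 1 / 4 < (flat (P a)).2 by move=> au; apply: flat_high; exact: far.
have Pinj := drawn_inj D.
have exit_inj x y : adj u x -> adj u y -> exitx x = exitx y -> x = y.
  move=> ux uy exy; have [xI nx _] := tauP ux; have [yI ny _] := tauP uy.
  have : c u x (tau x) = c u y (tau y).
    apply: flat_inj; try by apply: offb_neq0; exact: bN.
    by rewrite [LHS]surjective_pairing [RHS]surjective_pairing !exit_low // -/(exitx x) exy.
  by move/(drawn_cross D ux uy xI yI); case=> [[]|[-> <-]].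
have lowq : 0 < 16^-1 :> R by rewrite invr_gt0.
split.
- move=> [a|] [a'|] //=; last 2 first.
  + by case: (eqVneq a u) => [_ |/flatP_high h] E; exfalso; [move: (congr1 fst E) => /=; lra|move: h; rewrite E /=; lra].
  + by case: (eqVneq a' u) => [_ |/flatP_high h] E; exfalso; [move: (congr1 fst E) => /=; lra|move: h; rewrite -E /=; lra].
  case: eqP => [->|/eqP au]; case: eqP => [->|/eqP a'u] //.
  + by move=> E; exfalso; have := flatP_high _ a'u; rewrite -E /=; lra.
  + by move=> E; exfalso; have := flatP_high _ au; rewrite E /=; lra.
  by move/flat_inj; rewrite !out_offb ?far // => /(_ isT isT)/Pinj ->.
- have cm : ctn (fun t => Num.min 1 (2 * clamp t) : R).
    by apply: ctn_min; [exact: ctn_cst|apply: ctnM; [exact: ctn_cst|exact: ctn_clamp]].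
  have cflat a a' : adj a a' -> a' != u ->
     ctn (fun t => (flat (tailed a a' (clamp t))).1) /\ ctn (fun t => (flat (tailed a a' (clamp t))).2).
    move=> aa' a'u; have [c1 c2] := tailed_ctn aa' a'u.
    by split; (apply: ctnD; [exact: ctn_cst | apply: ctnM => //; exact: ctn_cst]).
  have carm x0 a : adj u a -> ctn (fun t => (arm x0 a (clamp t)).1) /\ ctn (fun t => (arm x0 a (clamp t)).2).
    move=> ua; have [c1 c2] := cflat _ _ ua (adj_neq ua); rewrite /arm /=; split; last exact: ctnM.
    by apply: ctnD; [exact: ctn_cst|apply: ctnM => //; apply: ctnD => //; exact: ctn_cst].
  move=> [a|] [a'|] //=; last 2 first.
  + by move=> _; split; [exact: ctn_id|exact: ctn_cst].
  + by move/eqP->; exact: carm.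
  by case/and3P => aa' a'u _; case: eqP aa' => [->|_] aa'; [exact: carm|exact: cflat].
- move=> [a|] [a'|] //=; last 2 first.
  + by move=> _ s t _ _ [].
  + move/eqP-> => s t sI tI; move: (sI) (tI); rewrite !in_itv /= => sI' tI'.
    by rewrite !clampE // => /arm_inj -> //.
  case/and3P => aa' a'u _ s t sI tI; move: (sI) (tI); rewrite !in_itv /= => sI' tI'.
  rewrite !clampE //; case: eqP aa' => [->|/eqP au] aa'; first by move/arm_inj->.
  rewrite /tailed (negbTE au) => /flat_inj; rewrite !out_offb ?farc // => /(_ isT isT).
  by move/(drawn_simple D aa')->.
- have c0 : clamp 0 = 0 :> R by rewrite clampE // lexx ler01.
  have c1 : clamp 1 = 1 :> R by rewrite clampE // lexx ler01.
  have arm0 x0 a : adj u a -> arm x0 a 0 = (x0, 0).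
    by move=> _; rewrite /arm mulr0 min_r ?ler01 // !mul0r addr0.
  have arm1 x0 a : adj u a -> arm x0 a 1 = flat (P a).
    move=> ua; have l1 : (1 : R) <= 1 by [].
    case: (armP x0 ua l1) => [[]|[t2 -> _ _ _]]; first by rewrite mulr1 => t2; exfalso; lra.
    rewrite stretch2 // mulr1; have -> : tau a + (2 - 1) * (1 - tau a) = 1 by ring.
    by have [_ ->] := drawn_ends D ua.
  move=> [a|] [a'|] //=; last 2 first.
  + by move/eqP->; rewrite eqxx.
  + by move/eqP->; rewrite (negbTE (adj_neq uv)) c0 c1 arm0 ?arm1.
  case/and3P => aa' a'u _; rewrite c0 c1 (negbTE a'u); case: eqP aa' => [->|/eqP au] aa'.
    by rewrite arm0 ?arm1.
  by rewrite /tailed (negbTE au); have [-> ->] := drawn_ends D aa'.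
- move=> x y w t xy tI; have /andP[t0 t1] := tI.
  case: (sub_curve_cases uv xy tI) => [[a [a' [s [_ aa' sI out [-> _]]]]]|[a' [_ _ _ _ [t2 ->]]]|[_ _ t2 ->]|[_ _ ->]].
  + case: w => [w|] /=; last by move=> E; have := flat_high out; rewrite E /=; lra.
    case: eqP => [_|/eqP wu] E; first by have := flat_high out; rewrite E /=; lra.
    move/flat_inj: E; rewrite !out_offb ?far // => /(_ isT isT); exact: (drawn_vertex D aa' sI).
  + case: w => [w|] /=; last by case=> _; lra.
    by case: eqP => [_ []|/eqP wu E]; [lra | have := flatP_high _ wu; rewrite -E /=; lra].
  + case: w => [w|] /=; last by case=> _; lra.
    by case: eqP => [_ []|/eqP wu E]; [lra | have := flatP_high _ wu; rewrite -E /=; lra].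
  case: w => [w|] /=; last by case; lra.
  by case: eqP => [_ []|/eqP wu E]; [lra | have := flatP_high _ wu; rewrite -E /=; lra].
move=> x y x' y' s t xy xy' sI tI; have /andP[s0 s1] := sI; have /andP[t0 t1] := tI.
have nuv a a' : a' != u -> u = a' /\ v = a -> False by move=> /eqP h [h' _]; apply: h.
case: (sub_curve_cases uv xy sI) => [[a [a' [q [ce aa' qI out [E _]]]]]|[a' [ex ey ua' a'v [s2 E]]]|[ex ey s2 E]|[ex ey E]];
case: (sub_curve_cases uv xy' tI) => [[d [d' [q' [de dd' qI' out' [E' _]]]]]|[d' [ex' ey' ud' d'v [t2 E']]]|[ex' ey' t2 E']|[ex' ey' E']];
rewrite E E' => EE.
- move/flat_inj: EE; rewrite !out_offb // => /(_ isT isT) /(drawn_cross D aa' dd' qI qI') cr.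
  have au0 : a' != u.
    case: ce => [[ex ey]|[_ _ _ ->]]; last exact: adj_neq.
    by move: xy; rewrite ex ey => /and3P[].
  have du0 : d' != u.
    case: de => [[ex ey]|[_ _ _ ->]]; last exact: adj_neq.
    by move: xy'; rewrite ex ey => /and3P[].
  case: ce de => [[ex ey]|[ex ey ea ea']] [[ex' ey']|[ex' ey' ed ed']]; subst.
  + by case: cr => -[-> ->]; [left|right].
  + case: cr => -[h1 h2]; last by move: au0; rewrite h2 eqxx.
    by move: xy; rewrite h1 h2 /= !eqxx /= !andbF.
  + case: cr => -[h1 h2]; last by move: du0; rewrite -h1 eqxx.
    by move: xy'; rewrite -h1 -h2 /= !eqxx /= !andbF.
  by left.
- by exfalso; have := flat_high out; rewrite EE /=; lra.
- by exfalso; have := flat_high out; rewrite EE /=; lra.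
- by exfalso; have := flat_high out; rewrite EE /=; lra.
- by exfalso; have := flat_high out'; rewrite -EE /=; lra.
- case: EE => h1 h2; have st : s = t by lra.
  left; split; rewrite ?ex ?ex' // ey ey'; congr Some; apply: exit_inj => //.
  by move: h1; rewrite st => /(mulfI _); apply; rewrite gt_eqF // mulr_gt0.
- case: EE => h1 h2; have st : s = t by lra.
  have h3 := vmax _ ua'; have [h4|h4] := eqVneq (exitx a') (exitx v).
    by move: a'v; rewrite (exit_inj _ _ ua' uv h4) eqxx.
  have : exitx a' < exitx v by rewrite lt_neqAle h4.
  by subst t => h5; exfalso; nra.
- by exfalso; case: EE; lra.
- by exfalso; have := flat_high out'; rewrite -EE /=; lra.
- case: EE => h1 h2; have st : s = t by lra.
  have h3 := vmax _ ud'; have [h4|h4] := eqVneq (exitx d') (exitx v).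
    by move: d'v; rewrite (exit_inj _ _ ud' uv h4) eqxx.
  have : exitx d' < exitx v by rewrite lt_neqAle h4.
  by subst t => h5; exfalso; nra.
- by left; rewrite ex ex' ey ey'.
- by exfalso; case: EE; lra.
- by exfalso; have := flat_high out'; rewrite -EE /=; lra.
- by exfalso; case: EE; lra.
- by exfalso; case: EE; lra.
by left; rewrite ex ex' ey ey'.
Qed.
End Placed.

(** Some edge at [u], though not a prescribed one, can be subdivided in such a way that
    [u] and the new vertex are both on the outer face. *)
Lemma subdivided_drawing : (exists v, adj u v) -> exists v, adj u v /\ exists (P' : option G -> R * R) (c' : option G -> option G -> R -> R * R),
  [/\ drawn (sube u v) P' c', P' (Some u) = (0, 0), P' None = (1, 0),
      forall x, x != Some u -> x != None -> halfdiamond (P' x) &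
      forall x y t, sube u v x y -> 0 < t < 1 -> halfdiamond (c' x y t)].
Proof.
case=> v0 uv0; have [r r0 [far farc]] := small_radius.
have [tau tauP] := exits r0 far.
have [b [bC bN]] := circle_avoid (fun v => ((c u v (tau v)).1 - (P u).1, (c u v (tau v)).2 - (P u).2)) r0.
have bN' v : adj u v -> c u v (tau v) <> ((P u).1 + b.1, (P u).2 + b.2).
  move=> _ E; apply: (bN v); rewrite E /= [RHS]surjective_pairing; congr pair; ring.
have [e e0 [eP eC]] := small_scale farc tauP bC bN'.
pose ex := exitx tau b e.
have [v uv vmax] : exists2 v, adj u v & forall x, adj u x -> ex x <= ex v.
  by case: (@arg_maxP _ R G v0 (fun x => adj u x) ex uv0) => v uv H; exists v.
exists v; split=> //; exists (sub_pos b e), (sub_curve tau b e); split => //=.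
- exact: (sub_drawn r0 far farc tauP bC bN' e0 eC uv vmax).
- by rewrite eqxx.
- case=> [a|] //= ; rewrite -[_ != _]/(a != u) => au _; rewrite (negbTE au).
  by have [h1 h2] := eP _ au; apply: (high_half bC e0) => //; exact: far.
move=> x y t xy tI; have /andP[t0 t1] := tI.
have tI2 : 0 < t <= 1 by rewrite t0 ltW.
case: (sub_curve_cases farc tauP bC e0 eC uv xy tI) => [[a [a' [s [_ _ _ _ [_ h]]]]] //|[a' [-> -> ua' a'v [t2 E]]]|[-> -> t2 E]|[-> -> ->]].
- by rewrite /sub_curve eqxx clampE; [case: (arm_half tauP bC e0 eC ua' tI2 (or_introl (erefl 0)))|lra].
- by rewrite /sub_curve clampE; [case: (arm_half tauP bC e0 eC uv tI2 (or_intror (erefl 1)))|lra].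
by rewrite /halfdiamond /=; apply/and3P; split; lra.
Qed.
End Sub.

(** * Two copies in series, and the grid of slots *)

(** The square with diagonal from (0, 0) to (1, 0). The diamonds over the unit edges of the
    square lattice are pairwise disjoint and contain no lattice point. *)
Definition diamond (R : realType) (z : R * R) :=
  [&& - z.1 < z.2, z.2 < z.1, - (1 - z.1) < z.2 & z.2 < 1 - z.1].

Lemma drawn_sub (R : realType) (V : Type) (e e' : V -> V -> Prop) P (c : V -> V -> R -> R * R) :
  (forall u v, e' u v -> e u v) -> drawn e P c -> drawn e' P c.
Proof.
move=> ee [d1 d2 d3 d4 d5 d6]; split => //.
- by move=> u v /ee; exact: d2.
- by move=> u v /ee; exact: d3.
- by move=> u v /ee; exact: d4.
- by move=> u v w t /ee; exact: d5.
by move=> u v u' v' s t /ee h /ee; exact: d6.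
Qed.

Lemma drawn_comp (R : realType) (V V' : Type) (e : V -> V -> Prop) P (c : V -> V -> R -> R * R) (f : V' -> V) :
  injective f -> drawn e P c -> drawn (fun x y => e (f x) (f y)) (fun x => P (f x)) (fun x y => c (f x) (f y)).
Proof.
move=> fi [d1 d2 d3 d4 d5 d6]; split => //.
- by move=> x y /d1/fi.
- by move=> u v; exact: d2.
- by move=> u v; exact: d3.
- by move=> u v; exact: d4.
- by move=> u v w t; exact: d5.
by move=> u v u' v' s t h h' sI tI /(d6 _ _ _ _ _ _ h h' sI tI) [[/fi -> /fi ->]|[/fi -> /fi ->]]; [left|right].
Qed.

Section Series.
Variables (R : realType) (G : finType) (u : G).
Variables (ex : option G -> option G -> bool) (P : option G -> R * R) (c : option G -> option G -> R -> R * R).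
Hypothesis D : drawn (fun x y => ex x y) P c.
Hypothesis Pu : P (Some u) = (0, 0).
Hypothesis Pw : P None = (1, 0).
Hypothesis hP : forall x, x != Some u -> x != None -> halfdiamond (P x).
Hypothesis hC : forall x y t, ex x y -> 0 < t < 1 -> halfdiamond (c x y t).

(** Two copies of the graph on [option G] are glued at [None]. The two ends, which are
    the copies of [u], are kept apart as booleans, since they are the vertices shared with
    other slots. *)
Definition inner := {a : G | a != u}.
Definition series := (bool + option (inner * bool))%type.
Definition lower (x : series) : option G :=
  match x with inl _ => Some u | inr None => None | inr (Some (a, _)) => Some (val a) end.
Definition on_copy (s : bool) (x : series) : bool :=
  match x with inl s' => s' == s | inr None => true | inr (Some (_, s')) => s' == s end.
Definition series_rel (s : bool) (x y : series) := [&& on_copy s x, on_copy s y & ex (lower x) (lower y)].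
(** The additional edge between the two ends, drawn as the diagonal, makes room for a
    slot that is a single arc. *)
Definition series_edge (x y : series) : bool :=
  ((x == inl false) && (y == inl true)) || series_rel false x y || series_rel true x y.
(** The two copies of the half diamond are placed over the segments that join (0, 0) and
    (1, 0) to (1/2, 1/4), the common image of [None]. *)
Definition place (s : bool) (z : R * R) : R * R :=
  (if s then 1 - z.1 / 2 else z.1 / 2, (z.1 + z.2) / 4).
Definition series_pos (x : series) : R * R :=
  match x with inl s => ((s : nat)%:R, 0) | inr None => (1 / 2, 1 / 4)
  | inr (Some (a, s)) => place s (P (Some (val a))) end.
Definition series_curve (x y : series) (t : R) : R * R :=
  if series_rel false x y then place false (c (lower x) (lower y) t)
  else if series_rel true x y then place true (c (lower x) (lower y) t) else (t, 0).

Lemma lower_inj s x y : on_copy s x -> on_copy s y -> lower x = lower y -> x = y.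
Proof.
case: x => [a|[[a s']|]]; case: y => [b|[[b s'']|]] //=.
- by move=> /eqP-> /eqP->.
- by move=> _ _ [] E; case/eqP: (valP b).
- by move=> _ _ [] E; case/eqP: (valP a).
by move=> /eqP-> /eqP-> [] /val_inj ->.
Qed.

Lemma place_inj s z z' : place s z = place s z' -> z = z'.
Proof. by case: z z' => [a b] [a' b']; case: s => -[] h1 h2; congr pair; lra. Qed.

Lemma place_half s z : halfdiamond z -> [/\ diamond (place s z), 0 < (place s z).2 &
   if s then 1 / 2 < (place s z).1 else (place s z).1 < 1 / 2].
Proof. by case/and3P => h1 h2 h3; case: s; rewrite /diamond /=; split; try lra; apply/and4P; split; lra. Qed.

Lemma series_posE s x : on_copy s x -> series_pos x = place s (P (lower x)).
Proof.
case: x => [s'|[[a s']|]] //=; first by move/eqP->; rewrite Pu /place /= addr0 !mul0r subr0; case: s.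
- by move/eqP->.
by move=> _; rewrite Pw /place /=; case: s; congr pair; lra.
Qed.

Lemma series_edgeP x y : series_edge x y ->
  (exists s, series_rel s x y /\ forall t, series_curve x y t = place s (c (lower x) (lower y) t)) \/
  [/\ x = inl false, y = inl true & forall t, series_curve x y t = (t, 0)].
Proof.
rewrite /series_edge /series_curve.
have [h|h] := boolP (series_rel false x y); first by left; exists false.
have [h'|h'] := boolP (series_rel true x y); first by left; exists true.
by rewrite !orbF => /andP[/eqP -> /eqP ->]; right.
Qed.

Lemma series_pos_inner x s : x <> inl s -> x <> inl (~~ s) -> diamond (series_pos x) /\ 0 < (series_pos x).2.
Proof.
case: x => [s'|[[a s']|]].
- by case: s s' => -[].
- move=> _ _; rewrite /series_pos.
  have nu : Some (val a) != Some u by apply/eqP => -[] E; case/eqP: (valP a).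
  by have [] := place_half s' (hP nu isT).
by move=> _ _ /=; rewrite /diamond /=; split; [apply/and4P; split|]; lra.
Qed.

Lemma series_curve_inner x y t : series_edge x y -> 0 < t < 1 -> diamond (series_curve x y t).
Proof.
move=> /series_edgeP [[s [/and3P[_ _ exy] ->]]|[_ _ ->]] tI; first by case: (place_half s (hC exy tI)).
by rewrite /diamond /=; apply/and4P; split; lra.
Qed.

Lemma series_drawn : drawn (fun x y => series_edge x y) series_pos series_curve.
Proof.
have onE s x : on_copy (~~ s) x -> ~~ on_copy s x -> (x = inl (~~ s)) \/ exists a, x = inr (Some (a, ~~ s)).
  by case: x => [s'|[[a s']|]] //=; case: s s' => -[] // _ _; [left|left|right; exists a|right; exists a].
have half x s : on_copy s x -> (exists a, x = inr (Some (a, s))) \/ x = inl s \/ x = inr None.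
  by case: x => [s'|[[a s']|]] //=; [move/eqP->; right; left|move/eqP->; left; exists a|right; right].
have inside a s : [/\ diamond (series_pos (inr (Some (a, s)))), 0 < (series_pos (inr (Some (a, s)))).2 &
   if s then 1 / 2 < (series_pos (inr (Some (a, s)))).1 else (series_pos (inr (Some (a, s)))).1 < 1 / 2].
  by apply: place_half; apply: hP => //; apply/eqP => -[] E; case/eqP: (valP a).
split.
- move=> x y E.
  have [[s [sx sy]]|H] := pselect (exists s, on_copy s x /\ on_copy s y).
    apply: (lower_inj sx sy); apply: (drawn_inj D); apply: (@place_inj s).
    by rewrite -!series_posE.
  exfalso; case: x y E H => [s'|[[a s']|]] [s''|[[a' s'']|]] E H; try by apply: H; exists s'; rewrite /= eqxx.
  + have /= := congr1 fst E; case: s' s'' {E} H => -[] H /= E.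
    * by apply: H; exists true.
    * lra.
    * lra.
    * by apply: H; exists false.
  + by have [_ h _] := inside a' s''; move: h; rewrite -E /= ltxx.
  + by have [_ h _] := inside a s'; move: h; rewrite E /= ltxx.
  + have [_ _ h] := inside a s'; have [_ _ h'] := inside a' s''; case: s' s'' E H h h' => -[] E H; rewrite ?E; try lra;
     by move=> _ _; apply: H; first [by exists true | by exists false].
  + by apply: H; exists s''; rewrite /= eqxx.
  + by apply: H; exists s''; rewrite /= eqxx.
  by apply: H; exists true.
- move=> x y xy; have [[s [/and3P[_ _ exy] E]]|[_ _ E]] := series_edgeP xy.
    have [c1 c2] := drawn_ctn D exy.
    have -> : series_curve x y = (fun t => place s (c (lower x) (lower y) t)) by apply/funext.
    split; last by rewrite /=; apply: ctnM; [exact: ctnD|exact: ctn_cst].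
    have h1 : ctn (fun t => (c (lower x) (lower y) t).1 / 2) by apply: ctnM; [|exact: ctn_cst].
    case: s {E} => //=; apply: ctnD; [exact: ctn_cst|exact: ctnN].
  have -> : series_curve x y = (fun t => (t, 0)) by apply/funext.
  by split; [exact: ctn_id|exact: ctn_cst].
- move=> x y xy; have [[s [/and3P[_ _ exy] E]]|[_ _ E]] := series_edgeP xy => t t' tI tI'; rewrite !E.
    by move/place_inj; apply: (drawn_simple D exy).
  by case.
- move=> x y xy; have [[s [/and3P[sx sy exy] E]]|[-> -> E]] := series_edgeP xy; rewrite !E //.
  by have [-> ->] := drawn_ends D exy; rewrite -!series_posE.
- move=> x y w t xy tI; have [[s [/and3P[sx sy exy] ->]]|[-> -> ->]] := series_edgeP xy; last first.
    case: w => [[]|[[a s]|]] /= [] E; try lra.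
    + by case: (inside a s) => _; rewrite /= => h _; lra.
  have [dm h0 h1] := place_half s (hC exy tI).
  have [sw|nsw] := boolP (on_copy s w).
    by rewrite (series_posE sw) => /place_inj; exact: (drawn_vertex D exy tI).
  have : on_copy (~~ s) w by case: w nsw => [[]|[[a []]|]]; case: (s).
  case/onE=> // [->|[a ->]] E.
    by move: h0; rewrite E /= ltxx.
  by have [_ _ h2] := inside a (~~ s); move: h1; rewrite E; case: (s) h2 => /= h2 h1; lra.
move=> x y x' y' s t xy xy' sI tI.
have [[q [/and3P[qx qy exy] ->]]|[-> -> ->]] := series_edgeP xy;
have [[q' [/and3P[qx' qy' exy'] ->]]|[-> -> ->]] := series_edgeP xy'.
- have [dm h0 h1] := place_half q (hC exy sI); have [dm' h0' h1'] := place_half q' (hC exy' tI).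
  have [qq E|nq E] := eqVneq q q'; last first.
    by exfalso; move: h1'; rewrite -E; case: (q) (q') nq h1 => -[] //= _; lra.
  subst q'; move/place_inj: E => /(drawn_cross D exy exy' sI tI) [[]|[]] e1 e2; [left|right];
  by split; apply: (@lower_inj q).
- by have [_ h0 _] := place_half q (hC exy sI) => E; move: h0; rewrite E /= ltxx.
- by have [_ h0 _] := place_half q' (hC exy' tI) => E; move: h0; rewrite -E /= ltxx.
by left.
Qed.
End Series.

Section Host.
Variables (w m : nat).
(** The vertex [p] of the gadget in the slot from the lattice point (i, j) to
    (i + 1, j) if [d], to (i, j + 1) otherwise. Each lattice point is followed by the
    interior vertices of its two slots; 0 and 1 are the ends of the gadget and are
    therefore lattice points. *)
Definition gidx (i j : nat) (d : bool) (p : nat) : nat :=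
  (match p with
  | 0 => (i * w.+1 + j) * (2 * m).+1
  | 1 => ((i + d) * w.+1 + (j + ~~ d)) * (2 * m).+1
  | p'.+2 => (i * w.+1 + j) * (2 * m).+1 + (d * m + p').+1
  end)%N.

Variables (R : realType) (F : 'I_m.+2 -> 'I_m.+2 -> bool) (gp : 'I_m.+2 -> R * R)
  (gc : 'I_m.+2 -> 'I_m.+2 -> R -> R * R).
Hypothesis D : drawn (fun p q => F p q) gp gc.
Hypothesis gp0 : gp ord0 = (0, 0).
Hypothesis gp1 : gp (inord 1) = (1, 0).
Hypothesis gpd : forall p : 'I_m.+2, (1 < p)%N -> diamond (gp p).
Hypothesis gcd : forall p q t, F p q -> 0 < t < 1 -> diamond (gc p q t).

(** Row [i] and column [j] are drawn at the ordinate [i] and the abscissa [j]. *)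
Definition slotmap (i j : nat) (d : bool) (z : R * R) : R * R :=
  if d then (j%:R + z.2, i%:R + z.1) else (j%:R + z.1, i%:R + z.2).
Definition host_pos (u : nat) : R * R :=
  let q := (u %/ (2 * m).+1)%N in let a := (u %% (2 * m).+1)%N in
  let i := (q %/ w.+1)%N in let j := (q %% w.+1)%N in
  if a is a'.+1 then slotmap i j (m <= a')%N (gp (inord ((a' - (m <= a')%N * m).+2)))
  else (j%:R, i%:R).

Lemma slotmap_inj i j d z z' : slotmap i j d z = slotmap i j d z' -> z = z'.
Proof. by case: z z' => [a b] [a' b']; case: d => -[] h1 h2; congr pair; lra. Qed.

(** Lattice coordinates that differ do so by at least 1, which is more than two open
    diamonds leave room for. *)
Lemma slotmap_disj i j d z i' j' d' z' : diamond z -> diamond z' ->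
  slotmap i j d z = slotmap i' j' d' z' -> [/\ i = i', j = j', d = d' & z = z'].
Proof.
case: z z' => [a b] [a' b'] /and4P[/= h1 h2 h3 h4] /and4P[/= h1' h2' h3' h4'] E.
have e1 := congr1 fst E; have e2 := congr1 snd E.
have lt3 (x y : nat) : [\/ x = y, x%:R + 1 <= y%:R :> R | y%:R + 1 <= x%:R :> R].
  case: (ltngtP x y) => lt; [apply: Or32|apply: Or33|exact: Or31]; by rewrite natr1 ler_nat.
have [[ei ej] ed] : (i = i' /\ j = j') /\ d = d'.
  case: (lt3 i i') => hi; case: (lt3 j j') => hj;
    [split; [by []|subst; case: d d' {E} e1 e2 => -[] //= e1 e2; exfalso; lra]
    |exfalso; try subst; case: d d' {E} e1 e2 => -[] /=; lra..].
by subst; split => //; apply: slotmap_inj E.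
Qed.

Lemma slotmap_lattice i j d z (i' j' : nat) : diamond z -> slotmap i j d z <> (j'%:R, i'%:R).
Proof.
case: z => [a b] /and4P[/= h1 h2 h3 h4] E.
have e1 := congr1 fst E; have e2 := congr1 snd E.
have lt3 (x y : nat) : [\/ x = y, x%:R + 1 <= y%:R :> R | y%:R + 1 <= x%:R :> R].
  case: (ltngtP x y) => lt; [apply: Or32|apply: Or33|exact: Or31]; by rewrite natr1 ler_nat.
by case: (lt3 i i') => hi; case: (lt3 j j') => hj; try subst; case: d {E} e1 e2 => /=; lra.
Qed.

Lemma host_pos_idx i j d (p : 'I_m.+2) : (j < w)%N -> host_pos (gidx i j d p) = slotmap i j d (gp p).
Proof.
move=> jw; have jw' : (j < w.+1)%N by apply: ltnW.
case: p => -[|[|p]] pm; rewrite /gidx /host_pos /=.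
- rewrite mulnK // modnMl divnMDl // divn_small // addn0 modnMDl modn_small //.
  have -> : Ordinal pm = ord0 by apply: val_inj.
  by rewrite gp0 /slotmap /= !addr0; case: d.
- rewrite mulnK // modnMl.
  have h : (j + ~~ d < w.+1)%N by case: d; rewrite /= ?addn0 ?addn1.
  rewrite divnMDl // (divn_small h) addn0 modnMDl (modn_small h).
  have -> : Ordinal pm = inord 1 by apply: val_inj; rewrite /= inordK.
  by rewrite gp1 /slotmap /=; case: d {h} => /=; rewrite ?addn0 ?addr0 natrD.
have pm' : (p < m)%N by rewrite -2!ltnS.
have h : ((d * m + p).+1 < (2 * m).+1)%N by case: d => /=; rewrite ?mul1n ?mul0n ltnS; lia.
rewrite divnMDl // (divn_small h) addn0 modnMDl (modn_small h).
rewrite divnMDl // divn_small // addn0 modnMDl modn_small //.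
have -> : (m <= d * m + p)%N = d by case: (d); rewrite ?mul1n ?mul0n ?leq_addr //; apply/negbTE; rewrite -ltnNge.
by rewrite addKn; congr slotmap; congr gp; apply: val_inj; rewrite /= inordK.
Qed.

Lemma host_pos_cases u : (exists i j, [/\ u = (i * w.+1 + j) * (2 * m).+1 & host_pos u = (j%:R, i%:R)]%N) \/
  (exists i j (d : bool) k, [/\ u = (i * w.+1 + j) * (2 * m).+1 + (d * m + k).+1, (k < m) &
     host_pos u = slotmap i j d (gp (inord k.+2))]%N).
Proof.
have [q [a [-> am]]] : exists q a, (u = q * (2 * m).+1 + a /\ a < (2 * m).+1)%N.
  by exists (u %/ (2 * m).+1)%N, (u %% (2 * m).+1)%N; rewrite -divn_eq ltn_mod.
have [i [j [-> jw]]] : exists i j, (q = i * w.+1 + j /\ j < w.+1)%N.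
  by exists (q %/ w.+1)%N, (q %% w.+1)%N; rewrite -divn_eq ltn_mod.
have dj x : ((x * w.+1 + j) %/ w.+1 = x)%N by rewrite divnMDl // divn_small // addn0.
have mj x : ((x * w.+1 + j) %% w.+1 = j)%N by rewrite modnMDl modn_small.
case: a am => [|a] am.
  by left; exists i, j; rewrite addn0 /host_pos mulnK // modnMl dj mj.
right; exists i, j, (m <= a)%N, (a - (m <= a)%N * m)%N.
rewrite /host_pos divnMDl // (divn_small am) addn0 modnMDl (modn_small am) dj mj.
by split=> //; case: leqP => h; rewrite ?mul1n ?mul0n; lia.
Qed.

Lemma host_pos_inj : injective host_pos.
Proof.
have lat i j i' j' : (j%:R, i%:R) = (j'%:R, i'%:R) :> R * R -> i = i' /\ j = j'.
  by case=> /eqP; rewrite eqr_nat => /eqP -> /eqP; rewrite eqr_nat => /eqP ->.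
have dm k : (k < m)%N -> diamond (gp (inord k.+2)) by move=> km; apply: gpd; rewrite inordK.
move=> u u'; case: (host_pos_cases u) => [[i [j [-> ->]]]|[i [j [d [k [-> km ->]]]]]];
case: (host_pos_cases u') => [[i' [j' [-> ->]]]|[i' [j' [d' [k' [-> km' ->]]]]]].
- by case/lat => -> ->.
- by move/esym/slotmap_lattice; case; exact: dm.
- by move/slotmap_lattice; case; exact: dm.
case/slotmap_disj; rewrite ?dm // => -> -> -> /(drawn_inj D)/(congr1 val).
by rewrite /= !inordK // => -[->].
Qed.

Variables (N : nat) (e : rel 'I_N).
Hypothesis eP : forall u v, e u v -> exists i j d (p q : 'I_m.+2),
  [/\ (j < w)%N, F p q, u = gidx i j d p :> nat & v = gidx i j d q :> nat].

Lemma host_drawn : exists c, drawn (fun u v => e u v) (fun u : 'I_N => host_pos u) c.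
Proof.
have H (uv : 'I_N * 'I_N) : exists x : nat * nat * bool * 'I_m.+2 * 'I_m.+2, e uv.1 uv.2 ->
   [/\ (x.1.1.1.2 < w)%N, F x.1.2 x.2, uv.1 = gidx x.1.1.1.1 x.1.1.1.2 x.1.1.2 x.1.2 :> nat &
     uv.2 = gidx x.1.1.1.1 x.1.1.1.2 x.1.1.2 x.2 :> nat].
  case: uv => u v; have [/eP [i [j [d [p [q hh]]]]]|_] := boolP (e u v); first by exists (i, j, d, p, q).
  by exists (0%N, 0%N, false, ord0, ord0).
have [f Hf] := choice H.
pose c u v t := let x := f (u, v) in slotmap x.1.1.1.1 x.1.1.1.2 x.1.1.2 (gc x.1.2 x.2 t).
exists c; split.
- by move=> u v /host_pos_inj/val_inj.
- move=> u v uv; have [_ fe _ _] := Hf (u, v) uv; have [c1 c2] := drawn_ctn D fe.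
  by rewrite /c /slotmap; case: (f (u, v)).1.1.2; split; (apply: ctnD => //; exact: ctn_cst).
- move=> u v uv s t sI tI; have [_ fe _ _] := Hf (u, v) uv; move/slotmap_inj; exact: (drawn_simple D fe).
- move=> u v uv; have [jw fe /= eu ev] := Hf (u, v) uv; have [h0 h1] := drawn_ends D fe.
  by rewrite /c /= h0 h1 eu ev !host_pos_idx.
- move=> u v x t uv tI; have [jw fe /= eu ev] := Hf (u, v) uv; rewrite /c.
  have dc := gcd fe tI.
  case: (host_pos_cases x) => [[i' [j' [_ ->]]]|[i' [j' [d' [k' [_ km' ->]]]]]]; first exact: slotmap_lattice.
  case/slotmap_disj => //; first by apply: gpd; rewrite inordK.
  move=> _ _ _; exact: (drawn_vertex D fe tI).
move=> u v u' v' s t uv uv' sI tI.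
have [jw fe /= eu ev] := Hf (u, v) uv; have [jw' fe' /= eu' ev'] := Hf (u', v') uv'.
rewrite /c => /slotmap_disj [].
- exact: gcd fe sI.
- exact: gcd fe' tI.
move=> ei ej ed /(drawn_cross D fe fe' sI tI) [] [e1 e2]; [left|right];
  by split; apply: val_inj => /=; rewrite ?eu ?ev ?eu' ?ev' ei ej ed ?e1 ?e2.
Qed.
End Host.

(** * Ranks, and the gadget that forces equal colours *)

Local Close Scope ring_scope.
Section Ranks.
Variable T : finType.
Implicit Type e : rel T.

Lemma rank_acyclic e (rho : T -> nat) : (forall x y, e x y -> rho x < rho y) -> acyclic e.
Proof.
move=> inc [|x p] // _ /andP[cyc _]; move: cyc => /=.
have H q : forall y, path e y q -> rho y <= rho (last y q).
  by elim: q => //= z q IH y /andP[/inc yz /IH]; apply: leq_trans; exact: ltnW.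
rewrite rcons_path => /andP[/H h /inc]; by rewrite ltnNge h.
Qed.

(** The rank of a vertex counts the vertices from which it can be reached. *)
Lemma acyclic_rank e : acyclic e -> exists rho : T -> nat,
  (forall x y, e x y -> rho x < rho y) /\ forall x, rho x <= #|T|.
Proof.
move=> ac; exists (fun x => #|[set y | connect e y x]|); split=> [x y xy|x]; last exact: max_card.
apply: proper_card; apply/properP; split.
  by apply/fintype.subsetP => z; rewrite !inE => zx; exact: connect_trans zx (connect1 xy).
exists y; rewrite !inE ?connect0 //; apply/negP => /connectP[p yp xE].
have := xE; case: (shortenP yp) => q yq uq _ xE'.
apply: (ac (y :: q)) => //; rewrite /ucycle uq andbT /= rcons_path yq /=.
by rewrite -xE'.
Qed.
End Ranks.

(** One rank function serves both classes, because only arcs within a class constrain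
    it. *)
Lemma dicolourable2P (D : oriented_graph) : dicolourable 2 D <->
  exists (col : D -> bool) (rho : D -> nat), forall x y, Defs.arc x y -> col x = col y -> rho x < rho y.
Proof.
split.
  case=> col ac; have [r0 [H0 _]] := acyclic_rank (ac ord0); have [r1 [H1 _]] := acyclic_rank (ac (inord 1)).
  exists (fun x => col x == ord0), (fun x => if col x == ord0 then r0 x else r1 x) => x y xy cxy.
  have c1 (z : 'I_2) : z != ord0 -> z = inord 1.
    by move=> nz; apply: val_inj; rewrite /= inordK //; case: z nz => -[|[|]].
  case: (boolP (col x == ord0)) (cxy) => cx /esym cy.
    by rewrite cy; apply: H0; rewrite /induced_rel /= !inE cx cy xy.
  rewrite cy; apply: H1; rewrite /induced_rel /= !inE xy andbT.
  by rewrite (c1 _ cx) (c1 (col y)) ?cy // !eqxx.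
case=> col [rho H]; exists [ffun x => if col x then ord0 else inord 1] => i.
apply: (rank_acyclic (rho := rho)) => x y; rewrite /induced_rel /= !inE !ffunE => /and3P[/eqP ci /eqP cj xy].
apply: H => //; have := etrans ci (esym cj); case: (col x); case: (col y) => // /(congr1 val); by rewrite /= inordK.
Qed.

Section Minimal.
Variable R : realType.

Definition same_pair (T : eqType) (u v a b : T) := ((a == u) && (b == v)) || ((a == v) && (b == u)).

Section Delete.
Variables (D : oriented_graph) (u v : D).
Definition del_adj (a b : D) := adj a b && ~~ same_pair u v a b.
Lemma del_sym : symmetric del_adj.
Proof.
move=> a b; rewrite /del_adj adj_sym /same_pair; congr (_ && ~~ _).
by rewrite orbC; congr (_ || _); rewrite andbC.
Qed.

Lemma del_irrefl : irreflexive del_adj.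
Proof. by move=> a; rewrite /del_adj adj_irrefl. Qed.
Definition del_simple := SimpleGraph del_sym del_irrefl.
Definition del_arc : rel del_simple := fun a b => Defs.arc (a : D) b && ~~ same_pair u v a b.
Lemma del_arc_adj (a b : del_simple) : del_arc a b -> adj a b.
Proof. by case/andP => h h'; apply/andP; split=> //; exact: arc_adj h. Qed.
Lemma del_orient (a b : del_simple) : adj a b -> del_arc a b (+) del_arc b a.
Proof.
rewrite /= /del_adj => /andP[h h']; rewrite /del_arc h'.
have -> : same_pair u v b a = same_pair u v a b.
  by rewrite /same_pair orbC; congr (_ || _); rewrite andbC.
by rewrite h' !andbT; exact: arc_orient.
Qed.

Definition del_graph := OrientedGraph del_arc_adj del_orient.

Lemma del_planar : planar R D -> planar R del_graph.
Proof.
case/drawn_planar => P [c d]; apply: (@planar_drawn R del_simple (fun a b => del_adj a b) P c).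
- by move=> a b; rewrite /= => ->.
- by [].
by apply: drawn_sub d => a b /andP[].
Qed.
End Delete.

(** Deleting edges while the graph stays not 2-dicolourable must stop. *)
Lemma critical_graph : (exists D : planar_oriented_graph R, ~ dicolourable 2 (sval D)) ->
  exists D : oriented_graph, [/\ planar R D, ~ dicolourable 2 D &
    forall u v : D, adj u v -> dicolourable 2 (del_graph u v)].
Proof.
pose size (D : oriented_graph) := #|[set ab : D * D | adj ab.1 ab.2]|.
case=> -[D plD] /=; have [n] := ubnP (size D); elim: n D plD => // n IH D plD Dn ndic.
have [H|] := pselect (forall u v : D, adj u v -> dicolourable 2 (del_graph u v)); first by exists D.
move=> H; have [u [v [uv nd]]] : exists u v : D, adj u v /\ ~ dicolourable 2 (del_graph u v).
  apply: contrapT => H'; apply: H => u v uv; apply: contrapT => nd; apply: H'; by exists u, v.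
apply: (IH (del_graph u v)) => //; first exact: del_planar.
rewrite -ltnS; apply: leq_ltn_trans Dn; rewrite /size; apply: proper_card; apply/properP; split.
  by apply/fintype.subsetP => -[a b]; rewrite !inE /= => /andP[].
by exists (u, v); rewrite !inE //= /del_adj /same_pair !eqxx /= andbF.
Qed.
End Minimal.

Section Gadget.
Variables (D : oriented_graph) (u v : D).
Hypothesis uv : adj u v.
Hypothesis ndic : ~ dicolourable 2 D.
Hypothesis crit : dicolourable 2 (del_graph u v).

(** The path through [None] is directed as the arc between [u] and [v] was. *)
Definition sub_arc (x y : option D) : bool :=
  match x, y with
  | Some a, Some b => Defs.arc a b && ~~ same_pair u v a b
  | Some a, None => ((a == u) && Defs.arc u v) || ((a == v) && Defs.arc v u)
  | None, Some b => ((b == v) && Defs.arc u v) || ((b == u) && Defs.arc v u)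
  | None, None => false
  end.
Definition series_arc (x y : series u) : bool :=
  [|| [&& on_copy false x, on_copy false y & sub_arc (lower x) (lower y)]
    | [&& on_copy true x, on_copy true y & sub_arc (lower x) (lower y)]].

Lemma series_arcP x y : series_arc x y ->
  exists s, [/\ on_copy s x, on_copy s y & sub_arc (lower x) (lower y)].
Proof. by case/orP => /and3P[h1 h2 h3]; [exists false|exists true]. Qed.

Lemma arc_anti (a b : D) : Defs.arc a b -> Defs.arc b a -> False.
Proof. by move=> ab ba; have := arc_orient (arc_adj ab); rewrite ab ba. Qed.

Lemma sub_arc_anti x y : sub_arc x y -> ~~ sub_arc y x.
Proof.
have uv' : u != v by apply: contraTneq uv => ->; rewrite adj_irrefl.
case: x y => [a|] [b|] //=.
- case/andP => ab _; apply/negP => /andP[ba _]; exact: arc_anti ab ba.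
- have [->|] := eqVneq a u; rewrite /= ?(negbTE uv') ?orbF; last first.
    by move=> _ /andP[/eqP -> vu]; rewrite ?eqxx /= ?orbF; apply/negP => h; exact: arc_anti h vu.
  by move=> h; apply/negP => h'; exact: arc_anti h h'.
have [->|] := eqVneq b v; rewrite /= ?orbF.
  by rewrite eq_sym (negbTE uv') orbF /= => h; apply/negP => h'; exact: arc_anti h h'.
by move=> _ /andP[/eqP -> h]; rewrite ?eqxx /= ?orbF; apply/negP => h'; exact: arc_anti h h'.
Qed.

Lemma series_arc_anti x y : series_arc x y -> ~~ series_arc y x.
Proof. by case/series_arcP => s [_ _ /sub_arc_anti h]; apply/norP; rewrite !negb_and h !orbT. Qed.

Lemma sub_arc_sube x y : sub_arc x y -> sube u v x y || sube u v y x.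
Proof.
case: x y => [a|] [b|] //=; last 2 first.
- by case/orP => /andP[-> _]; rewrite ?orbT.
- by case/orP => /andP[-> _]; rewrite ?orbT.
case/andP => /arc_adj ab; rewrite /same_pair negb_or => /andP[h1 h2].
rewrite ab (adj_sym b a) ab h1 /= andbT; have [bu|//] := eqVneq b u.
rewrite /=; move: h2; rewrite bu eqxx andbT => ->; rewrite andbT.
by apply: contraTneq ab => ->; rewrite bu adj_irrefl.
Qed.

(** If [u] and the new vertex agree, the rank of the new vertex separates the ranks of [u]
    and [v] whenever these agree as well; the arc between them could be restored. *)
Lemma sub_forced (col : option D -> bool) (rho : option D -> nat) :
  (forall x y, sub_arc x y -> col x = col y -> rho x < rho y) -> col (Some u) != col None.
Proof.
move=> H; apply/eqP => cu; apply: ndic; apply/dicolourable2P.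
exists (fun a => col (Some a)), (fun a => rho (Some a)) => a b ab cab.
have [|nab] := boolP (same_pair u v a b); last by apply: H; rewrite /= ?ab.
case/orP => /andP[/eqP ea /eqP eb]; subst.
  apply: (@ltn_trans (rho None)); apply: H; rewrite /= ?eqxx ?ab ?orbT //; by rewrite -cu.
apply: (@ltn_trans (rho None)); apply: H; rewrite /= ?eqxx ?ab ?orbT //; by rewrite -cu cab.
Qed.

(** In a 2-dicolouring of [D] without [uv] the vertices [u] and [v] agree, because
    otherwise the arc could be restored. The opposite colour at the new vertex thus leaves no
    monochromatic arc there. *)
Lemma sub_sound (k : bool) : exists (col : option D -> bool) (rho : option D -> nat),
  [/\ col (Some u) = k, col None = ~~ k &
  forall x y, sub_arc x y -> col x = col y -> [/\ rho x < rho y, x <> None & y <> None]].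
Proof.
have [col [rho H]] := (dicolourable2P _).1 crit.
have cuv : col u = col v.
  apply: contrapT => cuv; apply: ndic; apply/dicolourable2P; exists col, rho => a b ab cab.
  apply: H => //; rewrite /= /del_arc ab /=; apply/negP => /orP[] /andP[/eqP ea /eqP eb]; subst; exact: cuv.
pose col' a := col a (+) col u (+) k.
have cc a b : col' a = col' b -> col a = col b by rewrite /col'; case: (col a); case: (col b); case: (col u); case: (k).
exists (fun x => if x is Some a then col' a else ~~ k), (fun x => if x is Some a then rho a else 0).
split=> //; first by rewrite /col'; case: (col u); case: (k).
have cu : col' u = k by rewrite /col'; case: (col u); case: (k).
have cv : col' v = k by rewrite /col' -cuv; case: (col u); case: (k).
move=> [a|] [b|] //=.
- by move=> ab /cc cab; split=> //; apply: H.
- by case/orP => /andP[/eqP -> _]; rewrite ?cu ?cv; case: (k).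
by case/orP => /andP[/eqP -> _]; rewrite ?cu ?cv; case: (k).
Qed.

Lemma series_forced (col : series u -> bool) (rho : series u -> nat) :
  (forall x y, series_arc x y -> col x = col y -> rho x < rho y) -> col (inl false) = col (inl true).
Proof.
move=> H.
pose up s (x : option D) : series u :=
  if x is Some a then (if insub a is Some i then inr (Some (i, s)) else inl s) else inr None.
have upc s x : on_copy s (up s x).
  by case: x => [a|] //=; case: insubP => [i _ _|_] /=; rewrite eqxx.
have upl s x : lower (up s x) = x.
  case: x => [a|] //=; case: insubP => [i _ <-|] //=; by rewrite negbK => /eqP ->.
have upu s : up s (Some u) = inl s by rewrite /up insubF ?eqxx.
have F s : col (inl s) != col (inr None).
  rewrite -upu -[X in _ != col X]/(up s None).
  apply: (@sub_forced (fun x => col (up s x)) (fun x => rho (up s x))) => x y xy; apply: H.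
  by rewrite /series_arc !upl xy !andbT; case: s; rewrite !upc ?orbT.
by move: (F false) (F true); case: (col (inl false)); case: (col (inl true)); case: (col _).
Qed.

(** No monochromatic arc meets the glued vertex, so every monochromatic path stays in one
    of the two copies, which [side] records. The ranks on the two sides can then be shifted independently of
    each other, to fit any ranks of the two ends. *)
Lemma series_sound (k : bool) : exists (col side : series u -> bool) (rho : series u -> nat),
  [/\ forall s, col (inl s) = k /\ side (inl s) = s, rho (inl false) = rho (inl true) &
  forall x y, series_arc x y -> col x = col y -> side x = side y /\ rho x < rho y].
Proof.
have [col [rho [cu cN H]]] := sub_sound k.
exists (fun x => col (lower x)), (fun x => match x with inl s => s | inr (Some (_, s)) => s | inr None => false end),
  (fun x => rho (lower x)); split=> // x y /series_arcP[s [sx sy xy]] /(H _ _ xy)[h1 h2 h3].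
split=> //; move: sx sy h2 h3; case: x y {xy h1} => [sx|[[a sx]|]] [sy|[[b sy]|]] //= /eqP-> /eqP-> //.
Qed.
End Gadget.

(** Renumbers the gadget so that its two ends are the vertices 0 and 1, as the grid
    expects. *)
Section Tagging.
Variable I : finType.
Definition tagging (p : 'I_#|I|.+2) : (bool + I)%type :=
  if unlift ord0 p is Some q then (if unlift ord0 q is Some k then inr (enum_val k) else inl true) else inl false.
Definition untag (x : bool + I) : 'I_#|I|.+2 :=
  match x with inl false => ord0 | inl true => lift ord0 ord0 | inr i => lift ord0 (lift ord0 (enum_rank i)) end.
Lemma untagK : cancel untag tagging.
Proof.
move=> [[]|i]; rewrite /untag /tagging.
- by rewrite liftK unlift_none.
- by rewrite unlift_none.
by rewrite !liftK enum_rankK.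
Qed.

Lemma taggingK : cancel tagging untag.
Proof.
move=> p; rewrite /untag /tagging; case: unliftP => [q ->|->] //.
by case: unliftP => [k ->|->] //; rewrite enum_valK.
Qed.

Lemma tagging0 : tagging ord0 = inl false.
Proof. exact: (untagK (inl false)). Qed.
Lemma tagging1 : tagging (inord 1) = inl true.
Proof. by rewrite -(untagK (inl true)); congr tagging; apply: val_inj; rewrite /= inordK. Qed.
Lemma tagging_inner (p : 'I_#|I|.+2) : 1 < p -> exists i, tagging p = inr i.
Proof.
move=> p1; case E : (tagging p) => [b|i]; last by exists i.
by move: p1; rewrite -(taggingK p) E; case: b {E}.
Qed.
End Tagging.

Definition forces_equal (m : nat) (A : rel 'I_m.+2) := forall (col : 'I_m.+2 -> bool) (rho : 'I_m.+2 -> nat),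
  (forall p q, A p q -> col p = col q -> rho p < rho q) -> col ord0 = col (inord 1).
(** As monochromatic arcs join vertices of the same [side], no monochromatic path leads from one
    end to the other, and the colouring puts no constraint on the ranks of the ends. *)
Definition allows_equal (m : nat) (A : rel 'I_m.+2) := forall k : bool,
  exists (col side : 'I_m.+2 -> bool) (rho : 'I_m.+2 -> nat),
  [/\ col ord0 = k /\ col (inord 1) = k, side ord0 = false /\ side (inord 1) = true, rho ord0 = rho (inord 1) &
  forall p q, A p q -> col p = col q -> side p = side q /\ rho p < rho q].
(** The drawing contains the diagonal between the two ends, so that the slot may also be
    filled by a single arc. *)
Definition slot_drawing (R : realType) (m : nat) (A : rel 'I_m.+2) :=
  exists (F : rel 'I_m.+2) (gp : 'I_m.+2 -> R * R) (gc : 'I_m.+2 -> 'I_m.+2 -> R -> R * R),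
  [/\ drawn (fun p q => F p q) gp gc, gp ord0 = (0, 0)%R /\ gp (inord 1) = (1, 0)%R,
      forall p : 'I_m.+2, 1 < p -> diamond (gp p),
      forall p q t, F p q -> (0 < t < 1)%R -> diamond (gc p q t) &
      F ord0 (inord 1) /\ forall p q, A p q -> F p q || F q p].

Lemma slot_gadget (R : realType) : (exists D : planar_oriented_graph R, ~ dicolourable 2 (sval D)) ->
  exists (m : nat) (A : rel 'I_m.+2), [/\ forall p q, A p q -> ~~ A q p,
    forces_equal A, allows_equal A & slot_drawing R A].
Proof.
case/critical_graph => D [plD ndic crit].
have [u [v0 uv0]] : exists u v : D, adj u v.
  apply: contrapT => H; apply: ndic; apply/dicolourable2P; exists xpredT, (fun=> 0) => x y /arc_adj xy.
  by case: H; exists x, y.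
have [P [c d]] := drawn_planar plD.
have [|v [uv [P' [c' [d' Pu Pw hP hC]]]]] := subdivided_drawing (u := u) d; first by exists v0.
pose I : finType := option (inner u * bool); pose beta := @tagging I.
exists #|I|, (fun p q => series_arc v (beta p) (beta q)); split.
- by move=> p q; exact: series_arc_anti.
- move=> col rho H; rewrite -[ord0](@taggingK I) -[inord 1](@taggingK I) tagging0 tagging1.
  apply: (series_forced (v := v) ndic (col := fun x => col (@untag I x)) (rho := fun x => rho (@untag I x))) => x y xy; apply: H.
  by rewrite /beta !untagK.
- move=> k; have [col [side [rho [ends r01 H]]]] := series_sound ndic (crit _ _ uv) k.
  exists (fun p => col (beta p)), (fun p => side (beta p)), (fun p => rho (beta p)).
  rewrite /beta !tagging0 !tagging1; have [-> ->] := ends false; have [-> ->] := ends true.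
  by split=> // p q; exact: H.
have sd := series_drawn d' Pu Pw hP hC.
have bi : injective beta := can_inj (@taggingK I).
exists (fun p q => series_edge (sube u v) (beta p) (beta q)), (fun p => series_pos P' (beta p)),
  (fun p q => series_curve (sube u v) c' (beta p) (beta q)); split.
- exact: drawn_comp bi sd.
- by rewrite /beta tagging0 tagging1.
- move=> p /tagging_inner[i E]; rewrite /beta E.
  by have [] := @series_pos_inner _ _ _ P' hP (inr i) false.
- by move=> p q t pq tI; exact: series_curve_inner.
split; first by rewrite /beta tagging0 tagging1 /series_edge !eqxx.
move=> p q /series_arcP[s [sp sq]] /sub_arc_sube/orP[] h; apply/orP; [left|right];
by rewrite /series_edge /series_rel; case: s sp sq => sp sq; rewrite sp sq h ?orbT.
Qed.

(** * The host graph *)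

Section Decode.
Variables (w m : nat).
Notation K := (2 * m).+1.
(** Functions on the vertices of the host graph are given by a function of the lattice
    points and one of the interior vertices of slots. *)
Definition decode (T : Type) (f : nat -> nat -> T) (g : nat -> nat -> bool -> nat -> T) (u : nat) : T :=
  let i := u %/ K %/ w.+1 in let j := u %/ K %% w.+1 in
  if u %% K is a.+1 then g i j (m <= a) (a - (m <= a) * m) else f i j.

Lemma decode_pt T f g i j : j < w.+1 -> @decode T f g ((i * w.+1 + j) * K) = f i j.
Proof. by move=> jw; rewrite /decode modnMl mulnK // divnMDl // modnMDl divn_small // modn_small // addn0. Qed.
Lemma decode_inner T f g i j (d : bool) k : j < w.+1 -> k < m ->
  @decode T f g ((i * w.+1 + j) * K + (d * m + k).+1) = g i j d k.
Proof.
move=> jw km; have h : (d * m + k).+1 < K by case: d => /=; rewrite ?mul1n ?mul0n ltnS; lia.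
rewrite /decode modnMDl (modn_small h) divnMDl // (divn_small h) addn0 divnMDl // modnMDl divn_small // modn_small // addn0.
have -> : (m <= d * m + k) = d by case: (d); rewrite ?mul1n ?mul0n ?leq_addr //; apply/negbTE; rewrite -ltnNge.
by rewrite addKn.
Qed.

Lemma decode_idx T f g i j (d : bool) (p : 'I_m.+2) : j < w -> @decode T f g (gidx w m i j d p) =
  match val p with 0 => f i j | 1 => f (i + d) (j + ~~ d) | k.+2 => g i j d k end.
Proof.
move=> jw; have jw' : j < w.+1 := ltnW jw; case: p => -[|[|k]] pm /=.
- exact: decode_pt.
- by rewrite decode_pt //; case: d => /=; rewrite ?addn0 ?addn1.
by rewrite decode_inner.
Qed.

Definition place_of (u : nat) : nat * nat * option (bool * nat) :=
  decode (fun i j => (i, j, None)) (fun i j d k => (i, j, Some (d, k))) u.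
Lemma place_of_idx i j (d : bool) (p : 'I_m.+2) : j < w -> place_of (gidx w m i j d p) =
  match val p with 0 => (i, j, None) | 1 => (i + d, j + ~~ d, None) | k.+2 => (i, j, Some (d, k)) end.
Proof. exact: decode_idx. Qed.

Lemma gidx_slot_inj i j d (p q : 'I_m.+2) : j < w -> gidx w m i j d p = gidx w m i j d q -> p = q.
Proof.
move=> jw /(congr1 place_of); rewrite !place_of_idx //.
case: p q => [[|[|p]] pm] [[|[|q]] qm] //= E; apply: val_inj => //=; move: E; case: d => -[] /=; lia.
Qed.

(** Two distinct vertices of a slot determine it, hence no two slots share an edge. *)
Lemma gidx_pair_inj i j d (p q : 'I_m.+2) i' j' d' (p' q' : 'I_m.+2) : j < w -> j' < w -> p != q ->
  gidx w m i j d p = gidx w m i' j' d' p' -> gidx w m i j d q = gidx w m i' j' d' q' ->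
  [/\ i = i', j = j', d = d', p = p' & q = q'].
Proof.
move=> jw jw' pq E1 E2.
suff [ei ej ed] : [/\ i = i', j = j' & d = d'].
  by subst; rewrite (gidx_slot_inj jw E1) (gidx_slot_inj jw E2).
move: (congr1 place_of E1) (congr1 place_of E2); rewrite !place_of_idx // {E1 E2}.
have {pq} : val p != val q by [].
move=> pq E1 E2; move: pq (congr1 (fun x => x.1.1) E1) (congr1 (fun x => x.1.2) E1) (congr1 snd E1)
  (congr1 (fun x => x.1.1) E2) (congr1 (fun x => x.1.2) E2) (congr1 snd E2) => {E1 E2}.
case: p q p' q' => [[|[|p]] pm] [[|[|q]] qm] [[|[|p']] pm'] [[|[|q']] qm'] //= _;
  by case: d d' => -[] //= *; split=> //; lia.
Qed.

Lemma gidx_lt h i j d (p : 'I_m.+2) : i < h -> j < w -> gidx w m i j d p < h.+1 * w.+1 * K.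
Proof.
move=> ih jw.
have aux a b c : a < h.+1 -> b < w.+1 -> c < K -> (a * w.+1 + b) * K + c < h.+1 * w.+1 * K.
  move=> ah bw cK; apply: (@leq_trans ((a * w.+1 + b).+1 * K)); first by rewrite (mulSnr (_ + b)) ltn_add2l.
  rewrite leq_mul2r; apply/orP; right; apply: (@leq_trans (a.+1 * w.+1)); first by rewrite (mulSnr a) -addnS leq_add2l.
  by rewrite leq_mul2r ah orbT.
have aux0 a b : a < h.+1 -> b < w.+1 -> (a * w.+1 + b) * K < h.+1 * w.+1 * K.
  by move=> ah bw; have := aux a b 0 ah bw isT; rewrite addn0.
case: p => -[|[|k]] pm /=.
- by apply: aux0; apply: ltnW.
- by apply: aux0; case: (d) => /=; rewrite ?addn0 ?addn1 // ltnW.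
apply: aux; [exact: ltnW|exact: ltnW|].
by rewrite ltnS; case: (d) => /=; rewrite ?mul1n ?mul0n; lia.
Qed.
End Decode.

Section HostGraph.
Variables (m : nat) (A : rel 'I_m.+2).
Hypothesis A_anti : forall p q, A p q -> ~~ A q p.
Hypothesis A_force : forces_equal A.
Hypothesis A_allow : allows_equal A.
Variables (h w : nat) (st : nat -> nat -> bool -> nat).
Notation K := (2 * m).+1.
(** The contents of a slot: 0 for none, 1 and 2 for a single arc in either direction, 3 for
    the gadget. *)
Definition slot_rel (t : nat) : rel 'I_m.+2 := fun p q =>
  match t with
  | 1 => (p == ord0) && (q == inord 1) | 2 => (q == ord0) && (p == inord 1)
  | 3 => A p q | _ => false end.
Definition host_arc (a b : nat) : bool :=
  [exists x : 'I_h * 'I_w * bool * 'I_m.+2 * 'I_m.+2,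
    [&& a == gidx w m x.1.1.1.1 x.1.1.1.2 x.1.1.2 x.1.2, b == gidx w m x.1.1.1.1 x.1.1.1.2 x.1.1.2 x.2
      & slot_rel (st x.1.1.1.1 x.1.1.1.2 x.1.1.2) x.1.2 x.2]].
Lemma host_arcP a b : reflect (exists i j d (p q : 'I_m.+2), [/\ i < h, j < w, a = gidx w m i j d p,
   b = gidx w m i j d q & slot_rel (st i j d) p q]) (host_arc a b).
Proof.
apply: (iffP existsP) => [[[[[[i j] d] p] q]] /= /and3P[/eqP -> /eqP -> s]|[i [j [d [p [q [ih jw -> -> s]]]]]]].
  by exists i, j, d, p, q; rewrite !ltn_ord.
by exists (Ordinal ih, Ordinal jw, d, p, q); rewrite /= !eqxx.
Qed.

Lemma slot_rel_anti t p q : slot_rel t p q -> ~~ slot_rel t q p.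
Proof.
case: t => [|[|[|[|t]]]] //=; last exact: A_anti.
- by case/andP => /eqP -> /eqP ->; apply/negP => /andP[/eqP/(congr1 val)]; rewrite /= inordK.
by case/andP => /eqP -> /eqP ->; apply/negP => /andP[/eqP/(congr1 val)]; rewrite /= inordK.
Qed.

Lemma slot_rel_neq t p q : slot_rel t p q -> p != q.
Proof. by move=> s; apply/eqP => e; have := slot_rel_anti s; rewrite -e; move: s; rewrite -e => ->. Qed.
Lemma host_anti a b : host_arc a b -> ~~ host_arc b a.
Proof.
case/host_arcP => i [j [d [p [q [ih jw -> -> s]]]]]; apply/host_arcP => -[i' [j' [d' [q' [p' [ih' jw' eq ep s']]]]]].
have [ei ej ed ep' eq'] := gidx_pair_inj jw jw' (slot_rel_neq s) ep eq; subst.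
by have := slot_rel_anti s; rewrite s'.
Qed.

Definition host_size := h.+1 * w.+1 * K.
Definition host_adj : rel 'I_host_size := fun a b => host_arc a b || host_arc b a.
Lemma host_adj_sym : symmetric host_adj. Proof. by move=> a b; rewrite /host_adj orbC. Qed.
Lemma host_adj_irrefl : irreflexive host_adj.
Proof. by move=> a; rewrite /host_adj orbb; case s : (host_arc a a) => //; have := host_anti s; rewrite s. Qed.
Definition host_simple := SimpleGraph host_adj_sym host_adj_irrefl.
Definition host_rel : rel host_simple := fun a b => host_arc (a : 'I_host_size) (b : 'I_host_size).
Lemma host_arc_adj (a b : host_simple) : host_rel a b -> adj a b.
Proof. by rewrite /host_rel /= /host_adj => ->. Qed.
Lemma host_orient (a b : host_simple) : adj a b -> host_rel a b (+) host_rel b a.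
Proof. by rewrite /host_rel /= => /orP[] s; rewrite s (negbTE (host_anti s)). Qed.
Definition host_graph := OrientedGraph host_arc_adj host_orient.

Lemma host_planar (R : realType) : slot_drawing R A -> planar R host_graph.
Proof.
case=> F [gp [gc [D [g0 g1] gd gcd [F01 AF]]]].
pose e (a b : 'I_host_size) := [exists x : 'I_h * 'I_w * bool * 'I_m.+2 * 'I_m.+2,
    [&& val a == gidx w m x.1.1.1.1 x.1.1.1.2 x.1.1.2 x.1.2, val b == gidx w m x.1.1.1.1 x.1.1.1.2 x.1.1.2 x.2
      & F x.1.2 x.2]].
have [|c dr] := @host_drawn w m R F gp gc D g0 g1 gd gcd _ e.
  move=> a b /existsP[[[[[i j] d] p] q]] /= /and3P[/eqP ea /eqP eb f].
  by exists i, j, d, p, q.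
apply: (@planar_drawn R host_simple (fun a b => host_adj a b && e a b) _ c); last 1 first.
- by apply: drawn_sub dr => a b /andP[].
- move=> a b ab; have ab' : host_adj a b := ab.
  have ba' : host_adj b a by rewrite host_adj_sym.
  rewrite ab' ba' /=; clear ab ba'; wlog: a b ab' / host_arc a b.
    by move=> H; case/orP: (ab') => s; [exact: H|rewrite orbC; apply: H => //; rewrite host_adj_sym].
  case/host_arcP => i [j [d [p [q [ih jw ea eb s]]]]].
  have : F p q || F q p.
    move: s; case: (st i j d) => [|[|[|[|t]]]] //=; last exact: AF.
    - by case/andP => /eqP -> /eqP ->; rewrite F01.
    - by case/andP => /eqP -> /eqP ->; rewrite F01 orbT.
  case/orP => f; apply/orP; [left|right]; apply/existsP.
    by exists (Ordinal ih, Ordinal jw, d, p, q); rewrite /= ea eb !eqxx.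
  by exists (Ordinal ih, Ordinal jw, d, q, p); rewrite /= ea eb !eqxx.
by move=> a b /andP[].
Qed.

(** What the slots require of the colours [pc] and ranks [pr] of the lattice points alone. *)
Definition valid_points (pc : nat -> nat -> bool) (pr : nat -> nat -> nat) :=
  forall i j (d : bool), i < h -> j < w ->
  match st i j d with
  | 1 => pc i j = pc (i + d) (j + ~~ d) -> pr i j < pr (i + d) (j + ~~ d)
  | 2 => pc i j = pc (i + d) (j + ~~ d) -> pr (i + d) (j + ~~ d) < pr i j
  | 3 => pc i j = pc (i + d) (j + ~~ d)
  | _ => True
  end.

(** The gadgets are coloured by [allows_equal]. Their ranks are shifted by a multiple of a
    bound on all their ranks: by the rank of the first end on one side and by that of the
    second end on the other side, which agrees with the ranks of the lattice points
    and increases along all arcs. *)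
Lemma host_dicolourable : dicolourable 2 host_graph <-> exists pc pr, valid_points pc pr.
Proof.
rewrite dicolourable2P; split.
  case=> col [rho H].
  pose c (a : nat) := oapp col false (insub a); pose r (a : nat) := oapp rho 0 (insub a).
  have {}H a b : a < host_size -> b < host_size -> host_arc a b -> c a = c b -> r a < r b.
    by move=> ha hb ab; rewrite /c /r !insubT /=; apply: H.
  exists (fun i j => c (gidx w m i j false 0)), (fun i j => r (gidx w m i j false 0)) => i j d ih jw.
  have Hs p q : slot_rel (st i j d) p q -> c (gidx w m i j d p) = c (gidx w m i j d q) ->
     r (gidx w m i j d p) < r (gidx w m i j d q).
    move=> s; apply: H; rewrite ?gidx_lt //; apply/host_arcP; by exists i, j, d, p, q.
  have e1 : gidx w m (i + d) (j + ~~ d) false 0 = gidx w m i j d (inord 1 : 'I_m.+2) by rewrite inordK.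
  have e0 : gidx w m i j false 0 = gidx w m i j d (ord0 : 'I_m.+2) by [].
  rewrite e1 e0; case E : (st i j d) => [|[|[|[|t]]]] // ; move: Hs; rewrite E => Hs.
  - by apply: Hs; rewrite /= !eqxx.
  - by move=> e; apply: Hs; rewrite ?e //= !eqxx.
  exact: (A_force (col := fun p => c (gidx w m i j d p)) Hs).
case=> pc [pr V].
have [G1 [S1 [r1 [[c10 c11] [s10 s11] r101 H1]]]] := A_allow true.
have [G0 [S0 [r0 [[c00 c01] [s00 s01] r001 H0]]]] := A_allow false.
pose G (k : bool) := if k then G1 else G0; pose S (k : bool) := if k then S1 else S0.
pose r (k : bool) := if k then r1 else r0.
have G0' k : G k ord0 = k by case: k. have G1' k : G k (inord 1) = k by case: k.
have S0' k : S k ord0 = false by case: k. have S1' k : S k (inord 1) = true by case: k.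
have r01 k : r k (inord 1) = r k ord0 by case: k.
have HA k p q : A p q -> G k p = G k q -> S k p = S k q /\ r k p < r k q by case: k; [exact: H1|exact: H0].
pose B := (\max_p r1 p + \max_p r0 p).+1.
have rB k p : r k p < B.
  rewrite ltnS /r; case: k; [apply: leq_trans (leq_addr _ _)|apply: leq_trans (leq_addl _ _)]; exact: leq_bigmax.
pose col u := decode w m pc (fun i j d k => G (pc i j) (inord k.+2)) u.
pose side i j (d s : bool) := if s then pr (i + d) (j + ~~ d) else pr i j.
pose rho u := decode w m (fun i j => pr i j * B + r (pc i j) ord0)
   (fun i j d k => side i j d (S (pc i j) (inord k.+2)) * B + r (pc i j) (inord k.+2)) u.
exists (fun u : 'I_host_size => col u), (fun u : 'I_host_size => rho u) => a b.
case/host_arcP => i [j [d [p [q [ih jw -> -> s]]]]].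
have v0 (x : 'I_m.+2) : val x = 0 -> x = ord0 by move=> e; apply: val_inj.
have v1 (x : 'I_m.+2) : val x = 1 -> x = inord 1 by move=> e; apply: val_inj; rewrite /= inordK.
have v2 (x : 'I_m.+2) k : val x = k.+2 -> x = inord k.+2 by move=> e; apply: val_inj; rewrite /= -e inord_val.
have := V i j d ih jw; move: s; case: (st i j d) => [|[|[|[|t]]]] //=.
- case/andP => /eqP -> /eqP ->; rewrite /col /rho !decode_idx //= !inordK //= => V' e; have := V' e.
  rewrite e; have := rB (pc (i + d) (j + ~~ d)) ord0; move: (r _ _) => z zB lt.
  by rewrite ltn_add2r ltn_pmul2r.
- case/andP => /eqP -> /eqP ->; rewrite /col /rho !decode_idx //= !inordK //= => V' e; have := V' (esym e).
  by rewrite e ltn_add2r ltn_pmul2r.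
move=> Apq eqc; set k := pc i j.
have cE (x : 'I_m.+2) : col (gidx w m i j d x) = G k x.
  rewrite /col decode_idx //; case E : (val x) => [|[|y]].
  - by rewrite (v0 _ E) G0'.
  - by rewrite (v1 _ E) G1' /k.
  - by rewrite (v2 _ _ E).
have rE (x : 'I_m.+2) : rho (gidx w m i j d x) = side i j d (S k x) * B + r k x.
  rewrite /rho decode_idx //; case E : (val x) => [|[|y]].
  - by rewrite (v0 _ E) S0' /side.
  - by rewrite (v1 _ E) S1' /side r01 -eqc.
  - by rewrite (v2 _ _ E).
by rewrite !cE !rE => /(HA _ _ _ Apq)[-> lt]; rewrite ltn_add2l.
Qed.
End HostGraph.

(** * The tiles of the crossbar *)

Local Open Scope nat_scope.
Definition point := (nat * nat)%type.
(** The wires of the block, as paths of gadgets, and the vertices of its directed cycle of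
    arcs. A block is a square of 5 by 5 lattice points; the middles of its sides are
    its ports. *)
Definition block := (seq (seq point) * seq point)%type.
(** From a port to the centre: top, right, bottom, left. *)
Definition half_wire (k : nat) : seq point :=
  match k with
  | 0 => [:: (0,2); (1,2); (2,2)] | 1 => [:: (2,4); (2,3); (2,2)]
  | 2 => [:: (4,2); (3,2); (2,2)] | _ => [:: (2,0); (2,1); (2,2)] end.
Definition star (ks : seq nat) : block := ([seq half_wire k | k <- ks], [::]).
(** The vertical wire, of colour [a], passes. Six of the eight vertices of the cycle are
    joined to it and the others are the ends of the wires on the left and right, so that
    the latter are not both of colour [a]. *)
Definition pass : block :=
  ([:: [:: (0,2); (1,2); (2,2); (3,2); (4,2)]; [:: (1,1); (0,1); (0,2); (0,3); (1,3)];
       [:: (3,1); (4,1); (4,2); (4,3); (3,3)]; [:: (2,0); (2,1)]; [:: (2,3); (2,4)]],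
   [:: (1,1); (1,2); (1,3); (2,3); (3,3); (3,2); (3,1); (2,1)]).
(** Two vertices of the cycle belong to the upper wire and two to the lower one, so that
    these have opposite colours. *)
Definition flip : block :=
  ([:: [:: (0,2); (1,2)]; [:: (0,2); (0,1); (1,1)]; [:: (2,2); (3,2); (4,2)]; [:: (2,1); (3,1); (3,2)]],
   [:: (1,1); (1,2); (2,2); (2,1)]).
Definition transp (p : point) : point := (p.2, p.1).
Definition hflip : block := (map (map transp) flip.1, map transp flip.2).

(** The column wire, of colour [a], is flipped between two copies of [pass] and flipped back
    after them. On the right of both copies is the negation of the outgoing colour, on the
    left the incoming colour, as far as [inlet] connects it. If it is connected to both,
    the incoming colour and that negation are not both [a] and not both the negation of [a], so
    they are opposite and the row crosses unchanged. If it is connected to only one of the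
    copies, the colour of the row may change, subject to one condition on [a]. *)
Definition crossing (inlet : seq nat) : seq (seq block) :=
  [:: [:: star [:: 1; 2]; pass; star [:: 3; 2]; star [::]];
      [:: star inlet;     flip; star [:: 0; 1; 2]; hflip];
      [:: star [:: 0; 1]; pass; star [:: 0; 3]; star [::]];
      [:: star [::];      flip; star [::]; star [::]]].
Definition border (mid : seq block) : seq (seq block) :=
  [:: [:: star [::]; star [:: 0; 2]; star [::]; star [::]]; mid;
      [:: star [::]; star [:: 0; 2]; star [::]; star [::]];
      [:: star [::]; star [:: 0; 2]; star [::]; star [::]]].
(** The tiles: 0 for a literal that does not occur, 1 and 2 for a positive and a negative one,
    3 for the first column, 4 and 5 for the last one, in the row 0 and in the rows of
    clauses. *)
Definition layout (t : nat) : seq (seq block) :=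
  match t with
  | 0 => crossing [:: 0; 2; 3] | 1 => crossing [:: 0; 3] | 2 => crossing [:: 2; 3]
  | 3 => border [:: star [::]; star [:: 0; 1; 2]; star [:: 1; 3]; hflip]
  | 4 => border [:: star [:: 1; 3]; star [:: 0; 2; 3]; star [::]; star [::]]
  | 5 => border [:: hflip; star [:: 0; 2; 3]; star [::]; star [::]]
  | _ => [::] end.
(** What a tile with column colour [a] requires of the row colours that enter and leave it. *)
Definition tile_rel (t : nat) (a yin yout : bool) : bool :=
  match t with
  | 0 => yin == yout
  | 1 => (yin != yout) ==> (a != yin)
  | 2 => (yin != yout) ==> (a == yin)
  | 3 => yout != a
  | 4 => yin == a
  | _ => yin != a end.

Definition shift (bi bj : nat) (p : point) : point := (5 * bi + p.1, 5 * bj + p.2).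
Definition block_at t bi bj : block := nth (star [::]) (nth [::] (layout t) bi) bj.
Definition places := [seq (bi, bj) | bi <- iota 0 4, bj <- iota 0 4].
(** The wires inside the blocks, and the gadgets between the ports of neighbouring blocks. *)
Definition tile_edges (t : nat) : seq (point * point) :=
  flatten [seq flatten [seq zip (map (shift b.1 b.2) s) (behead (map (shift b.1 b.2) s)) | s <- (block_at t b.1 b.2).1] | b <- places]
  ++ [seq (shift b.1 b.2 (2, 4), shift b.1 b.2 (2, 5)) | b <- places & b.2 < 3]
  ++ [seq (shift b.1 b.2 (4, 2), shift b.1 b.2 (5, 2)) | b <- places & b.1 < 3].
Definition tile_rings (t : nat) : seq (seq point) :=
  [seq r <- [seq map (shift b.1 b.2) (block_at t b.1 b.2).2 | b <- places] | r != [::]].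

Definition step_to (p : point) (d : bool) : point := (p.1 + d, p.2 + ~~ d).
(** The slots across the border of a tile are gadgets at the ports (7, 19) and (19, 7) and
    empty otherwise. *)
Definition tile_slot (t : nat) (p : point) (d : bool) : nat :=
  if d && (p.1 == 19) then (if p.2 == 7 then 3 else 0)
  else if ~~ d && (p.2 == 19) then (if p.1 == 7 then 3 else 0)
  else let q := step_to p d in
  if ((p, q) \in tile_edges t) || ((q, p) \in tile_edges t) then 3
  else if has (fun r => (p \in r) && (next r p == q)) (tile_rings t) then 1
  else if has (fun r => (q \in r) && (next r q == p)) (tile_rings t) then 2 else 0.

(** The points that wires connect to a given one; 30 rounds suffice for every net of a tile. *)
Fixpoint flood (E : seq (point * point)) (n : nat) (front acc : seq point) : seq point :=
  if n is n'.+1 then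
    let nbrs := [seq e.2 | e <- E & e.1 \in front] ++ [seq e.1 | e <- E & e.2 \in front] in
    let new := [seq q <- undup nbrs | q \notin acc] in flood E n' new (acc ++ new)
  else acc.
(** In every tile these points represent the nets that reach a port or a cycle. The colours
    of these nets decide all constraints, so that only the 2 ^ 8 colourings of the nets need to be examined. *)
Definition roots : seq point := [:: (0,7); (7,0); (7,19); (2,8); (7,7); (17,7); (12,6); (2,6)].
Definition nets t := [seq flood (tile_edges t) 30 [:: r] [:: r] | r <- roots].
Definition label (N : seq (seq point)) (p : point) := find (fun S => p \in S) N.
Fixpoint bseqs n : seq (seq bool) := if n is n'.+1 then map (cons true) (bseqs n') ++ map (cons false) (bseqs n') else [:: [::]].
Lemma mem_bseqs (s : seq bool) : s \in bseqs (size s).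
Proof. by elim: s => //= b s IH; rewrite mem_cat; apply/orP; case: b; [left|right]; apply: map_f. Qed.
Definition proper_rings (L : seq (seq nat)) (bs : seq bool) := all (fun l => ~~ constant (map (nth false bs) l)) L.
Definition ring_labels t := let N := nets t in map (map (label N)) (tile_rings t).
Definition port_labels t := map (label (nets t)) [:: (0,7); (7,0); (7,19); (19,7)].
Definition ring_of t p := nth [::] (tile_rings t) (find (fun r => p \in r) (tile_rings t)).
Definition geometry_check t : bool :=
  [&& all (fun e : point * point => has (fun d => ((e.2 == step_to e.1 d) && (tile_slot t e.1 d == 3))
        || ((e.1 == step_to e.2 d) && (tile_slot t e.2 d == 3))) [:: true; false]) (tile_edges t),
      all (fun e : point * point => [&& e.1.1 < 20, e.1.2 < 20, e.2.1 < 20 & e.2.2 < 20]) (tile_edges t),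
      all (fun r => all (fun p => let q := next r p in [&& p.1 < 20, p.2 < 20 & has (fun d => ((q == step_to p d) && (tile_slot t p d == 1))
        || ((p == step_to q d) && (tile_slot t q d == 2))) [:: true; false]]) r) (tile_rings t) &
      all (fun r => uniq r && (0 < size r) && all (fun p => ring_of t p == r) r) (tile_rings t)].
Definition net_check t : bool :=
  let N := nets t in all (fun e : point * point => label N e.1 == label N e.2) (tile_edges t).
(** In every colouring of the nets for which no cycle of arcs is monochromatic, the column
    colour passes and [tile_rel] holds. *)
Definition complete_check t : bool :=
  let L := ring_labels t in let l := port_labels t in
  all (fun k => k < 8) (flatten L ++ l) &&
  all (fun bs => proper_rings L bs ==> let c i := nth false bs (nth 0 l i) in
     (c 3 == c 0) && tile_rel t (c 0) (c 1) (c 2)) (bseqs 8).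
Definition pick_col (L : seq (seq nat)) (l : seq nat) (a yi yo : bool) : seq bool :=
  nth [::] (bseqs 8) (find (fun bs => (map (nth false bs) l == [:: a; yi; yo; a]) && proper_rings L bs) (bseqs 8)).
Definition tile_col t a yi yo p :=
  nth false (pick_col (ring_labels t) (port_labels t) a yi yo) (label (nets t) p).
(** Conversely, ports that satisfy [tile_rel] extend to such a colouring, found by
    search. *)
Definition sound_check t : bool :=
  let L := ring_labels t in let l := port_labels t in
  all (fun a => all (fun yi => all (fun yo => tile_rel t a yi yo ==>
    let bs := pick_col L l a yi yo in
    (map (nth false bs) l == [:: a; yi; yo; a]) && proper_rings L bs)
    [:: true; false]) [:: true; false]) [:: true; false].

Arguments tile_edges : simpl never.
Arguments tile_rings : simpl never.
Arguments tile_slot : simpl never.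
Arguments tile_rel : simpl never.
Arguments nets : simpl never.
Arguments ring_labels : simpl never.
Arguments port_labels : simpl never.
Arguments label : simpl never.
Arguments bseqs : simpl never.
Arguments pick_col : simpl never.
Arguments ring_of : simpl never.
Arguments roots : simpl never.
Lemma geometry_checked : all geometry_check (iota 0 6). Proof. by vm_compute. Qed.
Lemma net_checked : all net_check (iota 0 6). Proof. by vm_compute. Qed.
Lemma complete_checked : all complete_check (iota 0 6). Proof. by vm_compute. Qed.
Lemma sound_checked : all sound_check (iota 0 6). Proof. by vm_compute. Qed.

Lemma size_nets t : size (nets t) = 8. Proof. by rewrite /nets size_map. Qed.
Lemma nth_nets t k : k < 8 -> nth [::] (nets t) k =
  flood (tile_edges t) 30 [:: nth (0,0) roots k] [:: nth (0,0) roots k].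
Proof. by move=> k8; rewrite /nets (nth_map (0,0)). Qed.
Lemma mem_label N p : label N p < size N -> p \in nth [::] N (label N p).
Proof. by move=> h; apply: (nth_find [::] (a := fun S => p \in S)); rewrite has_find. Qed.
#[global] Opaque nets tile_edges tile_rings bseqs label.
Lemma all_iota (P : pred nat) n t : all P (iota 0 n) -> t < n -> P t.
Proof. by move=> /allP H tn; apply: H; rewrite mem_iota. Qed.

Section RingRank.
Variables (T : eqType) (col : T -> bool) (r : seq T).
Hypothesis ur : uniq r.
(** The position on the cycle, counted from just after a change of colour, so that the arc
    along which the rank drops is not monochromatic. *)
Definition ring_rank (p : T) : nat :=
  let k := find (fun q => col q != col (next r q)) r in (index p r + size r - k.+1) %% size r.

Lemma index_next p : p \in r -> index (next r p) r = (index p r).+1 %% size r.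
Proof.
case: r ur => // x s us ps; rewrite next_nth ps.
have : index p (x :: s) <= size s by rewrite -ltnS -/(size (x :: s)) index_mem.
move: (index p (x :: s)) => i; rewrite leq_eqVlt => /orP[/eqP ->|lt].
  by rewrite nth_default //= modnn /= eqxx.
rewrite modn_small //; have {1}-> : nth x s i = nth x (x :: s) i.+1 by [].
by rewrite index_uniq.
Qed.

Lemma has_change : ~~ constant (map col r) -> has (fun q => col q != col (next r q)) r.
Proof.
apply: contraR => /hasPn H; have := cycle_next ur; case: r H => // x s H cy.
have /= cy' : cycle [rel p q | col p == col q] (x :: s).
  apply: (sub_in_cycle (P := mem (x :: s))) cy; last by apply/allP.
  by move=> p q ps _ /eqP <-; have := H p ps; rewrite negbK.
apply/allP => b /mapP[q qs ->] /=.
have tr : transitive [rel p q | col p == col q] by move=> a b' c' /= /eqP -> /eqP ->.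
move: cy'; rewrite rcons_path => /andP[/(order_path_min tr) /allP H' _].
by rewrite eq_sym; exact: H'.
Qed.

Lemma ring_rankP p : ~~ constant (map col r) -> p \in r -> col p = col (next r p) ->
  ring_rank p < ring_rank (next r p).
Proof.
move=> nc pr cp; rewrite /ring_rank index_next //; set k := find _ r.
have hc := has_change nc.
have ks : k < size r by rewrite -has_find.
have nk : index p r != k.
  apply/eqP => e; have := nth_find p hc; rewrite -/k -e nth_index // => /eqP; exact.
have : index p r < size r by rewrite index_mem.
move: (index p r) nk => i nk li; move: (size r) ks li => s ks li.
have [lt|eq] : i.+1 < s \/ i.+1 = s by lia.
  rewrite (modn_small lt); have [h|h] := ltnP i k.
    by rewrite !modn_small; lia.
  have -> : i + s - k.+1 = (i - k.+1) + s by lia.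
  have -> : i.+1 + s - k.+1 = (i.+1 - k.+1) + s by lia.
  by rewrite !modnDr !modn_small; lia.
rewrite eq modnn add0n; have -> : i + s - k.+1 = (i - k.+1) + s by lia.
by rewrite modnDr !modn_small; lia.
Qed.
End RingRank.

Lemma div20 x a : a < 20 -> (20 * x + a) %/ 20 = x.
Proof. by move=> h; rewrite mulnC divnMDl // divn_small // addn0. Qed.
Lemma mod20 x a : a < 20 -> (20 * x + a) %% 20 = a.
Proof. by move=> h; rewrite mulnC modnMDl modn_small. Qed.

Lemma flood_col (pc : point -> bool) E n r front acc : (forall e, e \in E -> pc e.1 = pc e.2) ->
  (forall q, q \in front -> pc q = pc r) -> (forall q, q \in acc -> pc q = pc r) ->
  forall q, q \in flood E n front acc -> pc q = pc r.
Proof.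
move=> HE; elim: n front acc => [|n IH] front acc hf ha; first exact: ha.
rewrite [flood _ _ _ _]/=; set new := [seq q <- _ | _].
have hn q : q \in new -> pc q = pc r.
  rewrite mem_filter mem_undup mem_cat => /andP[_ /orP[]] /mapP[e]; rewrite mem_filter => /andP[ef et] ->.
    by rewrite -(HE e et) hf.
  by rewrite (HE e et) hf.
by apply: IH => // q; rewrite mem_cat => /orP[]; [exact: ha|exact: hn].
Qed.

Lemma tile_colP t a yi yo : t < 6 -> tile_rel t a yi yo ->
  [/\ tile_col t a yi yo (0,7) = a, tile_col t a yi yo (7,0) = yi, tile_col t a yi yo (7,19) = yo,
      tile_col t a yi yo (19,7) = a & proper_rings (ring_labels t) (pick_col (ring_labels t) (port_labels t) a yi yo)].
Proof.
move=> t6 rel; have := all_iota sound_checked t6.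
have b2 (b : bool) : b \in [:: true; false] by case: b.
move=> /allP/(_ _ (b2 a))/allP/(_ _ (b2 yi))/allP/(_ _ (b2 yo))/implyP/(_ rel)/andP[].
rewrite /tile_col; move: (pick_col _ _ _ _ _) (proper_rings _) => bs pr; rewrite /port_labels.
by move: (label (nets t)) => lb /= /eqP[-> -> -> ->].
Qed.

Section Crossbar.
Variables (nr nc : nat) (tau : nat -> nat -> nat).
Hypothesis tau6 : forall r c, r < nr -> c < nc -> tau r c < 6.
Definition grid_slot (i j : nat) (d : bool) := tile_slot (tau (i %/ 20) (j %/ 20)) (i %% 20, j %% 20) d.

Lemma grid_slotE r c p d : p.1 < 20 -> p.2 < 20 -> grid_slot (20 * r + p.1) (20 * c + p.2) d = tile_slot (tau r c) p d.
Proof.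
by case: p => a b /= ha hb; rewrite /grid_slot !div20 // !mod20.
Qed.

Lemma net_label_col (pc : point -> bool) t : (forall e, e \in tile_edges t -> pc e.1 = pc e.2) ->
  forall p, label (nets t) p < 8 -> pc p = pc (nth (0, 0) roots (label (nets t) p)).
Proof.
move=> H p lp.
have := lp; rewrite -{1}(size_nets t) => /mem_label; rewrite (nth_nets t lp).
by apply: (flood_col H) => q; rewrite inE => /eqP ->.
Qed.

Lemma tile_complete (pc : point -> bool) t : t < 6 -> (forall e, e \in tile_edges t -> pc e.1 = pc e.2) ->
  (forall r, r \in tile_rings t -> ~~ constant (map pc r)) ->
  pc (19, 7) = pc (0, 7) /\ tile_rel t (pc (0, 7)) (pc (7, 0)) (pc (7, 19)).
Proof.
move=> t6 He Hr; have /andP[/allP lab /allP chk] := all_iota complete_checked t6.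
pose bs := map pc roots; have bs8 : bs \in bseqs 8 by exact: (mem_bseqs bs).
have cE p : label (nets t) p < 8 -> nth false bs (label (nets t) p) = pc p.
  by move=> lp; rewrite (net_label_col He lp) (nth_map (0, 0)).
have pl p : p \in [:: (0,7); (7,0); (7,19); (19,7)] -> label (nets t) p < 8.
  move=> hp; apply: lab; rewrite mem_cat; apply/orP; right; exact: map_f.
have := chk _ bs8; have -> /= : proper_rings (ring_labels t) bs.
  apply/allP => l /mapP[r rt ->]; rewrite -map_comp.
  rewrite (_ : map _ r = map pc r) ?Hr //; apply/eq_in_map => p pr /=.
  apply: cE; apply: lab; rewrite mem_cat; apply/orP; left; apply/flattenP; exists (map (label (nets t)) r); exact: map_f.
move: (label (nets t)) cE pl => lb cE pl.
rewrite (cE _ (pl (19,7) isT)) (cE _ (pl (0,7) isT)) (cE _ (pl (7,0) isT)) (cE _ (pl (7,19) isT)).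
by case/andP => /eqP -> ->.
Qed.

#[local] Opaque ring_of pick_col ring_labels port_labels.
Lemma tile_ring_rank (col : point -> bool) t s x : t < 6 -> s \in tile_rings t -> x \in s ->
  ~~ constant (map col s) -> col x = col (next s x) ->
  ring_rank col (ring_of t x) x < ring_rank col (ring_of t (next s x)) (next s x).
Proof.
move=> t6 st xs ncs eqc; have /and4P[_ _ _ g4] := all_iota geometry_checked t6.
have /andP[/andP[us _] ro] := allP g4 _ st.
have nx : next s x \in s by rewrite mem_next.
rewrite (eqP (allP ro _ xs)) (eqP (allP ro _ nx)); exact: ring_rankP.
Qed.

(** Ranks cannot increase all along a monochromatic cycle, so no cycle is monochromatic. *)
Lemma crossbar_complete pc pr : valid_points (20 * nr) (20 * nc) grid_slot pc pr ->
  exists (a : nat -> bool) (y : nat -> nat -> bool), forall r c, r < nr -> c < nc -> tile_rel (tau r c) (a c) (y r c) (y r c.+1).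
Proof.
move=> V; pose loc r c p := pc (20 * r + p.1) (20 * c + p.2); pose rk r c p := pr (20 * r + p.1) (20 * c + p.2).
have W r c p d : r < nr -> c < nc -> p.1 < 20 -> p.2 < 20 ->
  match tile_slot (tau r c) p d with
  | 1 => loc r c p = loc r c (step_to p d) -> rk r c p < rk r c (step_to p d)
  | 2 => loc r c p = loc r c (step_to p d) -> rk r c (step_to p d) < rk r c p
  | 3 => loc r c p = loc r c (step_to p d) | _ => True end.
  move=> hr hc h1 h2; rewrite -(grid_slotE r c d h1 h2).
  have := V (20 * r + p.1) (20 * c + p.2) d; rewrite /loc /rk /= !addnA.
  by apply; lia.
have T r c : r < nr -> c < nc -> loc r c (19, 7) = loc r c (0, 7) /\
   tile_rel (tau r c) (loc r c (0, 7)) (loc r c (7, 0)) (loc r c (7, 19)).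
  move=> hr hc; have t6 := tau6 hr hc; have /and4P[/allP g1 /allP g2 /allP g3 /allP g4] := all_iota geometry_checked t6.
  apply: tile_complete => // [e et|s st].
    have /and4P[e1 e2 e3 e4] := g2 _ et; have /hasP[d _ /orP[]/andP[/eqP e5 /eqP e6]] := g1 _ et.
      by have := W r c e.1 d hr hc e1 e2; rewrite e6 e5.
    by have := W r c e.2 d hr hc e3 e4; rewrite e6 e5.
  have /andP[/andP[us s0] _] := g4 _ st; apply/negP => cs.
  have eqc p q : p \in s -> q \in s -> loc r c p = loc r c q.
    move: cs; case: (s) => // x s' /= /allP H.
    have H' z : z \in x :: s' -> loc r c z = loc r c x.
      by rewrite inE => /orP[/eqP -> //|zs]; apply/eqP/H/map_f.
    by move=> /H' -> /H' ->.
  have inc p : p \in s -> rk r c p < rk r c (next s p).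
    move=> ps; have nps : next s p \in s by rewrite mem_next.
    have /and3P[p1 p2 /hasP[d _]] := allP (g3 _ st) _ ps.
    have /and3P[q1 q2 _] := allP (g3 _ st) _ nps.
    case/orP => /andP[/eqP e5 /eqP e6].
      by have := W r c p d hr hc p1 p2; rewrite e6 -e5; apply; exact: eqc.
    by have := W r c (next s p) d hr hc q1 q2; rewrite e6 -e5; apply; exact: eqc.
  have := cycle_next us; case: (s) s0 inc => // x s' _ inc cy.
  have : cycle (fun p q => rk r c p < rk r c q) (x :: s').
    apply: (sub_in_cycle (P := mem (x :: s'))) cy; last by apply/allP.
    by move=> p q ps _ /eqP <-; exact: inc.
  rewrite /= rcons_path => /andP[pa la].
  have tr : transitive (fun p q => rk r c p < rk r c q) by move=> b a d; exact: ltn_trans.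
  have := order_path_min tr pa => /allP H; have := mem_last x s'; rewrite inE => /orP[/eqP e|/H h].
    by move: la; rewrite e ltnn.
  by have := ltn_trans la h; rewrite ltnn.
exists (fun c => loc 0 c (0, 7)), (fun r c => loc r c (7, 0)) => r c hr hc.
have aE : loc r c (0, 7) = loc 0 c (0, 7).
  elim: r hr => // r IH hr; have hr' : r < nr by apply: ltnW.
  rewrite -(IH hr') -(T r c hr' hc).1.
  have := W r c (19, 7) true hr' hc isT isT; rewrite /= => ->.
  by rewrite /loc /=; congr pc; lia.
have yE : loc r c (7, 19) = loc r c.+1 (7, 0).
  have := W r c (7, 19) false hr hc isT isT; rewrite /= => ->.
  by rewrite /loc /=; congr pc; lia.
by rewrite -aE -yE; have [] := T r c hr hc.
Qed.

(** Each tile is coloured by the search in [sound_check]; its entering ports are given the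
    prescribed colours directly, since the slots at the far border of the grid lead to
    ports that belong to no tile. *)
Lemma crossbar_sound (a : nat -> bool) (y : nat -> nat -> bool) :
  (forall r c, r < nr -> c < nc -> tile_rel (tau r c) (a c) (y r c) (y r c.+1)) ->
  exists pc pr, valid_points (20 * nr) (20 * nc) grid_slot pc pr.
Proof.
move=> H.
pose tc r c p := tile_col (tau r c) (a c) (y r c) (y r c.+1) p.
pose pc i j := let r := i %/ 20 in let c := j %/ 20 in let p := (i %% 20, j %% 20) in
  if p == (0, 7) then a c else if p == (7, 0) then y r c else tc r c p.
pose pr i j := let r := i %/ 20 in let c := j %/ 20 in let p := (i %% 20, j %% 20) in
  ring_rank (tc r c) (ring_of (tau r c) p) p.
have pc07 r c : pc (20 * r + 0) (20 * c + 7) = a c.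
  by rewrite /pc (@div20 c 7 isT) (@mod20 r 0 isT) (@mod20 c 7 isT).
have pc70 r c : pc (20 * r + 7) (20 * c + 0) = y r c.
  by rewrite /pc (@div20 r 7 isT) (@div20 c 0 isT) (@mod20 r 7 isT) (@mod20 c 0 isT).
have F r c : r < nr -> c < nc -> [/\ tc r c (0, 7) = a c, tc r c (7, 0) = y r c, tc r c (7, 19) = y r c.+1,
   tc r c (19, 7) = a c & proper_rings (ring_labels (tau r c)) (pick_col (ring_labels (tau r c)) (port_labels (tau r c)) (a c) (y r c) (y r c.+1))].
  by move=> hr hc; apply: tile_colP; [exact: tau6|exact: H].
have pcE r c p : r < nr -> c < nc -> p.1 < 20 -> p.2 < 20 -> pc (20 * r + p.1) (20 * c + p.2) = tc r c p.
  move=> hr hc; case: p => p1 p2 /= h1 h2; rewrite /pc (div20 _ h1) (div20 _ h2) (mod20 _ h1) (mod20 _ h2).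
  have [f1 f2 _ _ _] := F r c hr hc; case: eqP => [-> //|_]; by case: eqP => [-> //|_].
have prE r c p : p.1 < 20 -> p.2 < 20 -> pr (20 * r + p.1) (20 * c + p.2) = ring_rank (tc r c) (ring_of (tau r c) p) p.
  by case: p => p1 p2 /= h1 h2; rewrite /pr (div20 _ h1) (div20 _ h2) (mod20 _ h1) (mod20 _ h2).
exists pc, pr => i j d hi hj.
have [r [c [p [hr hc p1 p2 [iE jE]]]]] : exists r c (p : point),
    [/\ r < nr, c < nc, p.1 < 20, p.2 < 20 & i = 20 * r + p.1 /\ j = 20 * c + p.2].
  exists (i %/ 20), (j %/ 20), (i %% 20, j %% 20).
  by split; rewrite ?ltn_mod ?ltn_divLR 1?[_ * 20]mulnC //; split; rewrite mulnC -divn_eq.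
subst i j.
have t6 := tau6 hr hc; have [f1 f2 f3 f4 f5] := F r c hr hc.
rewrite (grid_slotE r c d p1 p2) /tile_slot (pcE _ _ _ hr hc p1 p2).
have [/andP[d1 /eqP e19]|nb1] := boolP (d && (p.1 == 19)).
  have [e7|//] := eqVneq p.2 7; have dT : d = true := d1; subst d.
  rewrite (_ : p = (19, 7)) ?f4; last by rewrite -e19 -e7; case: (p).
  rewrite /= addn0 (_ : 20 * r + 19 + 1 = 20 * r.+1 + 0); last lia.
  by rewrite pc07.
have [/andP[/negbTE d0 /eqP e19]|nb2] := boolP (~~ d && (p.2 == 19)).
  have [e7|//] := eqVneq p.1 7; subst d.
  rewrite (_ : p = (7, 19)) ?f3; last by rewrite -e19 -e7; case: (p).
  rewrite /= addn0 (_ : 20 * c + 19 + 1 = 20 * c.+1 + 0); last lia.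
  by rewrite pc70.
pose q := step_to p d.
have q1 : q.1 < 20 by rewrite /q /=; move: nb1 p1; clear; case: d => /=; lia.
have q2 : q.2 < 20 by rewrite /q /=; move: nb2 p2; clear; case: d => /=; lia.
have -> : 20 * r + p.1 + d = 20 * r + q.1 by rewrite /q /= addnA.
have -> : 20 * c + p.2 + ~~ d = 20 * c + q.2 by rewrite /q /= addnA.
rewrite (pcE _ _ _ hr hc q1 q2) (prE _ _ _ p1 p2) (prE _ _ _ q1 q2) -/q.
have lab e : e \in tile_edges (tau r c) -> tc r c e.1 = tc r c e.2.
  by move=> /(allP (all_iota net_checked t6)) /eqP h; rewrite /tc /tile_col h.
have ringS s x : s \in tile_rings (tau r c) -> x \in s -> tc r c x = tc r c (next s x) ->
   ring_rank (tc r c) (ring_of (tau r c) x) x < ring_rank (tc r c) (ring_of (tau r c) (next s x)) (next s x).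
  move=> st xs e; have ncs := allP f5 (map (label (nets (tau r c))) s) (map_f _ st); rewrite -map_comp in ncs.
  exact: (@tile_ring_rank (tc r c) (tau r c) s x t6 st xs ncs e).
case: ifP => [/orP[] /lab //|_].
case: ifP => [/hasP[s st /andP[ps /eqP nq]]|_]; first (rewrite -nq => e; exact (ringS s p st ps e)).
case: ifP => [/hasP[s st /andP[qs /eqP nq]]|_]; last exact I.
rewrite -nq => e; exact (ringS s q st qs (esym e)).
Qed.
End Crossbar.

(** * Satisfiability on the crossbar *)

(** A CNF formula with [nv] variables and [ncl] clauses is given by its incidence matrix
    [lit]: 0 if the variable does not occur in the clause, 1 if it does, 2 if its negation
    does. *)
Section Cnf.
Variables (nv ncl : nat) (lit : nat -> nat -> nat).
Hypothesis lit3 : forall r v, r < ncl -> v < nv -> lit r v < 3.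
Definition cnf_tile (r c : nat) : nat :=
  if c == 0 then 3 else if c == nv.+1 then (if r == 0 then 4 else 5)
  else if r == 0 then 0 else lit r.-1 c.-1.
Definition true_lit (val : nat -> bool) (r v : nat) : bool :=
  ((lit r v == 1) && val v) || ((lit r v == 2) && ~~ val v).
Definition cnf_sat := exists val, forall r, r < ncl -> has (true_lit val r) (iota 0 nv).

Lemma cnf_tile6 r c : r < ncl.+1 -> c < nv.+2 -> cnf_tile r c < 6.
Proof.
rewrite /cnf_tile => hr hc; case: eqP => // c0; case: eqP => [_|c1]; first by case: (r == 0).
by case: eqP => // r0; apply: leq_trans (lit3 _ _) _; lia.
Qed.

(** Colours are only defined up to exchange, so the column 0 fixes which one means true.
    Every row starts with the colour of false. The row 0, which crosses all variables unchanged,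
    transmits this colour to the last column, and there the row of every clause must arrive
    with the other one. It must change somewhere on its way, which is possible only at a true
    literal. *)
Lemma cnf_crossbar : cnf_sat <-> exists (a : nat -> bool) (y : nat -> nat -> bool),
  forall r c, r < ncl.+1 -> c < nv.+2 -> tile_rel (cnf_tile r c) (a c) (y r c) (y r c.+1).
Proof.
split.
  case=> val sat; exists (fun c => if c == 0 then true else if c == nv.+1 then false else val c.-1).
  exists (fun r c => (0 < r) && has (true_lit val r.-1) (iota 0 c.-1)) => r c hr hc.
  rewrite /cnf_tile; case: c hc => [|c] hc; first by rewrite /tile_rel /= andbF.
  have E : iota 0 c.+2.-1 = rcons (iota 0 c) c by rewrite -[c.+2.-1]addn1 iotaD cats1.
  rewrite E (_ : (c.+1 == 0) = false) // eqSS -[c.+1.-1]/c; have [->|cn] := eqVneq c nv.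
    case: r hr => [|r] hr; first by rewrite /tile_rel.
    by rewrite /tile_rel /= sat.
  case: r hr => [|r] hr; first by rewrite /tile_rel.
  rewrite /= has_rcons.
  have cv : c < nv by lia.
  have := lit3 (hr : r < ncl) cv; rewrite /true_lit; case: (lit r c) => [|[|[|]]] // _; rewrite /tile_rel /= ?orbF //.
  - by case: (has _ _); case: (val c).
  - by case: (has _ _); case: (val c).
case=> a [y H]; pose k := ~~ a 0.
have y1 r : r < ncl.+1 -> y r 1 = k.
  by move=> hr; have := H r 0 hr isT; rewrite /tile_rel /= /k; case: (y r 1); case: (a 0).
have row0 c : c <= nv -> y 0 c.+1 = k.
  elim: c => [|c IH] hc; first exact: y1.
  have := H 0 c.+1 isT (ltnW _); rewrite /cnf_tile /= eqSS (ltn_eqF hc) /tile_rel /= => /(_ _)/eqP <- //; exact: IH (ltnW hc).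
have aend : a nv.+1 = k.
  by have := H 0 nv.+1 isT (leqnn _); rewrite /cnf_tile /= eqxx /tile_rel row0 // => /eqP.
exists (fun v => a v.+1 != k) => r hr; apply: contraT => /hasPn ns.
have row c : c <= nv -> y r.+1 c.+1 = k.
  elim: c => [|c IH] hc; first exact: y1.
  have := H r.+1 c.+1 hr (ltnW hc); rewrite /cnf_tile /= eqSS (ltn_eqF hc) IH ?(ltnW hc) //.
  have := ns c; rewrite mem_iota add0n => /(_ hc); rewrite /true_lit negb_or.
  have := lit3 hr hc; case: (lit r c) => [|[|[|]]] // _; rewrite /tile_rel /=.
  - by move=> _ /eqP.
  - by move=> /andP[/negbNE/eqP -> _]; rewrite eqxx; case: eqP.
  - by rewrite negbK => h; rewrite (negbTE h); case: eqP.
have := H r.+1 nv.+1 hr (leqnn _); rewrite /cnf_tile /= eqxx /tile_rel /= row // aend.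
by rewrite eqxx.
Qed.

Section Reduction.
Variables (m : nat) (A : rel 'I_m.+2).
Hypothesis A_anti : forall p q, A p q -> ~~ A q p.
Hypothesis A_force : forces_equal A.
Hypothesis A_allow : allows_equal A.
Definition cnf_graph := host_graph A_anti (20 * ncl.+1) (20 * nv.+2) (grid_slot cnf_tile).
Lemma cnf_graphP : dicolourable 2 cnf_graph <-> cnf_sat.
Proof.
rewrite cnf_crossbar (host_dicolourable A_anti A_force A_allow); split.
  by case=> pc [pr V]; apply: (crossbar_complete _ V) => r c; exact: cnf_tile6.
by case=> a [y H]; apply: (crossbar_sound _ H) => r c; exact: cnf_tile6.
Qed.
End Reduction.
End Cnf.

(** * Programs for multitape machines *)

Section Views.
Variable A : Type.
(** A tape as a function of the signed distance to the head. Moving the head shifts the function,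
    which makes the transition local. *)
Definition view (tp : tape A) (z : int) : option A :=
  match z with
  | Posz 0 => tape_head tp | Posz n.+1 => nth None (tape_right tp) n | Negz n => nth None (tape_left tp) n end.
Definition dir_shift (d : direction) : int :=
  match d with MoveLeft => Negz 0 | Stay => Posz 0 | MoveRight => Posz 1 end.

Lemma view_write a tp z : view (tape_write a tp) z = if z == 0%R then a else view tp z.
Proof. by case: z => [[|n]|n]. Qed.
Lemma view_move d tp z : view (tape_move d tp) z = view tp (z + dir_shift d)%R.
Proof.
case: tp => l h r; case: d => /=; last 2 first.
- by rewrite addr0.
- case: z => [n|[|n]].
  + by rewrite -PoszD addn1; case: n => [|n] /=; rewrite ?nth0 ?nth_behead.
  + by [].
  + by rewrite (_ : (Negz n.+1 + 1)%R = Negz n) //; lia.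
case: z => [[|[|n]]|n].
- by rewrite /= nth0.
- by rewrite (_ : (Posz 1 + Negz 0)%R = 0%R) //; lia.
- by rewrite (_ : (Posz n.+2 + Negz 0)%R = Posz n.+1) //; lia.
by rewrite (_ : (Negz n + Negz 0)%R = Negz n.+1) /= ?nth_behead //; lia.
Qed.

Definition word_cells (s : seq A) (z : int) : option A := if z is Posz n then nth None (map some s) n else None.
Lemma view_tape_of s z : view (tape_of s) z = word_cells s z.
Proof.
rewrite /tape_of; case: z => [[|n]|n] /=; last by rewrite nth_nil.
  by rewrite nth0.
by rewrite nth_behead.
Qed.
End Views.

Section ViewRun.
Variable M : machine.
Notation symbol := (bool + tm_aux M)%type.
Definition tapes_view := 'I_(tm_extra_tapes M).+1 -> int -> option symbol.
(** Writes, and then moves the head. *)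
Definition vact (ad : option symbol * direction) (f : int -> option symbol) (z : int) :=
  if (z + dir_shift ad.2 == 0)%R then ad.1 else f (z + dir_shift ad.2)%R.
Definition vstep (qv : tm_state M * tapes_view) : option (tm_state M * tapes_view) :=
  if tm_delta qv.1 [ffun i => qv.2 i 0%R] is Some (q, act)
  then Some (q, fun i => vact (act i) (qv.2 i)) else None.
Definition vrun t qv := iter t (fun c => odflt c (vstep c)) qv.
Definition cfg_view (c : config M) := (cfg_state c, fun i => view (cfg_tapes c i)).

Lemma vstep_view c : vstep (cfg_view c) = omap cfg_view (step c).
Proof.
rewrite /vstep /step /=; have -> : [ffun i => view (cfg_tapes c i) 0%R] = [ffun i => tape_head (cfg_tapes c i)].
  by apply/ffunP => i; rewrite !ffunE.
case: tm_delta => [[q act]|] //=; rewrite /cfg_view /=; congr (Some (_, _)).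
by apply/funext => i; apply/funext => z; exact: (esym (etrans (view_move _ _ _) (view_write _ _ _))).
Qed.

Lemma vrun_view t c : vrun t (cfg_view c) = cfg_view (run t c).
Proof. by elim: t => //= t IH; rewrite IH vstep_view; case: (step _). Qed.
Lemma halted_view c : halted c <-> vstep (cfg_view c) = None.
Proof. by rewrite vstep_view /halted; case: (step c). Qed.
Lemma vrun_halt t u qv : vstep (vrun t qv) = None -> t <= u -> vrun u qv = vrun t qv.
Proof. by move=> hlt /subnK <-; elim: (u - t) => //= k IH; rewrite IH hlt. Qed.
End ViewRun.

Lemma leading_bitsE (M : machine) (s : seq (option (bool + tm_aux M))) (o : word) :
  (forall k, nth None s k = nth None [seq Some (inl b) | b <- o] k) -> leading_bits s = o.
Proof.
elim: o s => [|b o IH] [|c s] H //=.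
- by have := H 0; rewrite /= => ->.
- by have := H 0.
by have := H 0; rewrite /= => ->; congr (_ :: _); apply: IH => k; exact: H k.+1.
Qed.

Notation cell := (option (bool + void)).
(** Structured programs for machines without auxiliary symbols. Tapes are named by natural
    numbers and tests look at the scanned symbol of one tape. *)
Inductive cmd : Type :=
  | Act of nat & option cell & direction
  | Seq of cmd & cmd
  | If of nat & (cell -> bool) & cmd & cmd
  | While of nat & (cell -> bool) & cmd.

(** The contents of the tapes in fixed coordinates and the positions of the heads. *)
Definition state := ((nat -> int -> cell) * (nat -> int))%type.
Definition upd (T : Type) (f : nat -> T) (i : nat) (x : T) := fun j => if j == i then x else f j.
Definition put (f : int -> cell) (p : int) (a : cell) := fun z => if z == p then a else f z.
Definition scan (S : state) (i : nat) : cell := S.1 i (S.2 i).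
Definition act_state (S : state) i w d : state :=
  (if w is Some a then upd S.1 i (put (S.1 i) (S.2 i) a) else S.1, upd S.2 i (S.2 i + dir_shift d)%R).

Inductive exec : cmd -> state -> state -> nat -> Prop :=
  | ExecAct i w d S : exec (Act i w d) S (act_state S i w d) 1
  | ExecSeq a b S S1 S2 n m : exec a S S1 n -> exec b S1 S2 m -> exec (Seq a b) S S2 (n + m)
  | ExecIfT i (t : cell -> bool) a b S S1 n : t (scan S i) -> exec a S S1 n -> exec (If i t a b) S S1 n.+1
  | ExecIfF i (t : cell -> bool) a b S S1 n : ~~ t (scan S i) -> exec b S S1 n -> exec (If i t a b) S S1 n.+1
  | ExecStop i (t : cell -> bool) a S : ~~ t (scan S i) -> exec (While i t a) S S 1
  | ExecLoop i (t : cell -> bool) a S S1 S2 n m : t (scan S i) -> exec a S S1 n -> exec (While i t a) S1 S2 m ->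
      exec (While i t a) S S2 (n + m).+1.

(** The states of the machine for a program are its program points. *)
Fixpoint ctrl (c : cmd) : finType :=
  match c with
  | Act _ _ _ => unit | Seq a b => (ctrl a + ctrl b)%type
  | If _ _ a b => option (ctrl a + ctrl b)%type | While _ _ a => option (ctrl a) end.
Fixpoint entry (c : cmd) : ctrl c :=
  match c with
  | Act _ _ _ => tt | Seq a b => inl (entry a) | If _ _ _ _ => None | While _ _ _ => None end.
Definition idle (h : nat -> cell) : nat -> cell * direction := fun j => (h j, Stay).
Fixpoint trans (c : cmd) : ctrl c -> (nat -> cell) -> option (ctrl c) * (nat -> cell * direction) :=
  match c return ctrl c -> (nat -> cell) -> option (ctrl c) * (nat -> cell * direction) with
  | Act i w d => fun _ h => (None, fun j => if j == i then (if w is Some a then a else h j, d) else (h j, Stay))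
  | Seq a b => fun q h => match q with
      | inl q => let: (o, act) := trans q h in (Some (if o is Some q' then inl q' else inr (entry b)), act)
      | inr q => let: (o, act) := trans q h in (omap inr o, act) end
  | If i t a b => fun q h => match q with
      | None => (Some (Some (if t (h i) then inl (entry a) else inr (entry b))), idle h)
      | Some (inl q) => let: (o, act) := trans q h in (omap (fun q => Some (inl q)) o, act)
      | Some (inr q) => let: (o, act) := trans q h in (omap (fun q => Some (inr q)) o, act) end
  | While i t a => fun q h => match q with
      | None => (if t (h i) then Some (Some (entry a)) else None, idle h)
      | Some q => let: (o, act) := trans q h in (Some o, act) end
  end.

Definition apply_act (S : state) (act : nat -> cell * direction) : state :=
  (fun i => put (S.1 i) (S.2 i) (act i).1, fun i => (S.2 i + dir_shift (act i).2)%R).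
(** Runs of the program as a machine, up to leaving it. *)
Inductive mrun (c : cmd) : ctrl c -> state -> nat -> state -> Prop :=
  | MExit q S act : trans q (scan S) = (None, act) -> mrun q S 1 (apply_act S act)
  | MNext q S act q' n S' : trans q (scan S) = (Some q', act) -> mrun q' (apply_act S act) n S' -> mrun q S n.+1 S'.

Lemma put_id f p : put f p (f p) = f.
Proof. by apply/funext => z; rewrite /put; case: eqP => [->|]. Qed.
Lemma apply_idle S : apply_act S (idle (scan S)) = S.
Proof.
case: S => C P; rewrite /apply_act /idle /scan /=; congr pair; apply/funext => i; first exact: put_id.
by rewrite addr0.
Qed.

Lemma apply_actE S i w d : apply_act S (fun j => if j == i then (if w is Some a then a else scan S j, d) else (scan S j, Stay))
  = act_state S i w d.
Proof.
case: S => C P; rewrite /apply_act /act_state /scan /=; congr pair; apply/funext => j; rewrite /upd.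
  case: w => [a|]; case: eqP => [->|_] //=; rewrite ?put_id //.
by case: eqP => [->|_] //=; rewrite addr0.
Qed.

Lemma mrun_seq2 a b (q : ctrl b) S n S1 : mrun q S n S1 -> mrun (c := Seq a b) (inr q) S n S1.
Proof. by elim => {}q {}S act => [e|q' {}n S' e _ IH]; [apply: MExit|apply: (MNext _ IH)]; rewrite /= e. Qed.
Lemma mrun_seq1 a b (q : ctrl a) S n S1 m S2 : mrun q S n S1 -> mrun (entry b) S1 m S2 ->
  mrun (c := Seq a b) (inl q) S (n + m) S2.
Proof.
move=> h1 h2; elim: h1 h2 => {q S n S1} [q S act e|q S act q' n S' e _ IH] h2.
  by apply: (MNext (act := act) (q' := inr (entry b) : ctrl (Seq a b))); rewrite /= ?e //; exact: mrun_seq2.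
by rewrite addSn; apply: (MNext (act := act) (q' := inl q' : ctrl (Seq a b))); rewrite /= ?e //; exact: IH.
Qed.

Lemma mrun_if1 i t a b (q : ctrl a) S n S1 : mrun q S n S1 -> mrun (c := If i t a b) (Some (inl q)) S n S1.
Proof. by elim => {}q {}S act => [e|q' {}n S' e _ IH]; [apply: MExit|apply: (MNext _ IH)]; rewrite /= e. Qed.
Lemma mrun_if2 i t a b (q : ctrl b) S n S1 : mrun q S n S1 -> mrun (c := If i t a b) (Some (inr q)) S n S1.
Proof. by elim => {}q {}S act => [e|q' {}n S' e _ IH]; [apply: MExit|apply: (MNext _ IH)]; rewrite /= e. Qed.
Lemma mrun_while i t a (q : ctrl a) S n S1 m S2 : mrun q S n S1 -> mrun (c := While i t a) None S1 m S2 ->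
  mrun (c := While i t a) (Some q) S (n + m) S2.
Proof.
move=> h1 h2; elim: h1 h2 => {q S n S1} [q S act e|q S act q' n S' e _ IH] h2.
  by apply: (MNext (act := act) _ h2); rewrite /= e.
by rewrite addSn; apply: (MNext (act := act) _ (IH h2)); rewrite /= e.
Qed.

Lemma exec_mrun c S S' n : exec c S S' n -> mrun (entry c) S n S'.
Proof.
elim => {c S S' n} [i w d S|a b S S1 S2 n m _ h1 _ h2|i t a b S S1 n ts _ h|i t a b S S1 n ts _ h|i t a S ts|i t a S S1 S2 n m ts _ h1 _ h2].
- by rewrite -apply_actE; apply: MExit.
- exact: mrun_seq1 h1 h2.
- by apply: (MNext (act := idle (scan S)) (q' := Some (inl (entry a)) : ctrl (If i t a b))); rewrite /= ?ts // apply_idle; exact: mrun_if1.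
- by apply: (MNext (act := idle (scan S)) (q' := Some (inr (entry b)) : ctrl (If i t a b))); rewrite /= ?(negbTE ts) // apply_idle; exact: mrun_if2.
- by rewrite -{2}(apply_idle S); apply: MExit; rewrite /= (negbTE ts).
apply: (MNext (act := idle (scan S)) (q' := Some (entry a) : ctrl (While i t a))); rewrite /= ?ts // apply_idle.
exact: mrun_while h1 h2.
Qed.

Fixpoint tape_bound (c : cmd) : nat :=
  match c with
  | Act i _ _ => i.+1 | Seq a b => maxn (tape_bound a) (tape_bound b)
  | If i _ a b => maxn i.+1 (maxn (tape_bound a) (tape_bound b)) | While i _ a => maxn i.+1 (tape_bound a) end.

(** A program only depends on the tapes it names, hence a machine with that many tapes can run
    it. *)
Lemma trans_ext c B h h' (q : ctrl c) : tape_bound c <= B -> (forall j, j < B -> h j = h' j) ->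
  (trans q h).1 = (trans q h').1 /\ forall j, j < B -> (trans q h).2 j = (trans q h').2 j.
Proof.
move=> bB hh; elim: c q bB => [i w d|a IHa b IHb|i t a IHa b IHb|i t a IHa] q /=; rewrite ?geq_max.
- by move=> _; split=> // j jB; rewrite hh.
- case/andP => aB bB; case: q => q; [have := IHa q aB|have := IHb q bB];
  by case: (trans q h) (trans q h') => [r1 act] [r2 act'] /= [-> H].
- case/and3P => iB aB bB; case: q => [[q|q]|]; [have := IHa q aB|have := IHb q bB|];
  try by case: (trans q h) (trans q h') => [r1 act] [r2 act'] /= [-> H].
  by rewrite /= hh //; split=> // j jB; rewrite /idle hh.
case/andP => iB aB; case: q => [q|]; first have := IHa q aB.
  by case: (trans q h) (trans q h') => [r1 act] [r2 act'] /= [-> H].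
by rewrite /= hh //; split=> // j jB; rewrite /idle hh.
Qed.

Section CmdMachine.
Variables (k : nat) (c : cmd).
Hypothesis cB : tape_bound c <= k.+1.
Definition heads (h : {ffun 'I_k.+1 -> cell}) (j : nat) : cell := if insub j is Some i then h i else None.
Definition cmd_delta (q : option (ctrl c)) (h : {ffun 'I_k.+1 -> cell}) :
    option (option (ctrl c) * {ffun 'I_k.+1 -> cell * direction}) :=
  if q is Some q' then Some ((trans q' (heads h)).1, [ffun i => (trans q' (heads h)).2 (val i)]) else None.
Definition cmd_machine := @Machine k void (option (ctrl c)) (Some (entry c)) cmd_delta.
Definition state_view (S : state) : tapes_view cmd_machine := fun i z => S.1 (val i) (S.2 (val i) + z)%R.

Lemma cmd_step q S : vstep (M := cmd_machine) (Some q, state_view S) =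
  Some ((trans q (scan S)).1, state_view (apply_act S (trans q (scan S)).2)).
Proof.
rewrite /vstep /=.
have hE j : j < k.+1 -> heads [ffun i => state_view S i 0%R] j = scan S j.
  by move=> jk; rewrite /heads insubT ffunE /state_view addr0.
have [-> H] := trans_ext q cB hE; congr (Some (_, _)).
apply/funext => i; apply/funext => z; rewrite ffunE H // /vact /state_view /apply_act /= /put addrCA.
move: (dir_shift _) (S.2 i) => dl p; rewrite [(p + dl + z)%R]addrC.
by rewrite (_ : ((z + (p + dl))%R == p) = ((z + dl)%R == 0%R)) // addrCA -[X in _ == X]addr0 (inj_eq (addrI _)).
Qed.

Lemma mrun_machine q S n S' : mrun q S n S' -> vrun (M := cmd_machine) n (Some q, state_view S) = (None, state_view S').
Proof.
have runS m x : vrun (M := cmd_machine) m.+1 x = vrun m (odflt x (vstep x)) by rewrite /vrun iterSr.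
elim => {}q {}S act => [e|q' {}n {}S' e _ IH]; rewrite runS cmd_step e //=.
Qed.

Lemma exec_outputs S S' n (ws : seq word) (o : word) t : exec c S S' n ->
  (forall i, i < k.+1 -> forall z, word_cells (map inl (nth [::] ws i)) z = S.1 i (S.2 i + z)%R) ->
  (forall j, S'.1 0 (S'.2 0 + Posz j)%R = nth None [seq Some (inl b) | b <- o] j) ->
  n <= t -> outputs_within cmd_machine t ws o.
Proof.
move=> /exec_mrun /mrun_machine runs init out nt.
have iv : cfg_view (initial cmd_machine ws) = (Some (entry c), state_view S).
  rewrite /cfg_view /=; congr pair; apply/funext => i; apply/funext => z.
  by rewrite view_tape_of init.
have fin : vrun t (cfg_view (initial cmd_machine ws)) = (None, state_view S').
  by rewrite iv (@vrun_halt _ n) ?runs.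
rewrite /outputs_within; split; first by rewrite halted_view -vrun_view fin.
have : cfg_view (run t (initial cmd_machine ws)) = (None, state_view S') by rewrite -vrun_view.
case: (run _ _) => q tp [_] /(congr1 (fun f => f ord0)) /= V0.
apply: leading_bitsE => j; rewrite -out -[S'.1 0 _]/(state_view S' ord0 (Posz j)) -V0.
by case: j.
Qed.
End CmdMachine.

(** * Terms, and their evaluation in polynomial time *)

(** The expressions from which all computations are built. Variables are de Bruijn indices, and
    [TSum] and [TLet] bind one; [TBit] and [TLen] give a bit and the length of the
    input [x] (if the boolean is true) or of the certificate [w]. *)
Inductive term : Type :=
  | TVar of nat | TOne | TAdd of term & term | TSub of term & term
  | TSum of term & term | TLet of term & term | TBit of bool & term | TLen of bool.
Definition scons (x : nat) (e : nat -> nat) : nat -> nat := fun i => if i is i'.+1 then e i' else x.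
Section Eval.
Variables (x w : word).
Definition input (b : bool) : word := if b then x else w.
Fixpoint eval (t : term) (e : nat -> nat) : nat :=
  match t with
  | TVar i => e i | TOne => 1 | TAdd a b => eval a e + eval b e | TSub a b => eval a e - eval b e
  | TSum a b => \sum_(i < eval a e) eval b (scons i e)
  | TLet a b => eval b (scons (eval a e) e)
  | TBit j a => nth false (input j) (eval a e) | TLen j => size (input j) end.
End Eval.

(** Bounds, polynomial in a common bound [m] of the variables and input lengths, for the
    value of a term and for the time that its evaluation takes. Sums multiply the
    bounds of their parts and bindings compose them, but the depth of a term is fixed, so
    that the bounds stay polynomial. *)
Fixpoint vbound (t : term) (m : nat) : nat :=
  match t with
  | TVar _ => m | TOne => 1 | TAdd a b => vbound a m + vbound b m | TSub a b => vbound a m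
  | TSum a b => vbound a m * vbound b (m + vbound a m)
  | TLet a b => vbound b (m + vbound a m) | TBit _ _ => 1 | TLen _ => m end.
Fixpoint tbound (t : term) (m : nat) : nat :=
  match t with
  | TVar _ => m * 4 + (m * 3 + 2) | TOne => 1 | TAdd a b => tbound a m + tbound b m
  | TSub a b => tbound a m + tbound b m + (vbound b m * 5 + 1) + (vbound a m * 3 + 1)
  | TSum a b => tbound a m + (vbound a m * (tbound b (m + vbound a m) + 3) + 1) + (vbound a m * 2 + 1)
  | TLet a b => tbound a m + tbound b (m + vbound a m) + (vbound a m * 2 + 1)
  | TBit _ a => tbound a m + (vbound a m * 4 + 1) + 2 + (vbound a m * 3 + 1)
  | TLen _ => m * 4 + 1 + (m * 3 + 1) end.

(** Polynomial growth, in a form that is closed under sums, products and composition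
    without any computation with coefficients. *)
Definition pbounded (f : nat -> nat) := exists k, forall m, f m <= (m + 2) ^ k.
Lemma pb_const c : pbounded (fun=> c).
Proof. by exists c => m; apply: ltnW; apply: (@leq_trans (2 ^ c)); [exact: ltn_expl|case: c => // c; rewrite leq_exp2r // leq_addl]. Qed.
Lemma pb_id : pbounded id. Proof. by exists 1 => m; rewrite expn1 leq_addr. Qed.
Lemma pb_le k l m : k <= l -> (m + 2) ^ k <= (m + 2) ^ l.
Proof. by move=> kl; rewrite leq_exp2l // addn2. Qed.
Lemma pb_add f g : pbounded f -> pbounded g -> pbounded (fun m => f m + g m).
Proof.
move=> [k hk] [l hl]; exists (maxn k l).+1 => m; rewrite expnS.
apply: (@leq_trans (2 * (m + 2) ^ maxn k l)); last by rewrite leq_mul2r leq_addl orbT.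
by rewrite mul2n -addnn leq_add // (leq_trans (hk m), leq_trans (hl m)) // pb_le // (leq_maxl, leq_maxr).
Qed.

Lemma pb_mul f g : pbounded f -> pbounded g -> pbounded (fun m => f m * g m).
Proof. by move=> [k hk] [l hl]; exists (k + l) => m; rewrite expnD leq_mul. Qed.
Lemma pb_comp f g : pbounded f -> pbounded g -> pbounded (fun m => f (g m)).
Proof.
move=> [k hk] [l hl]; exists ((l + 2) * k) => m; apply: leq_trans (hk _) _; rewrite expnM.
case: k {hk} => // k; rewrite leq_exp2r // expnD.
have h := hl m; have p : 0 < (m + 2) ^ l by rewrite expn_gt0 addn2.
apply: (@leq_trans ((m + 2) ^ l + 2)); first by rewrite leq_add2r.
apply: (@leq_trans ((m + 2) ^ l * 2 ^ 2)); first by lia.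
by rewrite leq_mul2l leq_exp2r // leq_addl orbT.
Qed.

Lemma pb_vbound t : pbounded (vbound t).
Proof.
elim: t => [i||a IHa b IHb|a IHa b IHb|a IHa b IHb|a IHa b IHb|j a _|j] /=; try exact: pb_const; try exact: pb_id.
- exact: pb_add.
- by [].
- apply: pb_mul => //; apply: (pb_comp (g := fun m => m + vbound a m)) => //; exact: (pb_add pb_id).
- apply: (pb_comp (g := fun m => m + vbound a m)) => //; exact: (pb_add pb_id).
Qed.

Lemma pb_tbound t : pbounded (tbound t).
Proof.
have V := pb_vbound.
elim: t => [i||a IHa b IHb|a IHa b IHb|a IHa b IHb|a IHa b IHb|j a IHa|j] /=;
  repeat first [exact: pb_const | exact: pb_id | exact: V | assumption | apply: pb_add | apply: pb_mul
   | apply: (pb_comp (g := fun m => m + vbound _ m))].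
Qed.

Definition inc r := Act r.+3 None MoveRight.
Definition dec r := Act r.+3 None MoveLeft.
Definition in_tape (b : bool) := if b then 2 else 1.
Definition go b d := Act (in_tape b) None d.
Definition skip := Act 3 None Stay.
Definition loop r c := While r.+3 (fun a => ~~ isSome a) c.
Definition clear r := loop r (dec r).
Definition is_one (a : cell) := if a is Some (inl true) then true else false.

(** Adds the value of [t] to the register [r]. A register is a tape with a single mark, the
    distance from which to the head is its value. The variable [i] is in the register [rho i]; the
    registers from [d] on are free and contain 0, before and after. *)
Fixpoint acc (t : term) (rho : nat -> nat) (d r : nat) : cmd :=
  match t with
  | TVar i => Seq (loop (rho i) (Seq (dec (rho i)) (Seq (inc d) (inc r)))) (loop d (Seq (dec d) (inc (rho i))))
  | TOne => inc r
  | TAdd a b => Seq (acc a rho d r) (acc b rho d r)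
  | TSub a b => Seq (acc a rho d.+2 d) (Seq (acc b rho d.+2 d.+1)
      (Seq (loop d.+1 (Seq (dec d.+1) (If d.+3 (fun a => ~~ isSome a) (dec d) skip))) (loop d (Seq (dec d) (inc r)))))
  | TSum a b => Seq (acc a rho d.+2 d)
      (Seq (loop d (Seq (dec d) (Seq (acc b (scons d.+1 rho) d.+2 r) (inc d.+1)))) (clear d.+1))
  | TLet a b => Seq (acc a rho d.+1 d) (Seq (acc b (scons d rho) d.+1 r) (clear d))
  | TBit j a => Seq (acc a rho d.+2 d) (Seq (loop d (Seq (dec d) (Seq (inc d.+1) (go j MoveRight))))
      (Seq (If (in_tape j) is_one (inc r) skip) (loop d.+1 (Seq (dec d.+1) (go j MoveLeft)))))
  | TLen j => Seq (While (in_tape j) isSome (Seq (go j MoveRight) (Seq (inc d) (inc r))))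
      (loop d (Seq (dec d) (go j MoveLeft)))
  end.

(** Time-bounded execution. *)
Definition runs c S S' T := exists2 n, n <= T & exec c S S' n.
Lemma runs_le c S S' T T' : runs c S S' T -> T <= T' -> runs c S S' T'.
Proof. by move=> [n nT e] TT; exists n => //; exact: leq_trans TT. Qed.
Lemma runs_seq a b S S1 S2 T T' : runs a S S1 T -> runs b S1 S2 T' -> runs (Seq a b) S S2 (T + T').
Proof. by move=> [n nT e] [m mT e']; exists (n + m); [exact: leq_add|exact: ExecSeq e e']. Qed.
Lemma runs_while i (t : cell -> bool) c T (f : nat -> state) n :
  (forall j, j <= n -> t (scan (f j) i) = (j < n)) -> (forall j, j < n -> runs c (f j) (f j.+1) T) ->
  runs (While i t c) (f 0) (f n) (n * T.+1 + 1).
Proof.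
move=> ht hc; have : forall k j, j + k = n -> runs (While i t c) (f j) (f n) (k * T.+1 + 1).
  elim=> [|k IH] j jk.
    by rewrite addn0 in jk; subst j; exists 1 => //; apply: ExecStop; rewrite ht // ltnn.
  have jn : j < n by lia.
  have [n1 n1T e1] := hc j jn; have [n2 n2T e2] := IH j.+1 (etrans (addSnnS _ _) jk).
  by exists (n1 + n2).+1; [lia|apply: ExecLoop e1 e2; rewrite ht // ltnW].
by apply; rewrite add0n.
Qed.

Ltac upds := apply/funext => ?; rewrite /upd; repeat (case: eqP => //); intros; subst; lia.

Section Acc.
Variables (x w : word) (C : nat -> int -> cell).
Definition mark (z : int) : cell := if z == 0%R then Some (inl true) else None.
Hypothesis Creg : forall i, C i.+3 = mark.
Hypothesis Cin : forall b, C (in_tape b) = word_cells (map inl (input x w b)).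
Definition pos (o : int) (ip : bool -> nat) (s : nat -> nat) (i : nat) : int :=
  match i with 0 => o | 1 => Posz (ip false) | 2 => Posz (ip true) | j.+3 => Posz (s j) end.
Definition St o ip s : state := (C, pos o ip s).
Definition home : bool -> nat := fun=> 0.

Lemma scan_reg o ip s r : isSome (scan (St o ip s) r.+3) = (s r == 0).
Proof. by rewrite /scan /= Creg /mark; case: (s r). Qed.
Lemma scan_in o ip s b : scan (St o ip s) (in_tape b) = nth None [seq Some (inl c) | c <- input x w b] (ip b).
Proof.
have -> : scan (St o ip s) (in_tape b) = C (in_tape b) (Posz (ip b)) by case: b.
by rewrite Cin /word_cells -map_comp.
Qed.

Lemma runs_inc o ip s s' r : s' = upd s r (s r).+1 -> runs (inc r) (St o ip s) (St o ip s') 1.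
Proof.
move=> ->; exists 1 => //; have -> : St o ip (upd s r (s r).+1) = act_state (St o ip s) r.+3 None MoveRight; last exact: ExecAct.
rewrite /act_state /=; congr pair; apply/funext => -[|[|[|i]]] //=; rewrite /upd !eqSS; case: (i =P r) => [E|//] /=; try subst i.
by rewrite -addn1.
Qed.

Lemma runs_dec o ip s s' r : 0 < s r -> s' = upd s r (s r).-1 -> runs (dec r) (St o ip s) (St o ip s') 1.
Proof.
move=> sr ->; exists 1 => //; have -> : St o ip (upd s r (s r).-1) = act_state (St o ip s) r.+3 None MoveLeft; last exact: ExecAct.
rewrite /act_state /=; congr pair; apply/funext => -[|[|[|i]]] //=; rewrite /upd !eqSS; case: (i =P r) => [E|//] /=; try subst i.
by lia.
Qed.

Lemma runs_right o ip ip' s b : ip' = (fun b' => if b' == b then (ip b).+1 else ip b') ->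
  runs (go b MoveRight) (St o ip s) (St o ip' s) 1.
Proof.
move=> ->; exists 1 => //; rewrite /go; set S' := (X in exec _ _ X).
have -> : S' = act_state (St o ip s) (in_tape b) None MoveRight; last exact: ExecAct.
rewrite /S' /act_state /=; congr pair; apply/funext => -[|[|[|i]]] //=; rewrite /upd; case: b {S'} => //=; by rewrite -addn1.
Qed.

Lemma runs_left o ip ip' s b : 0 < ip b -> ip' = (fun b' => if b' == b then (ip b).-1 else ip b') ->
  runs (go b MoveLeft) (St o ip s) (St o ip' s) 1.
Proof.
move=> ib ->; exists 1 => //; rewrite /go; set S' := (X in exec _ _ X).
have -> : S' = act_state (St o ip s) (in_tape b) None MoveLeft; last exact: ExecAct.
rewrite /S' /act_state /=; congr pair; apply/funext => -[|[|[|i]]] //=; rewrite /upd; case: b ib {S'} => //= ib; lia.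
Qed.

Lemma runs_skip o ip s : runs skip (St o ip s) (St o ip s) 1.
Proof.
exists 1 => //; have {2}-> : St o ip s = act_state (St o ip s) 3 None Stay; last exact: ExecAct.
by rewrite /act_state /=; congr pair; apply/funext => -[|[|[|i]]] //=; rewrite /upd /=; case: eqP => // -[->]; rewrite addr0.
Qed.

Lemma runs_loop o (ip : nat -> bool -> nat) (s : nat -> nat -> nat) q c T n s0 s' i0 i' :
  s0 = s 0 -> s' = s n -> i0 = ip 0 -> i' = ip n -> (forall j, j <= n -> s j q = n - j) ->
  (forall j, j < n -> runs c (St o (ip j) (s j)) (St o (ip j.+1) (s j.+1)) T) ->
  runs (loop q c) (St o i0 s0) (St o i' s') (n * T.+1 + 1).
Proof.
move=> -> -> -> -> sq H; apply: (runs_while (f := fun j => St o (ip j) (s j))) => // j jn.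
by rewrite scan_reg sq // subn_eq0 -ltnNge.
Qed.

Lemma runs_clear o ip s s' r n : n = s r -> s' = upd s r 0 -> runs (clear r) (St o ip s) (St o ip s') (n * 2 + 1).
Proof.
move=> -> ->; apply: (runs_loop (ip := fun=> ip) (s := fun j => upd s r (s r - j))) => //; try by upds.
  by move=> j _; rewrite /upd eqxx.
by move=> j jn; apply: runs_dec; [rewrite /upd eqxx; lia|upds].
Qed.

Lemma vbound_eval t e m : (forall i, e i <= m) -> size x <= m -> size w <= m -> eval x w t e <= vbound t m.
Proof.
move=> + xm wm; elim: t e m xm wm => [i||a IHa b IHb|a IHa b IHb|a IHa b IHb|a IHa b IHb|j a _|j] e m xm wm em /=.
- exact: em.
- by [].
- by rewrite leq_add ?IHa ?IHb.
- by apply: leq_trans (leq_subr _ _) _; exact: IHa.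
- have va := IHa _ _ xm wm em; apply: (@leq_trans (\sum_(i < eval x w a e) vbound b (m + vbound a m))).
    apply: leq_sum => i _; apply: IHb; rewrite ?(leq_trans xm) ?(leq_trans wm) ?leq_addr //.
    move=> [|k] /=; last by apply: leq_trans (em k) _; exact: leq_addr.
    by apply: leq_trans (ltnW (ltn_ord i)) _; apply: leq_trans va _; exact: leq_addl.
  by rewrite sum_nat_const card_ord leq_mul2r va orbT.
- have va := IHa _ _ xm wm em; apply: IHb; rewrite ?(leq_trans xm) ?(leq_trans wm) ?leq_addr //.
  by move=> [|k] /=; [apply: leq_trans va _; exact: leq_addl|apply: leq_trans (em k) _; exact: leq_addr].
- by case: (nth _ _ _).
- by case: j.
Qed.

(** By induction on the term; a loop over a register destroys it, so a variable is counted down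
    into a free register and restored. *)
Lemma acc_runs t : forall rho d r s o m, (forall i, s (rho i) <= m) -> size x <= m -> size w <= m ->
  (forall q, d <= q -> s q = 0) -> (forall i, rho i < d) -> (forall i, rho i != r) -> r < d ->
  runs (acc t rho d r) (St o home s) (St o home (upd s r (s r + eval x w t (fun i => s (rho i))))) (tbound t m).
Proof.
elim: t => [v||a IHa b IHb|a IHa b IHb|a IHa b IHb|a IHa b IHb|j a IHa|j] rho d r s o m sm xm wm fr rd rr rdd /=.
- have vd := rd v; have vr := rr v; have d0 := fr d (leqnn d); have vm := sm v.
  apply: (@runs_le _ _ _ ((s (rho v) * 4 + 1) + (s (rho v) * 3 + 1))); last by lia.
  apply: (runs_seq (S1 := St o home (upd (upd (upd s (rho v) 0) d (s (rho v))) r (s r + s (rho v))))).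
    apply: (runs_loop (ip := fun=> home) (s := fun j => upd (upd (upd s (rho v) (s (rho v) - j)) d j) r (s r + j))) => //.
    + apply/funext => z; rewrite /upd; case: eqP => [->|_]; first by lia.
      by case: eqP => [->|_]; [lia|case: eqP => [->|//]; lia].
    + by rewrite subnn.
    + move=> j jn; rewrite /upd (negbTE vr); rewrite (ltn_eqF vd) eqxx //.
    move=> j jn; apply: (@runs_le _ _ _ (1 + (1 + 1))) => //.
    apply: (runs_seq (S1 := St o home (upd (upd (upd s (rho v) (s (rho v) - j.+1)) d j) r (s r + j)))).
      by apply: runs_dec; rewrite /upd (negbTE vr) (ltn_eqF vd) eqxx; [lia|upds].
    apply: (runs_seq (S1 := St o home (upd (upd (upd s (rho v) (s (rho v) - j.+1)) d j.+1) r (s r + j)))).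
      by apply: runs_inc; upds.
    by apply: runs_inc; upds.
  apply: (runs_loop (ip := fun=> home) (s := fun j => upd (upd (upd s (rho v) j) d (s (rho v) - j)) r (s r + s (rho v)))) => //.
  + by rewrite subn0.
  + by upds.
  + by move=> j jn; rewrite /upd eqxx; case: eqP => // e; move: rdd; rewrite e ltnn.
  move=> j jn; apply: (@runs_le _ _ _ (1 + 1)) => //.
  apply: (runs_seq (S1 := St o home (upd (upd (upd s (rho v) j) d (s (rho v) - j.+1)) r (s r + s (rho v))))).
    by apply: runs_dec; [rewrite /upd eqxx; case: eqP => [e|_]; [move: rdd; rewrite e ltnn|lia]|upds].
  by apply: runs_inc; upds.
- by apply: runs_inc; rewrite addn1.
- set ea := eval x w a _; set eb := eval x w b _.
  apply: (runs_seq (S1 := St o home (upd s r (s r + ea)))); first exact: IHa.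
  have E : (fun i => upd s r (s r + ea) (rho i)) = (fun i => s (rho i)).
    by apply/funext => i; rewrite /upd (negbTE (rr i)).
  have -> : upd s r (s r + (ea + eb)) = upd (upd s r (s r + ea)) r (upd s r (s r + ea) r + eb).
    by apply/funext => z; rewrite /upd eqxx; case: eqP => // _; rewrite addnA.
  rewrite /eb -E; apply: IHb => //.
  + by move=> i; rewrite /upd (negbTE (rr i)).
  by move=> q dq; rewrite /upd; case: eqP => [e|_]; [move: rdd; rewrite -e ltnNge dq|exact: fr].
- set ea := eval x w a _; set eb := eval x w b _.
  have vea : ea <= vbound a m by exact: vbound_eval. have veb : eb <= vbound b m by exact: vbound_eval.
  have d0 := fr d (leqnn d); have d1 := fr d.+1 (leqnSn d).
  have R1 : runs (acc a rho d.+2 d) (St o home s) (St o home (upd s d ea)) (tbound a m).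
    rewrite -[ea]add0n -d0; apply: IHa => //; try lia.
    + by move=> q dq; apply: fr; lia.
    + by move=> i; have := rd i; lia.
    by move=> i; have := rd i; rewrite neq_ltn => ->.
  have E : (fun i => upd s d ea (rho i)) = (fun i => s (rho i)).
    by apply/funext => i; rewrite /upd (ltn_eqF (rd i)).
  have R2 : runs (acc b rho d.+2 d.+1) (St o home (upd s d ea)) (St o home (upd (upd s d ea) d.+1 eb)) (tbound b m).
    have e1 : upd s d ea d.+1 = 0 by rewrite /upd; case: eqP => // ; lia.
    have -> : eb = upd s d ea d.+1 + eval x w b (fun i => upd s d ea (rho i)) by rewrite e1 E.
    apply: IHb => //; try lia.
    + by move=> i; rewrite /upd (ltn_eqF (rd i)).
    + by move=> q dq; rewrite /upd; case: eqP => [e|_]; [lia|apply: fr; lia].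
    + by move=> i; have := rd i; lia.
    by move=> i; have := rd i; rewrite neq_ltn => ?; apply/orP; left; lia.
  apply: (@runs_le _ _ _ (tbound a m + (tbound b m + ((eb * 5 + 1) + ((ea - eb) * 3 + 1))))); last by lia.
  apply: runs_seq R1 _; apply: runs_seq R2 _.
  apply: (runs_seq (S1 := St o home (upd s d (ea - eb)))).
    apply: (runs_loop (ip := fun=> home) (s := fun j => upd (upd s d (ea - j)) d.+1 (eb - j))) => //.
    + by rewrite !subn0.
    + by rewrite subnn; upds.
    + by move=> j jn; rewrite /upd eqxx.
    move=> j jn; apply: (@runs_le _ _ _ (1 + 3)) => //.
    apply: (runs_seq (S1 := St o home (upd (upd s d (ea - j)) d.+1 (eb - j.+1)))).
      by apply: runs_dec; [rewrite /upd eqxx; lia|upds].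
    have dd : (d == d.+1) = false by lia.
    have [ej|ej] := ltnP j ea.
      have [n n1 e] : runs (dec d) (St o home (upd (upd s d (ea - j)) d.+1 (eb - j.+1)))
         (St o home (upd (upd s d (ea - j.+1)) d.+1 (eb - j.+1))) 1.
        by apply: runs_dec; [rewrite /upd dd eqxx; lia|upds].
      by exists n.+1; [lia|apply: ExecIfT e; rewrite scan_reg /upd dd eqxx; lia].
    have [n n1 e] := runs_skip o home (upd (upd s d (ea - j)) d.+1 (eb - j.+1)).
    exists n.+1; first by lia.
    have -> : upd (upd s d (ea - j.+1)) d.+1 (eb - j.+1) = upd (upd s d (ea - j)) d.+1 (eb - j.+1) by upds.
    by apply: ExecIfF e; rewrite negbK scan_reg /upd dd eqxx; lia.
  have rd' : (r == d) = false by lia.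
  apply: (runs_loop (ip := fun=> home) (s := fun j => upd (upd s d (ea - eb - j)) r (s r + j))) => //.
  + by upds.
  + by upds.
  + by move=> j jn; rewrite /upd eqxx eq_sym rd'.
  move=> j jn; apply: (@runs_le _ _ _ (1 + 1)) => //.
  apply: (runs_seq (S1 := St o home (upd (upd s d (ea - eb - j.+1)) r (s r + j)))).
    by apply: runs_dec; [rewrite /upd eqxx eq_sym rd'; lia|upds].
  by apply: runs_inc; upds.
- set ea := eval x w a _; set m' := m + vbound a m.
  have vea : ea <= vbound a m by exact: vbound_eval.
  have d0 := fr d (leqnn d); have d1 := fr d.+1 (leqnSn d).
  have R1 : runs (acc a rho d.+2 d) (St o home s) (St o home (upd s d ea)) (tbound a m).
    rewrite -[ea]add0n -d0; apply: IHa => //; try lia.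
    + by move=> q dq; apply: fr; lia.
    + by move=> i; have := rd i; lia.
    by move=> i; have := rd i; rewrite neq_ltn => ->.
  pose g j := \sum_(i < j) eval x w b (scons i (fun i => s (rho i))).
  pose u j := upd (upd (upd s d (ea - j)) d.+1 j) r (s r + g j).
  have rdF : (r == d) = false by lia. have rd1F : (r == d.+1) = false by lia.
  have dd1 : (d == d.+1) = false by lia.
  have drF : (d == r) = false by lia. have d1rF : (d.+1 == r) = false by lia.
  have d1dF : (d.+1 == d) = false by lia.
  apply: (@runs_le _ _ _ (tbound a m + ((ea * (tbound b m' + 2).+1 + 1) + (ea * 2 + 1)))); last first.
    rewrite addnA; apply: leq_add; last by lia.
    by rewrite leq_add2l leq_add2r; apply: leq_mul => //; lia.
  apply: runs_seq R1 _; apply: (runs_seq (S1 := St o home (u ea))); last first.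
    apply: runs_clear; first by rewrite /u /upd d1rF eqxx.
    by rewrite /u subnn /g; upds.
  apply: (runs_loop (ip := fun=> home) (s := u)) => //.
  + rewrite /u /g big_ord0 addn0 subn0; apply/funext => z; rewrite /upd.
    have [->|_] := eqVneq z r; first by rewrite rdF.
    by have [->|//] := eqVneq z d.+1; rewrite d1dF d1.
  + by move=> j jn; rewrite /u /upd drF dd1 eqxx.
  move=> j jn; apply: (@runs_le _ _ _ (1 + (tbound b m' + 1))); last by lia.
  pose u1 := upd (upd (upd s d (ea - j.+1)) d.+1 j) r (s r + g j).
  apply: (runs_seq (S1 := St o home u1)).
    by apply: runs_dec; rewrite /u /upd drF dd1 eqxx; [lia|rewrite /u1; upds].
  have E : (fun i => u1 (scons d.+1 rho i)) = scons j (fun i => s (rho i)).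
    apply/funext => -[|i] /=; first by rewrite /u1 /upd d1rF eqxx.
    rewrite /u1 /upd (negbTE (rr i)); have := rd i => h.
    by rewrite (_ : (rho i == d.+1) = false) ?(ltn_eqF h) //; lia.
  apply: (runs_seq (S1 := St o home (upd u1 r (u1 r + eval x w b (scons j (fun i => s (rho i))))))).
    rewrite -E; apply: IHb.
    + move=> i; have := congr1 (fun f => f i) E => /= ->; case: i => [|i] /=; last by apply: leq_trans (sm i) _; exact: leq_addr.
      by rewrite /m'; lia.
    + by rewrite /m'; lia.
    + by rewrite /m'; lia.
    + by move=> q dq; rewrite /u1 /upd; case: eqP => [e|_]; [lia|case: eqP => [e|_]; [lia|case: eqP => [e|_]; [lia|apply: fr; lia]]].
    + by move=> [|i] /=; [lia|have := rd i; lia].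
    + by move=> [|i] /=; [rewrite d1rF|].
    by lia.
  apply: runs_inc; rewrite /u /u1 /g big_ord_recr /=; upds.
- set ea := eval x w a _; set m' := m + vbound a m.
  have vea : ea <= vbound a m by exact: vbound_eval.
  have d0 := fr d (leqnn d).
  have R1 : runs (acc a rho d.+1 d) (St o home s) (St o home (upd s d ea)) (tbound a m).
    rewrite -[ea]add0n -d0; apply: IHa => //; try lia.
    + by move=> q dq; apply: fr; lia.
    + by move=> i; have := rd i; lia.
    by move=> i; have := rd i; rewrite neq_ltn => ->.
  have drF : (d == r) = false by lia. have rdF : (r == d) = false by lia.
  have E : (fun i => upd s d ea (scons d rho i)) = scons ea (fun i => s (rho i)).
    by apply/funext => -[|i] /=; rewrite /upd ?eqxx // (ltn_eqF (rd i)).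
  apply: (@runs_le _ _ _ (tbound a m + (tbound b m' + (ea * 2 + 1)))); last by rewrite /m'; lia.
  apply: runs_seq R1 _.
  apply: (runs_seq (S1 := St o home (upd (upd s d ea) r (upd s d ea r + eval x w b (scons ea (fun i => s (rho i))))))).
    rewrite -E; apply: IHb.
    + move=> i; have := congr1 (fun f => f i) E => /= ->; case: i => [|i] /=; last by apply: leq_trans (sm i) _; exact: leq_addr.
      by rewrite /m'; lia.
    + by rewrite /m'; lia.
    + by rewrite /m'; lia.
    + by move=> q dq; rewrite /upd; case: eqP => [e|_]; [lia|apply: fr; lia].
    + by move=> [|i] /=; [lia|have := rd i; lia].
    + by move=> [|i] /=; [rewrite drF|].
    by lia.
  apply: runs_clear; first by rewrite /upd drF eqxx.
  apply/funext => z; rewrite /upd; have [->|_] := eqVneq z r; first by rewrite rdF.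
  by have [->|] := eqVneq z d.
- set ea := eval x w a _.
  have vea : ea <= vbound a m by exact: vbound_eval.
  have d0 := fr d (leqnn d); have d1 := fr d.+1 (leqnSn d).
  have R1 : runs (acc a rho d.+2 d) (St o home s) (St o home (upd s d ea)) (tbound a m).
    rewrite -[ea]add0n -d0; apply: IHa => //; try lia.
    + by move=> q dq; apply: fr; lia.
    + by move=> i; have := rd i; lia.
    by move=> i; have := rd i; rewrite neq_ltn => ->.
  pose ip n (b : bool) := if b == j then n else 0.
  have ip0 : home = ip 0 by apply/funext => b; rewrite /ip; case: eqP.
  have ipj n : ip n j = n by rewrite /ip eqxx.
  have rdF : (r == d) = false by lia. have rd1F : (r == d.+1) = false by lia.
  have dd1 : (d == d.+1) = false by lia.
  apply: (@runs_le _ _ _ (tbound a m + ((ea * 4 + 1) + (2 + (ea * 3 + 1))))); last by lia.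
  apply: runs_seq R1 _.
  apply: (runs_seq (S1 := St o (ip ea) (upd s d.+1 ea))).
    apply: (runs_loop (ip := ip) (s := fun i => upd (upd s d (ea - i)) d.+1 i)) => //.
    + by rewrite subn0; upds.
    + by rewrite subnn; upds.
    + by move=> i _; rewrite /upd dd1 eqxx.
    move=> i ie; apply: (@runs_le _ _ _ (1 + (1 + 1))) => //.
    apply: (runs_seq (S1 := St o (ip i) (upd (upd s d (ea - i.+1)) d.+1 i))).
      by apply: runs_dec; [rewrite /upd dd1 eqxx; lia|upds].
    apply: (runs_seq (S1 := St o (ip i) (upd (upd s d (ea - i.+1)) d.+1 i.+1))); first by apply: runs_inc; upds.
    by apply: runs_right; apply/funext => b; rewrite /ip eqxx; case: eqP.
  set bit := nth false _ _.
  apply: (runs_seq (S1 := St o (ip ea) (upd (upd s d.+1 ea) r (s r + bit)))).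
    have bE : is_one (scan (St o (ip ea) (upd s d.+1 ea)) (in_tape j)) = bit.
      rewrite scan_in ipj /bit; move: (input x w j) => l; have [h|h] := ltnP ea (size l).
        by rewrite (nth_map false) //; case: (nth _ _ _).
      by rewrite !nth_default ?size_map.
    case E : bit bE => bE.
      have [n n1 e] : runs (inc r) (St o (ip ea) (upd s d.+1 ea)) (St o (ip ea) (upd (upd s d.+1 ea) r (s r + true))) 1.
        by apply: runs_inc; upds.
      by exists n.+1; [lia|apply: ExecIfT e; rewrite bE].
    have [n n1 e] := runs_skip o (ip ea) (upd s d.+1 ea); exists n.+1; first by lia.
    have -> : upd (upd s d.+1 ea) r (s r + false) = upd s d.+1 ea by upds.
    by apply: ExecIfF e; rewrite bE.
  rewrite ip0; apply: (runs_loop (ip := fun i => ip (ea - i)) (s := fun i => upd (upd s d.+1 (ea - i)) r (s r + bit))) => //.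
  + by rewrite subn0.
  + by rewrite subnn; upds.
  + by rewrite subn0.
  + by rewrite subnn.
  + by move=> i _; rewrite /upd eq_sym rd1F eqxx.
  move=> i ie; apply: (@runs_le _ _ _ (1 + 1)) => //.
  apply: (runs_seq (S1 := St o (ip (ea - i)) (upd (upd s d.+1 (ea - i.+1)) r (s r + bit)))).
    by apply: runs_dec; [rewrite /upd eq_sym rd1F eqxx; lia|upds].
  by apply: runs_left; [rewrite ipj; lia|apply/funext => b; rewrite /ip eqxx; case: eqP => // _; lia].
set n := size _; have nm : n <= m by rewrite /n; case: (j).
have d0 := fr d (leqnn d).
pose ip k (b : bool) := if b == j then k else 0.
have ip0 : home = ip 0 by apply/funext => b; rewrite /ip; case: eqP.
have ipj k : ip k j = k by rewrite /ip eqxx.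
have rdF : (r == d) = false by lia.
apply: (@runs_le _ _ _ ((n * 4 + 1) + (n * 3 + 1))); last by lia.
apply: (runs_seq (S1 := St o (ip n) (upd (upd s d n) r (s r + n)))).
  have {1}-> : St o home s = St o (ip 0) (upd (upd s d 0) r (s r + 0)) by rewrite ip0; congr St; upds.
  apply: (runs_while (f := fun i => St o (ip i) (upd (upd s d i) r (s r + i)))).
    move=> i ie; rewrite scan_in ipj; have [h|h] := ltnP i n; first by rewrite (nth_map false).
    by rewrite nth_default ?size_map.
  move=> i ie; apply: (@runs_le _ _ _ (1 + (1 + 1))) => //.
  apply: (runs_seq (S1 := St o (ip i.+1) (upd (upd s d i) r (s r + i)))).
    by apply: runs_right; apply/funext => b; rewrite /ip eqxx; case: eqP.
  by apply: (runs_seq (S1 := St o (ip i.+1) (upd (upd s d i.+1) r (s r + i)))); apply: runs_inc; upds.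
rewrite ip0; apply: (runs_loop (ip := fun i => ip (n - i)) (s := fun i => upd (upd s d (n - i)) r (s r + n))) => //.
+ by rewrite subn0.
+ by rewrite subnn; upds.
+ by rewrite subn0.
+ by rewrite subnn.
+ by move=> i _; rewrite /upd eq_sym rdF eqxx.
move=> i ie; apply: (@runs_le _ _ _ (1 + 1)) => //.
apply: (runs_seq (S1 := St o (ip (n - i)) (upd (upd s d (n - i.+1)) r (s r + n)))).
  by apply: runs_dec; [rewrite /upd eq_sym rdF eqxx; lia|upds].
by apply: runs_left; [rewrite ipj; lia|apply/funext => b; rewrite /ip eqxx; case: eqP => // _; lia].
Qed.
End Acc.

(** * Printing a word bit by bit *)

Definition bank (t0 t1 t2 : int -> cell) (g : nat -> int -> cell) (i : nat) : int -> cell :=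
  match i with 0 => t0 | 1 => t1 | 2 => t2 | j.+3 => g j end.
Definition bit_cell (b : bool) : cell := Some (inl b).
Fixpoint mark_registers (n : nat) : cmd :=
  if n is n'.+1 then Seq (mark_registers n') (Act n'.+3 (Some (bit_cell true)) Stay) else Act 0 None Stay.
(** The tape 0 receives the output at the end, so that the input is first moved to the tape 2. *)
Definition copy_input : cmd :=
  Seq (While 0 isSome (Seq (If 0 is_one (Act 2 (Some (bit_cell true)) MoveRight) (Act 2 (Some (bit_cell false)) MoveRight))
                           (Seq (Act 0 (Some None) MoveRight) (inc 0))))
  (loop 0 (Seq (dec 0) (go true MoveLeft))).
(** The word is printed from its last letter to the first, so that the head ends on the first
    letter and the register that holds the length serves as index. *)
Definition print_bits (L b : term) : cmd :=
  Seq (acc L (fun=> 1) 3 0)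
  (Seq (loop 0 (Seq (dec 0) (Seq (acc b (scons 0 (fun=> 1)) 3 2)
         (Seq (If 5 isSome (Act 0 (Some (bit_cell false)) MoveLeft) (Act 0 (Some (bit_cell true)) MoveLeft)) (clear 2)))))
     (Act 0 None MoveRight)).
Definition print_cmd (L b : term) := Seq copy_input (print_bits L b).
Definition registers L b := tape_bound (print_cmd L b).
Definition term_cmd (L b : term) := Seq (mark_registers (registers L b)) (print_cmd L b).

Lemma runs_act0 t0 t0' t1 t2 g o o' ip s w d : t0' = (if w is Some a then put t0 o a else t0) -> o' = (o + dir_shift d)%R ->
  runs (Act 0 w d) (St (bank t0 t1 t2 g) o ip s) (St (bank t0' t1 t2 g) o' ip s) 1.
Proof.
move=> -> ->; exists 1 => //; set S' := (X in exec _ _ X).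
have -> : S' = act_state (St (bank t0 t1 t2 g) o ip s) 0 w d; last exact: ExecAct.
rewrite /S' /act_state /=; congr pair; apply/funext => -[|[|[|i]]] //=; first by case: w {S'}.
all: by case: w {S'}.
Qed.

Lemma runs_append t0 t1 t2 t2' g o ip ip' s a : t2' = put t2 (Posz (ip true)) a ->
  ip' = (fun b => if b then (ip true).+1 else ip b) ->
  runs (Act 2 (Some a) MoveRight) (St (bank t0 t1 t2 g) o ip s) (St (bank t0 t1 t2' g) o ip' s) 1.
Proof.
move=> -> ->; exists 1 => //; set S' := (X in exec _ _ X).
have -> : S' = act_state (St (bank t0 t1 t2 g) o ip s) 2 (Some a) MoveRight; last exact: ExecAct.
by rewrite /S' /act_state /=; congr pair; apply/funext => -[|[|[|i]]] //=; rewrite /upd /= -addn1.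
Qed.

Lemma tape_bound_mark n : tape_bound (mark_registers n) <= n.+3.
Proof. by elim: n => //= n IH; rewrite geq_max leqnn andbT (leq_trans IH). Qed.

(** The registers once the first [n] of [K] are marked. The tapes beyond those of the machine
    count as marked throughout, so that the properties of registers hold for all of
    them. *)
Definition marked (n K : nat) (i : nat) : int -> cell := if (i < n) || (K <= i) then mark else fun=> None.
Lemma runs_marks t0 t1 t2 K n o ip : n <= K ->
  runs (mark_registers n) (St (bank t0 t1 t2 (marked 0 K)) o ip (fun=> 0)) (St (bank t0 t1 t2 (marked n K)) o ip (fun=> 0)) n.+1.
Proof.
elim: n => [|n IH] nK /=; first by apply: runs_act0 => //; rewrite addr0.
apply: (@runs_le _ _ _ (n.+1 + 1)); last by rewrite addn1.
apply: runs_seq (IH (ltnW nK)) _; exists 1 => //; set S' := (X in exec _ _ X).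
have -> : S' = act_state (St (bank t0 t1 t2 (marked n K)) o ip (fun=> 0)) n.+3 (Some (bit_cell true)) Stay; last exact: ExecAct.
rewrite /S' /act_state /=; congr pair; apply/funext => -[|[|[|i]]] //=; rewrite /upd; last by rewrite addr0; case: eqP.
rewrite !eqSS /marked ltnS leq_eqVlt; case: (i =P n) => [->|_] //=; rewrite ltnn [K <= n]leqNgt nK /=.
by apply/funext => z; rewrite /put /mark /bit_cell.
Qed.

Lemma marked_full K i : marked K K i = mark.
Proof. by rewrite /marked; case: ltnP. Qed.

Section Print.
Variables (x w : word).
Notation input_cells u := (word_cells (map inl u) : int -> cell).
Notation blank := ((fun=> None) : int -> cell).
Notation tapes t0 t2 := (bank t0 (input_cells w) t2 (fun=> mark)).

Lemma runs_copy :
  runs copy_input (St (tapes (input_cells x) blank) 0%R home (fun=> 0))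
    (St (tapes blank (input_cells x)) (Posz (size x)) home (fun=> 0)) (size x * 8 + 2).
Proof.
pose rest j (z : int) : cell := if (z < Posz j)%R then None else input_cells x z.
pose part j (z : int) : cell := if (z < Posz j)%R then input_cells x z else None.
have cx z : input_cells x z = if z is Posz i then nth None [seq Some (inl c) | c <- x] i else None.
  by case: z => // i; rewrite /word_cells -map_comp.
have out z : (Posz (size x) <= z)%R -> input_cells x z = None.
  by case: z => // i si; rewrite cx nth_default // size_map; lia.
have r0 : rest 0 = input_cells x by apply/funext => -[i|i]; rewrite /rest //=; case: ifP.
have rn : rest (size x) = blank.
  by apply/funext => z; rewrite /rest; case: ltP => // /out.
have p0 : part 0 = blank by apply/funext => -[i|i]; rewrite /part //=; case: ifP.
have pn : part (size x) = input_cells x.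
  by apply/funext => z; rewrite /part; case: ltP => // /out ->.
pose ip j (b : bool) := if b then j else 0.
have ip0 : home = ip 0 by apply/funext => -[].
apply: (@runs_le _ _ _ ((size x * 5 + 1) + (size x * 3 + 1))); last by lia.
apply: (runs_seq (S1 := St (tapes (rest (size x)) (part (size x))) (Posz (size x)) (ip (size x)) (upd (fun=> 0) 0 (size x)))).
  have -> : St (tapes (input_cells x) blank) 0%R home (fun=> 0) =
     St (tapes (rest 0) (part 0)) (Posz 0) (ip 0) (upd (fun=> 0) 0 0).
    by rewrite r0 p0 ip0; congr St; upds.
  apply: (runs_while (f := fun j => St (tapes (rest j) (part j)) (Posz j) (ip j) (upd (fun=> 0) 0 j))).
    move=> j jn; rewrite /scan /= /rest ltxx cx; have [h|h] := ltnP j (size x); first by rewrite (nth_map false).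
    by rewrite nth_default // size_map.
  move=> j jn; apply: (@runs_le _ _ _ (2 + (1 + 1))) => //.
  apply: (runs_seq (S1 := St (tapes (rest j) (part j.+1)) (Posz j) (ip j.+1) (upd (fun=> 0) 0 j))).
    have app : runs (Act 2 (Some (bit_cell (nth false x j))) MoveRight) (St (tapes (rest j) (part j)) (Posz j) (ip j) (upd (fun=> 0) 0 j)) (St (tapes (rest j) (part j.+1)) (Posz j) (ip j.+1) (upd (fun=> 0) 0 j)) 1.
      apply: runs_append => //; last by apply/funext => -[].
      apply/funext => z; rewrite /put /part /=; have [->|zj] := eqVneq z (Posz j).
        by rewrite ltz_nat ltnSn cx (nth_map false).
      by congr (if _ then _ else _); lia.
    have sc : is_one (scan (St (tapes (rest j) (part j)) (Posz j) (ip j) (upd (fun=> 0) 0 j)) 0) = nth false x j.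
      by rewrite /scan /= /rest ltxx cx (nth_map false) //=; case: (nth _ _ _).
    have [n n1 e] := app; exists n.+1; first by [].
    case: (nth false x j) e sc => e sc; first by apply: ExecIfT e; rewrite sc.
    by apply: ExecIfF e; rewrite sc.
  apply: (runs_seq (S1 := St (tapes (rest j.+1) (part j.+1)) (Posz j.+1) (ip j.+1) (upd (fun=> 0) 0 j))).
    apply: runs_act0 => /=; last by rewrite -PoszD addn1.
    apply/funext => z; rewrite /put /rest; have [->|zj] := eqVneq z (Posz j); first by rewrite ltz_nat ltnSn.
    by congr (if _ then _ else _); lia.
  by apply: runs_inc; upds.
rewrite rn pn ip0.
have Creg i : tapes blank (input_cells x) i.+3 = mark by [].
apply: (runs_loop Creg (ip := fun j => ip (size x - j)) (s := fun j => upd (fun=> 0) 0 (size x - j))) => //.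
+ by rewrite subn0.
+ by rewrite subnn; upds.
+ by rewrite subn0.
+ by rewrite subnn.
move=> j jn; apply: (@runs_le _ _ _ (1 + 1)) => //.
apply: (runs_seq (S1 := St (tapes blank (input_cells x)) (Posz (size x)) (ip (size x - j)) (upd (fun=> 0) 0 (size x - j.+1)))).
  by apply: runs_dec; [rewrite /upd eqxx; lia|upds].
by apply: runs_left => /=; [lia|apply/funext => -[] //=; lia].
Qed.

Variables (L b : term).
Let e0 : nat -> nat := fun=> 0.
Let n := eval x w L e0.
Let bits i := 0 < eval x w b (scons i e0).
Definition print_time m := (tbound L m) + (vbound L m * (tbound b (m + vbound L m) + vbound b (m + vbound L m) * 2 + 6) + 2).

Lemma runs_print m (out : int -> cell) : size x <= m -> size w <= m -> (forall z, out z = None) -> forall p,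
  exists2 out' : int -> cell, (forall j, out' (p - Posz n + 1 + Posz j)%R = nth None [seq Some (inl c) | c <- mkseq bits n] j) &
  runs (print_bits L b) (St (tapes out (input_cells x)) p home e0)
    (St (tapes out' (input_cells x)) (p - Posz n + 1)%R home e0) (print_time m).
Proof.
move=> xm wm outN p.
(* The tape 0 after [j] rounds: the last letter is at the position [p]. *)
pose T j (z : int) : cell := if (p - z)%R is Posz i then if i < j then Some (inl (bits (n - i.+1))) else None else None.
exists (T n).
  move=> j; rewrite /T; have -> : (p - (p - Posz n + 1 + Posz j))%R = (Posz n - Posz j.+1)%R by lia.
  have [jn|jn] := ltnP j n; last first.
    by rewrite nth_default ?size_map ?size_iota //; case E : (Posz n - Posz j.+1)%R => [a|] //; case: ifP => //; lia.
  rewrite subzn // ifT; last by lia.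
  by rewrite (nth_map false) ?size_mkseq // nth_mkseq //; congr (Some (inl (bits _))); lia.
have vn : n <= vbound L m by apply: vbound_eval.
set m' := m + vbound L m.
have Cin C b' : tapes C (input_cells x) (in_tape b') = input_cells (input x w b') by case: b'.
have Creg C i : tapes C (input_cells x) i.+3 = mark by [].
have T0 : T 0 = out by apply/funext => z; rewrite outN /T; case: (_ - _)%R.
apply: (@runs_le _ _ _ (tbound L m + ((n * (tbound b m' + vbound b m' * 2 + 5).+1 + 1) + 1))); last first.
  by rewrite leq_add2l -addnA leq_add2r; apply: leq_mul => //; rewrite -/m'; lia.
apply: (runs_seq (S1 := St (tapes (T 0) (input_cells x)) p home (upd e0 0 n))).
  by rewrite T0; apply: (@acc_runs x w _ (Creg _) (Cin _) L (fun=> 1) 3 0 e0).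
pose s j := upd e0 0 (n - j).
pose S j := St (tapes (T j) (input_cells x)) (p - Posz j)%R home (s j).
apply: (runs_seq (S1 := S n)); last first.
  rewrite /S; have -> : s n = e0 by rewrite /s subnn; upds.
  exact: runs_act0.
have -> : St (tapes (T 0) (input_cells x)) p home (upd e0 0 n) = S 0.
  by rewrite /S /s subn0 subr0.
apply: (runs_while (f := S)) => [j jn|j jn].
  by rewrite (scan_reg (Creg _)) /s /upd eqxx subn_eq0 -ltnNge.
set k := n - j.+1; set v := eval x w b (scons k e0).
have vv : v <= vbound b m'.
  apply: vbound_eval; rewrite /m'; try lia.
  by case=> [|i] //=; rewrite /k; lia.
apply: (@runs_le _ _ _ (1 + (tbound b m' + (2 + (v * 2 + 1))))); last by lia.
apply: (runs_seq (S1 := St (tapes (T j) (input_cells x)) (p - Posz j)%R home (upd e0 0 k))).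
  by apply: runs_dec; rewrite /s /upd ?eqxx; [lia|rewrite /k; upds].
have E : (fun i => upd e0 0 k (scons 0 (fun=> 1) i)) = scons k e0 by apply/funext => -[|i].
apply: (runs_seq (S1 := St (tapes (T j) (input_cells x)) (p - Posz j)%R home (upd (upd e0 0 k) 2 v))).
  rewrite -[v]add0n /v -E.
  apply: (@acc_runs x w _ (Creg _) (Cin _) b (scons 0 (fun=> 1)) 3 2 (upd e0 0 k)) => //; rewrite /m'; try lia.
  - by case=> [|i] //=; rewrite /upd /= /k; lia.
  - by case.
  - by case=> [|i].
  by case.
apply: (runs_seq (S1 := St (tapes (T j.+1) (input_cells x)) (p - Posz j.+1)%R home (upd (upd e0 0 k) 2 v))).
  have W : runs (Act 0 (Some (bit_cell (0 < v))) MoveLeft) (St (tapes (T j) (input_cells x)) (p - Posz j)%R home (upd (upd e0 0 k) 2 v))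
    (St (tapes (T j.+1) (input_cells x)) (p - Posz j.+1)%R home (upd (upd e0 0 k) 2 v)) 1.
    apply: runs_act0 => /=; last by lia.
    apply/funext => z; rewrite /put; have [->|zj] := eqVneq z (p - Posz j)%R.
      by rewrite /T subKr /= ltnSn.
    rewrite /T; case e : (p - z)%R => [i|] //; rewrite ltnS leq_eqVlt; case: eqP => // ij; lia.
  have sc : isSome (scan (St (tapes (T j) (input_cells x)) (p - Posz j)%R home (upd (upd e0 0 k) 2 v)) 5) = (v == 0).
    by rewrite scan_reg.
  have [q q1 e] := W; exists q.+1; first by [].
  rewrite lt0n in e; case: (v == 0) e sc => e sc; first by apply: ExecIfT e; rewrite sc.
  by apply: ExecIfF e; rewrite sc.
apply: (runs_clear (Creg _)); first by rewrite /upd eqxx.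
by rewrite /s -/k; upds.
Qed.
End Print.

Lemma pb_poly f : pbounded f -> exists p : {poly nat}, forall m, f m <= (p.[m])%R.
Proof.
move=> [k hk]; exists (('X + 2%:P) ^+ k)%R => m; apply: leq_trans (hk m) _.
by rewrite horner_exp hornerD hornerX hornerC natrXE.
Qed.

(** Words whose length and letters are values of terms are computed in polynomial time. *)
Lemma print_outputs L b : exists (M : machine) (p : {poly nat}), forall x w ws,
  nth [::] ws 0 = x -> nth [::] ws 1 = w -> (forall i, nth [::] ws i.+2 = [::]) ->
  outputs_within M (p.[(size x + size w)%N])%R ws
    (mkseq (fun i => 0 < eval x w b (scons i (fun=> 0))) (eval x w L (fun=> 0))).
Proof.
pose K := registers L b.
have cB : tape_bound (term_cmd L b) <= K.+3.
  have -> : tape_bound (term_cmd L b) = maxn (tape_bound (mark_registers K)) K by [].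
  by rewrite geq_max tape_bound_mark; lia.
have [|p hp] := @pb_poly (fun m => K.+1 + ((m * 8 + 2) + print_time L b m)).
  apply: pb_add; first exact: pb_const.
  apply: pb_add; first by apply: pb_add; [apply: pb_mul; [exact: pb_id|]|]; exact: pb_const.
  apply: pb_add; first exact: pb_tbound.
  apply: pb_add; last exact: pb_const.
  apply: pb_mul; first exact: pb_vbound.
  apply: (pb_comp (f := fun v => tbound b v + vbound b v * 2 + 6) (g := fun m => m + vbound L m)).
    apply: pb_add; last exact: pb_const.
    by apply: pb_add; [exact: pb_tbound|apply: pb_mul; [exact: pb_vbound|exact: pb_const]].
  by apply: pb_add; [exact: pb_id|exact: pb_vbound].
exists (cmd_machine K.+2 (term_cmd L b)), p => x w ws w0 w1 w2.
set m := size x + size w.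
pose cells u : int -> cell := word_cells (map inl u).
pose blank : int -> cell := fun=> None.
have [out' outE R3] := @runs_print x w L b m blank (leq_addr _ _) (leq_addl _ _) (fun=> erefl) (Posz (size x)).
have R2 := runs_copy x w.
have R1 := @runs_marks (cells x) (cells w) blank K K 0%R home (leqnn K).
have mE : marked K K = (fun=> mark) by apply/funext => i; exact: marked_full.
rewrite mE in R1.
have [n nT e] := runs_seq R1 (runs_seq R2 R3).
apply: (exec_outputs cB e); last first.
- apply: leq_trans nT (leq_trans _ (hp m)); rewrite leq_add2l leq_add2r /m; lia.
- by move=> j; rewrite -outE.
case=> [|[|[|i]]] iK z; rewrite /= ?add0r.
- by rewrite w0.
- by rewrite w1.
- by rewrite w2; case: z => // q; rewrite /= nth_nil.
rewrite w2 /marked (_ : (K <= i) = false) /=; last lia.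
by case: z => // q; rewrite /= nth_nil.
Qed.

(** * Definable functions *)

(** Functions of the input, the certificate and the environment that are values of terms. Closure
    properties are stated for functions in this form so that definability can be
    established by following the shape of an expression ([dfn_auto]). *)
Definition dfn (F : word -> word -> (nat -> nat) -> nat) : Prop := exists t, forall x w e, eval x w t e = F x w e.
Definition tl (e : nat -> nat) : nat -> nat := fun i => e i.+1.

(** Needed to use a term below the binders of other terms. *)
Lemma rename t rho : exists t', forall x w e, eval x w t' e = eval x w t (fun i => e (rho i)).
Proof.
pose up r := scons 0 (fun i => (r i).+1).
have upE r v e : (fun i => scons v e (up r i)) = scons v (fun i => e (r i)) by apply/funext => -[].
elim: t rho => [i||a IHa b IHb|a IHa b IHb|a IHa b IHb|a IHa b IHb|j a IHa|j] rho.
- by exists (TVar (rho i)).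
- by exists TOne.
- by have [s hs] := IHa rho; have [t ht] := IHb rho; exists (TAdd s t) => x w e /=; rewrite hs ht.
- by have [s hs] := IHa rho; have [t ht] := IHb rho; exists (TSub s t) => x w e /=; rewrite hs ht.
- have [s hs] := IHa rho; have [t ht] := IHb (up rho); exists (TSum s t) => x w e /=; rewrite hs.
  by apply: eq_bigr => i _; rewrite ht upE.
- by have [s hs] := IHa rho; have [t ht] := IHb (up rho); exists (TLet s t) => x w e /=; rewrite hs ht upE.
- by have [s hs] := IHa rho; exists (TBit j s) => x w e /=; rewrite hs.
by exists (TLen j).
Qed.

Lemma dfn_ext F G : (forall x w e, F x w e = G x w e) -> dfn F -> dfn G.
Proof. by move=> FG [t ht]; exists t => x w e; rewrite ht. Qed.
Lemma dfn_rename F rho : dfn F -> dfn (fun x w e => F x w (fun i => e (rho i))).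
Proof. by move=> [t ht]; have [s hs] := rename t rho; exists s => x w e; rewrite hs ht. Qed.
Lemma dfn_tl F : dfn F -> dfn (fun x w e => F x w (tl e)).
Proof. exact: dfn_rename. Qed.
Lemma dfn_push F A : dfn F -> dfn A -> dfn (fun x w e => F x w (scons (A x w e) e)).
Proof. by move=> [t ht] [s hs]; exists (TLet s t) => x w e /=; rewrite ht hs. Qed.
Lemma dfn_call2 f A B : dfn (fun x w e => f x w (e 0) (e 1)) -> dfn A -> dfn B ->
  dfn (fun x w e => f x w (A x w e) (B x w e)).
Proof. by move=> hf hA hB; exact: (dfn_push (dfn_push hf (dfn_tl hA)) hB). Qed.
Lemma dfn_var i : dfn (fun x w e => e i). Proof. by exists (TVar i). Qed.
Lemma dfn_add F G : dfn F -> dfn G -> dfn (fun x w e => F x w e + G x w e).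
Proof. by move=> [s hs] [t ht]; exists (TAdd s t) => x w e /=; rewrite hs ht. Qed.
Lemma dfn_sub F G : dfn F -> dfn G -> dfn (fun x w e => F x w e - G x w e).
Proof. by move=> [s hs] [t ht]; exists (TSub s t) => x w e /=; rewrite hs ht. Qed.
Lemma dfn_const c : dfn (fun x w e => c).
Proof.
elim: c => [|c IH]; first by exists (TSub TOne TOne).
by apply: (dfn_ext (F := fun x w e => c + 1)) => [x w e|]; [rewrite addn1|apply: dfn_add IH _; exists TOne].
Qed.

Lemma dfn_succ F : dfn F -> dfn (fun x w e => (F x w e).+1).
Proof. by move=> hF; apply: dfn_ext (dfn_add hF (dfn_const 1)) => x w e; rewrite addn1. Qed.
Lemma dfn_pred F : dfn F -> dfn (fun x w e => (F x w e).-1).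
Proof. by move=> hF; apply: dfn_ext (dfn_sub hF (dfn_const 1)) => x w e; rewrite subn1. Qed.
Lemma dfn_sum B f : dfn B -> dfn (fun x w e => f x w (tl e) (e 0)) -> dfn (fun x w e => \sum_(0 <= i < B x w e) f x w e i).
Proof. by move=> [s hs] [t ht]; exists (TSum s t) => x w e /=; rewrite big_mkord hs; apply: eq_bigr => i _; rewrite ht. Qed.
Lemma dfn_mul F G : dfn F -> dfn G -> dfn (fun x w e => F x w e * G x w e).
Proof.
move=> hF hG; apply: dfn_ext (dfn_sum (f := fun x w e _ => G x w e) hF (dfn_tl hG)) => x w e.
by rewrite sum_nat_const_nat subn0.
Qed.

Lemma dfn_size_x : dfn (fun x w e => size x). Proof. by exists (TLen true). Qed.
Definition dfnb (P : word -> word -> (nat -> nat) -> bool) := dfn (fun x w e => P x w e).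
Lemma dfnb_ext P Q : (forall x w e, P x w e = Q x w e) -> dfnb P -> dfnb Q.
Proof. by move=> PQ; apply: dfn_ext => x w e; rewrite PQ. Qed.
Lemma dfnb_bit_x A : dfn A -> dfnb (fun x w e => nth false x (A x w e)).
Proof. by move=> [s hs]; exists (TBit true s) => x w e /=; rewrite hs. Qed.
Lemma dfnb_bit_w A : dfn A -> dfnb (fun x w e => nth false w (A x w e)).
Proof. by move=> [s hs]; exists (TBit false s) => x w e /=; rewrite hs. Qed.
Lemma dfnb_const b : dfnb (fun x w e => b). Proof. exact: dfn_const. Qed.
Lemma dfnb_not P : dfnb P -> dfnb (fun x w e => ~~ P x w e).
Proof. by move=> hP; apply: dfn_ext (dfn_sub (dfn_const 1) hP) => x w e; case: (P x w e). Qed.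
Lemma dfnb_and P Q : dfnb P -> dfnb Q -> dfnb (fun x w e => P x w e && Q x w e).
Proof. by move=> hP hQ; apply: dfn_ext (dfn_mul hP hQ) => x w e; case: (P x w e); case: (Q x w e). Qed.
Lemma dfnb_or P Q : dfnb P -> dfnb Q -> dfnb (fun x w e => P x w e || Q x w e).
Proof.
move=> hP hQ; apply: dfnb_ext (dfnb_not (dfnb_and (dfnb_not hP) (dfnb_not hQ))) => x w e.
by rewrite negb_and !negbK.
Qed.

Lemma dfnb_imp P Q : dfnb P -> dfnb Q -> dfnb (fun x w e => P x w e ==> Q x w e).
Proof. by move=> hP hQ; apply: dfnb_ext (dfnb_or (dfnb_not hP) hQ) => x w e; rewrite implybE. Qed.
Lemma dfnb_leq F G : dfn F -> dfn G -> dfnb (fun x w e => F x w e <= G x w e).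
Proof.
move=> hF hG; apply: dfn_ext (dfn_sub (dfn_const 1) (dfn_sub hF hG)) => x w e.
by rewrite -subn_eq0; case: (_ - G x w e) => //= n; rewrite subSS sub0n.
Qed.

Lemma dfnb_eq F G : dfn F -> dfn G -> dfnb (fun x w e => F x w e == G x w e).
Proof. by move=> hF hG; apply: dfnb_ext (dfnb_and (dfnb_leq hF hG) (dfnb_leq hG hF)) => x w e; rewrite eqn_leq. Qed.
Lemma dfnb_eqb P Q : dfnb P -> dfnb Q -> dfnb (fun x w e => P x w e == Q x w e).
Proof. by move=> hP hQ; apply: dfnb_ext (dfnb_eq hP hQ) => x w e; case: (P x w e); case: (Q x w e). Qed.
Lemma dfn_if P F G : dfnb P -> dfn F -> dfn G -> dfn (fun x w e => if P x w e then F x w e else G x w e).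
Proof.
move=> hP hF hG; apply: dfn_ext (dfn_add (dfn_mul hP hF) (dfn_mul (dfnb_not hP) hG)) => x w e.
by case: (P x w e); rewrite /= ?mul1n ?mul0n ?addn0.
Qed.

Lemma dfnb_if P Q R : dfnb P -> dfnb Q -> dfnb R -> dfnb (fun x w e => if P x w e then Q x w e else R x w e).
Proof. by move=> hP hQ hR; apply: dfn_ext (dfn_if hP hQ hR) => x w e; case: (P x w e). Qed.
Lemma dfnb_has B P : dfn B -> dfnb (fun x w e => P x w (tl e) (e 0)) -> dfnb (fun x w e => has (P x w e) (iota 0 (B x w e))).
Proof.
move=> hB hP; apply: dfn_ext (dfnb_leq (dfn_const 1) (dfn_sum (f := fun x w e i => P x w e i : nat) hB hP)) => x w e; congr nat_of_bool.
have -> : \sum_(0 <= i < B x w e) P x w e i = count (P x w e) (iota 0 (B x w e)) by rewrite -sum1_count [RHS]big_mkcond /index_iota subn0 /=; apply: eq_bigr => i _; case: (P x w e i).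
by rewrite has_count.
Qed.

Lemma dfnb_all B P : dfn B -> dfnb (fun x w e => P x w (tl e) (e 0)) -> dfnb (fun x w e => all (P x w e) (iota 0 (B x w e))).
Proof.
move=> hB hP; apply: dfnb_ext (dfnb_not (dfnb_has (P := fun x w e i => ~~ P x w e i) hB (dfnb_not hP))) => x w e.
by rewrite -all_predC; apply: eq_all => i /=; rewrite negbK.
Qed.

Lemma dfn_div F G : dfn F -> dfn G -> dfn (fun x w e => F x w e %/ G x w e).
Proof.
have H : dfn (fun x w e => e 0 %/ e 1).
  apply: (dfn_ext (F := fun x w e => \sum_(0 <= k < e 0) ((0 < e 1) && (k.+1 * e 1 <= e 0)))); last first.
    apply: (dfn_sum (f := fun x w e k => ((0 < e 1) && (k.+1 * e 1 <= e 0)))); first exact: dfn_var.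
    by apply: dfnb_and; apply: dfnb_leq; rewrite /tl; do ?[exact: dfn_const | exact: dfn_var | exact: dfn_succ (dfn_var 0) | apply: dfn_mul].
  move=> x w e; set a := e 0; set b := e 1; case: (posnP b) => [->|b0]; first by rewrite divn0 big1.
  under eq_bigr do rewrite andTb -leq_divRL //.
  have : a %/ b <= a by exact: leq_div.
  move: (a %/ b) => c; elim: a => [|a IH]; first by rewrite leqn0 => /eqP ->; rewrite big_geq.
  rewrite leq_eqVlt big_nat_recr //= => /orP[/eqP ->|]; last by rewrite ltnS => ca; rewrite IH // ltnNge ca addn0.
  rewrite ltnSn addn1; congr _.+1.
  rewrite (eq_big_nat _ _ (F2 := fun=> 1)); first by rewrite sum_nat_const_nat subn0 muln1.
  by move=> i /andP[_ ia]; rewrite ltnS ltnW.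
by move=> hF hG; exact: (dfn_call2 (f := fun _ _ a b => a %/ b) H hF hG).
Qed.

Lemma dfn_mod F G : dfn F -> dfn G -> dfn (fun x w e => F x w e %% G x w e).
Proof.
move=> hF hG; apply: dfn_ext (dfn_sub hF (dfn_mul (dfn_div hF hG) hG)) => x w e.
by rewrite {1}(divn_eq (F x w e) (G x w e)) addnC addnK.
Qed.

Lemma dfn_poly (p : {poly nat}) F : dfn F -> dfn (fun x w e => (p.[F x w e])%R).
Proof.
move=> hF; elim/poly_ind: p => [|p c IH].
  by apply: (dfn_ext (F := fun x w e => 0)) (dfn_const 0) => x w e; rewrite horner0.
by apply: dfn_ext (dfn_add (dfn_mul IH hF) (dfn_const c)) => x w e; rewrite hornerD hornerMX hornerC.
Qed.
(** A function given by a finite table. Constants of the problem, such as the transition function of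
    a machine, enter terms in this form. *)
Definition tab (T : Type) (d : T) N (f : nat -> T) (a : nat) : T := if a < N then f a else d.
Lemma dfn_tab N (f : nat -> word -> word -> (nat -> nat) -> nat) A : dfn A -> (forall k, k < N -> dfn (f k)) ->
  dfn (fun x w e => tab 0 N (fun k => f k x w e) (A x w e)).
Proof.
move=> hA; elim: N => [|N IH] hf; first exact: dfn_const 0.
apply: dfn_ext (dfn_if (dfnb_eq hA (dfn_const N)) (hf N (ltnSn N)) (IH (fun k kN => hf k (ltnW kN)))) => x w e.
by rewrite /tab ltnS [A _ _ _ <= N]leq_eqVlt; case: eqP => [->|].
Qed.

Lemma dfnb_tab N (f : nat -> word -> word -> (nat -> nat) -> bool) A : dfn A -> (forall k, k < N -> dfnb (f k)) ->
  dfnb (fun x w e => tab false N (fun k => f k x w e) (A x w e)).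
Proof.
move=> hA hf; apply: dfn_ext (dfn_tab hA hf) => x w e; rewrite /tab; by case: ifP.
Qed.
(** One step along the shape of an expression; [ext] takes care of the functions that the problem
    at hand provides. *)
Ltac dfn_step ext :=
  cbv beta delta [tl];
  lazymatch goal with
  | |- dfn (fun x w e => nat_of_bool (@?P x w e)) => change (dfnb P)
  | |- dfn (fun _ _ _ => ?c) => exact (dfn_const c)
  | |- dfnb (fun _ _ _ => ?c) => exact (dfnb_const c)
  | |- dfn (fun x w e => e ?i) => exact (dfn_var i)
  | |- dfn (fun x w e => size x) => exact dfn_size_x
  | |- dfn (fun x w e => addn (@?A x w e) (@?B x w e)) => apply (@dfn_add A B)
  | |- dfn (fun x w e => subn (@?A x w e) (@?B x w e)) => apply (@dfn_sub A B)
  | |- dfn (fun x w e => muln (@?A x w e) (@?B x w e)) => apply (@dfn_mul A B)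
  | |- dfn (fun x w e => divn (@?A x w e) (@?B x w e)) => apply (@dfn_div A B)
  | |- dfn (fun x w e => modn (@?A x w e) (@?B x w e)) => apply (@dfn_mod A B)
  | |- dfn (fun x w e => S (@?A x w e)) => apply (@dfn_succ A)
  | |- dfn (fun x w e => predn (@?A x w e)) => apply (@dfn_pred A)
  | |- dfn (fun x w e => horner ?p (@?A x w e)) => apply (@dfn_poly p A)
  | |- dfnb (fun x w e => negb (@?A x w e)) => apply (@dfnb_not A)
  | |- dfnb (fun x w e => andb (@?A x w e) (@?B x w e)) => apply (@dfnb_and A B)
  | |- dfnb (fun x w e => orb (@?A x w e) (@?B x w e)) => apply (@dfnb_or A B)
  | |- dfnb (fun x w e => implb (@?A x w e) (@?B x w e)) => apply (@dfnb_imp A B)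
  | |- dfnb (fun x w e => leq (@?A x w e) (@?B x w e)) => apply (@dfnb_leq A B)
  | |- dfnb (fun x w e => @eq_op Datatypes_nat__canonical__eqtype_Equality (@?A x w e) (@?B x w e)) => apply (@dfnb_eq A B)
  | |- dfnb (fun x w e => @eq_op Datatypes_bool__canonical__eqtype_Equality (@?A x w e) (@?B x w e)) => apply (@dfnb_eqb A B)
  | |- dfnb (fun x w e => has (@?P x w e) (iota 0 (@?B x w e))) => apply (@dfnb_has B P)
  | |- dfnb (fun x w e => all (@?P x w e) (iota 0 (@?B x w e))) => apply (@dfnb_all B P)
  | |- dfnb (fun x w e => nth false x (@?A x w e)) => apply (@dfnb_bit_x A)
  | |- dfnb (fun x w e => nth false w (@?A x w e)) => apply (@dfnb_bit_w A)
  | |- dfnb _ => first [ext | apply: dfnb_if]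
  | |- dfn _ => first [ext | apply: dfn_sum | apply: dfn_if]
  end.
Ltac dfn_auto ext := repeat dfn_step ext.

(** * Membership in NP *)

Lemma nth_grid (T U : Type) (e : T -> U -> bool) (s : seq T) (r : seq U) x0 y0 i j : i < size s -> j < size r ->
  nth false [seq e u v | u <- s, v <- r] (i * size r + j) = e (nth x0 s i) (nth y0 r j).
Proof.
elim: s i => // a s IH [|i] /= si rj; rewrite nth_cat size_map.
  by rewrite add0n rj (nth_map y0).
by rewrite mulSn -addnA ltnNge leq_addr /= addKn IH.
Qed.

Lemma size_grid (T U : Type) (e : T -> U -> bool) (s : seq T) (r : seq U) :
  size [seq e u v | u <- s, v <- r] = size s * size r.
Proof. by elim: s => //= a s IH; rewrite size_cat size_map IH. Qed.

(** The number of leading ones, which is the number of vertices if the word encodes a digraph. *)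
Definition ones (x : word) : nat := \sum_(0 <= i < size x) all (nth false x) (iota 0 i.+1).
Lemma ones_nseq n s : ones (nseq n true ++ false :: s) = n.
Proof.
rewrite /ones size_cat size_nseq (big_cat_nat (n := n)) ?leq_addr //.
have H i : all (nth false (nseq n true ++ false :: s)) (iota 0 i.+1) = (i < n).
  apply/idP/idP => [/allP/(_ n)|lin]; last first.
    apply/allP => j; rewrite mem_iota => /andP[_ ji]; have jn : j < n by apply: leq_trans ji _.
    by rewrite nth_cat size_nseq jn nth_nseq jn.
  rewrite mem_iota ltnS nth_cat size_nseq ltnn subnn /= ltnNge; case: (n <= i) => //= h.
  by have := h isT.
rewrite (eq_big_nat _ _ (F2 := fun=> 1)) => [|i /andP[_ lin]]; last by rewrite H lin.
rewrite sum_nat_const_nat subn0 muln1 big_nat big1 ?Monoid.mulm1 // => i /andP[ni _].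
by rewrite H ltnNge ni.
Qed.

Section Encoding.
Variables (T : finType) (e : rel T).
Lemma ones_encode : ones (encode_digraph e) = #|T|.
Proof. exact: ones_nseq. Qed.
Lemma size_encode : size (encode_digraph e) = #|T|.+1 + #|T| * #|T|.
Proof. by rewrite size_cat size_nseq /= size_grid -cardE addSnnS. Qed.
Lemma nth_encode (u v : T) :
  nth false (encode_digraph e) (#|T|.+1 + (enum_rank u * #|T| + enum_rank v)) = e u v.
Proof.
rewrite nth_cat size_nseq ltnNge ltnW ?leq_addr //= addSnnS addKn /=.
have := @nth_grid _ _ e (enum T) (enum T) u v (enum_rank u) (enum_rank v).
by rewrite -cardE !ltn_ord !nth_enum_rank; apply.
Qed.
End Encoding.

Lemma dfnb_poly_time_rel V : dfnb (fun x w e => V x w) -> poly_time_rel V.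
Proof.
move=> [t ht]; have [M [p H]] := print_outputs TOne t; exists M, p => x w.
have := H x w [:: x; w] erefl erefl (fun i => nth_nil _ _).
by rewrite /mkseq /= ht lt0b.
Qed.

Lemma dfn_poly_time_fun (L : word -> nat) (b : word -> nat -> bool) :
  dfn (fun x w e => L x) -> dfnb (fun x w e => b x (e 0)) -> poly_time_fun (fun x => mkseq (b x) (L x)).
Proof.
move=> [tL hL] [t ht]; have [M [p H]] := print_outputs tL t; exists M, p => x.
have := H x [::] [:: x] erefl erefl (fun=> erefl).
by rewrite hL /= addn0 (eq_mkseq (g := b x)) // => i; rewrite ht lt0b.
Qed.

Lemma dfn_ones : dfn (fun x w e => ones x).
Proof. rewrite /ones; dfn_auto ltac:(fail). Qed.

(** A certificate lists the colours of the vertices and then, in unary, their ranks; these are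
    at most [n]. *)
Definition cert_rank (n : nat) (w : word) (a : nat) : nat := \sum_(0 <= i < n.+1) nth false w (n + (a * n.+1 + i)).
Definition certified (x w : word) : bool :=
  let n := ones x in
  all (fun a => all (fun b => nth false x (n.+1 + (a * n + b)) ==>
    ((nth false w a != nth false w b) || (cert_rank n w a < cert_rank n w b))) (iota 0 n)) (iota 0 n).
Lemma certified_poly : poly_time_rel certified.
Proof.
apply: dfnb_poly_time_rel; rewrite /certified /cert_rank.
dfn_auto ltac:(first [exact: dfn_ones]).
Qed.

Lemma certifiedP (D : oriented_graph) B : #|D| + #|D| * #|D|.+1 <= B ->
  dicolourable 2 D <-> exists2 w, size w <= B & certified (encode_digraph (@Defs.arc D)) w.
Proof.
move=> nB; rewrite dicolourable2P; set n := #|D|.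
have allI (p : nat -> bool) : reflect (forall u : D, p (enum_rank u)) (all p (iota 0 n)).
  apply: (iffP allP) => [h u|h i]; first by apply: h; rewrite mem_iota ltn_ord.
  by rewrite mem_iota => /andP[_ lin]; have := h (enum_val (Ordinal lin)); rewrite enum_valK.
split; last first.
  case=> w _; rewrite /certified ones_encode => /allI H.
  exists (fun u => nth false w (enum_rank u)), (fun u => cert_rank n w (enum_rank u)) => u v uv cuv.
  by have /allI/(_ v) := H u; rewrite nth_encode uv cuv eqxx.
case=> col [rho0 H0].
have [|rho [H rhon]] := @acyclic_rank _ (fun u v : D => Defs.arc u v && (col u == col v)).
  by apply: (rank_acyclic (rho := rho0)) => u v /andP[uv /eqP]; exact: H0.
pose c i := if insub i is Some k then col (enum_val (k : 'I_n)) else false.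
pose r i := if insub i is Some k then rho (enum_val (k : 'I_n)) else 0.
have cE u : c (enum_rank u) = col u by rewrite /c valK enum_rankK.
have rE u : r (enum_rank u) = rho u by rewrite /r valK enum_rankK.
pose w := mkseq (fun k => if k < n then c k else (k - n) %% n.+1 < r ((k - n) %/ n.+1)) (n + n * n.+1).
have wc u : nth false w (enum_rank u) = col u.
  by have un := ltn_ord (enum_rank u); rewrite nth_mkseq ?un ?cE // (leq_trans un) ?leq_addr.
have wr u : cert_rank n w (enum_rank u) = rho u.
  rewrite -rE /cert_rank; have un := ltn_ord (enum_rank u).
  have rn : r (enum_rank u) <= n by rewrite rE rhon.
  under eq_big_nat => i /andP[_ lin].
    rewrite nth_mkseq; last first.
      by rewrite ltn_add2l; apply: (@leq_trans ((enum_rank u).+1 * n.+1)); [rewrite mulSn; lia|rewrite leq_mul2r un orbT].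
    rewrite ltnNge leq_addr /= addKn modnMDl modn_small // divnMDl // divn_small // addn0.
    over.
  move: (r _) rn => k kn; rewrite (big_cat_nat (n := k)) ?leqW //=.
  rewrite (eq_big_nat _ _ (F2 := fun=> 1)) => [|i /andP[_ ->] //].
  rewrite sum_nat_const_nat subn0 muln1 big_nat big1 ?addn0 // => i /andP[ki _].
  by rewrite ltnNge ki.
exists w; first by rewrite size_mkseq.
rewrite /certified ones_encode; apply/allI => u; apply/allI => v; rewrite nth_encode !wc !wr.
by apply/implyP => uv; case: eqVneq => //= cuv; apply: H; rewrite uv cuv eqxx.
Qed.

Lemma dicolourability_NP (R : realType) : in_NP (planar_dicolourability R 2).
Proof.
exists certified; first exact: certified_poly.
exists ('X + 'X * ('X + 1%:P))%R => -[D pD] /=; apply: certifiedP.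
rewrite size_encode !(hornerD, hornerM, hornerX, hornerC) !natrDE natrME addn1.
by apply: leq_add; [|apply: leq_mul; rewrite ?ltnS]; apply: leq_trans (leq_addr _ _).
Qed.

(** * The tableau of a machine *)

Section Tableau.
Variable M : machine.
Notation K := (tm_extra_tapes M).
Notation symbol := (bool + tm_aux M)%type.
(** An entry of the tableau: the state, repeated in all entries of a row, and the cells of all
    tapes at a given distance from their heads. As distances to the heads are used, the
    tapes move and the heads stay. *)
Definition column : Type := (tm_state M * {ffun 'I_K.+1 -> option symbol})%type.
HB.instance Definition _ := Finite.copy column (tm_state M * {ffun 'I_K.+1 -> option symbol})%type.
Definition column_at (qv : tm_state M * tapes_view M) (z : int) : column := (qv.1, [ffun i => qv.2 i z]).
(** All that the transition needs to know of the distance: whether it is -1, 0 or 1. *)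
Definition near (z : int) : nat :=
  match z with Negz 0 => 0 | Posz 0 => 1 | Posz 1 => 2 | _ => 3 end.
(** The entry at distance [z] in the next row, from the entries at distances [0], [z - 1], [z] and
    [z + 1]. *)
Definition next_column (k : nat) (a b c d : column) : column :=
  if tm_delta a.1 a.2 is Some (q, act) then
    (q, [ffun i => match (act i).2 with
         | MoveLeft => if k == 2 then (act i).1 else b.2 i
         | Stay => if k == 1 then (act i).1 else c.2 i
         | MoveRight => if k == 0 then (act i).1 else d.2 i end])
  else (a.1, c.2).

Lemma column_step qv z : column_at (odflt qv (vstep qv)) z =
  next_column (near z) (column_at qv 0) (column_at qv (z - 1)) (column_at qv z) (column_at qv (z + 1)).
Proof.
rewrite /vstep /next_column /=; case: tm_delta => [[q act]|] //=.
rewrite /column_at /=; congr pair; apply/ffunP => i; rewrite !ffunE /vact.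
case: (act i) => s [] /=; last 2 first.
- by rewrite addr0; case: z => [[|[|z]]|[|z]].
- by rewrite (_ : (z + 1 == 0)%R = (near z == 0)) //; case: z => [[|[|z]]|[|z]].
by rewrite (_ : (z + Negz 0 == 0)%R = (near z == 2)) //; case: z => [[|[|z]]|[|z]].
Qed.

(** The symbols of the input alphabet are told apart from each other and from all others. *)
Definition code (s : option symbol) : nat := match s with None => 0 | Some (inl b) => b.+1 | Some (inr _) => 3 end.
Definition tape_code (i : nat) (g : column) : nat := if insub i is Some j then code (g.2 j) else 0.
Definition fresh (g : column) : bool := (g.1 == tm_start M) && [forall i : 'I_K.+1, (1 < i) ==> (g.2 i == None)].

Section Word.
Variables (x : word) (q T R : nat).
Definition x_code (z : nat) : nat := if (R <= z) && (z - R < size x) then (nth false x (z - R)).+1 else 0.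
(** The initial row: the input on the tape 0 and, on the tape 1, a word of at most [q]
    bits. Which one is left open; this is where the certificate is guessed. That the bits
    form an initial segment is a condition on neighbouring entries. *)
Definition starts (z : nat) (c d : column) : bool :=
  [&& fresh c, tape_code 0 c == x_code z &
      if (R <= z) && (z - R < q) then (tape_code 1 c < 3) && ((tape_code 1 c == 0) ==> (tape_code 1 d == 0))
      else tape_code 1 c == 0].
Definition cat (z : nat) : nat := if z == R then 1 else if z.+1 == R then 0 else if z == R.+1 then 2 else 3.
(** The violations of the rules, all of them visible in a window of five entries. *)
Definition bad (t z : nat) (a b c d e : column) : bool :=
  [&& t < T, 0 < z, z < R.*2 &
   [|| e != next_column (cat z) a b c d, (t == 0) && ~~ starts z c d | [&& t.+1 == T, z == R & tape_code 0 e != 2]]].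
Definition legal (s : nat -> nat -> column) : Prop :=
  forall t z, ~~ bad t z (s t R) (s t z.-1) (s t z) (s t z.+1) (s t.+1 z).

Hypothesis T0 : 0 < T.
Hypothesis RT : T + q < R.
Variable V : word -> bool.
Hypothesis computes : forall w, size w <= q -> outputs_within M T [:: x; w] [:: V w].

Lemma near_cat z : near (Posz z - Posz R)%R = cat z.
Proof.
rewrite /cat; case: eqP => [->|ne1]; first by rewrite subrr.
case: eqP => [<-|ne2]; first by rewrite -addn1 PoszD opprD addrA subrr sub0r.
case: eqP => [->|ne3]; first by rewrite -addn1 PoszD addrAC subrr add0r.
by case e : (Posz z - Posz R)%R => [[|[|k]]|[|k]] //=; lia.
Qed.

Definition start_view (w : word) := cfg_view (initial M [:: x; w]).
Lemma column_start w z : column_at (start_view w) z =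
  (tm_start M, [ffun i : 'I_K.+1 => word_cells (map inl (nth [::] [:: x; w] i)) z]).
Proof. by rewrite /column_at /=; congr pair; apply/ffunP => i; rewrite !ffunE view_tape_of. Qed.

Definition letter (u : word) (z : int) : option symbol := word_cells (map inl u) z.
Lemma code_letter u z : code (letter u z) =
  if z is Posz k then if k < size u then (nth false u k).+1 else 0 else 0.
Proof.
case: z => [k|//]; rewrite /letter /word_cells -map_comp; case: ltnP => h; last by rewrite nth_default ?size_map.
by rewrite (nth_map false).
Qed.

Lemma tape_code_start w i z : tape_code i (column_at (start_view w) z) = if i < K.+1 then code (letter (nth [::] [:: x; w] i) z) else 0.
Proof.
rewrite /tape_code column_start; case: ltnP => h; first by rewrite insubT /= ffunE.
by rewrite insubF //; apply/negbTE; rewrite -leqNgt.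
Qed.

Lemma x_codeE z : x_code z = code (letter x (Posz z - Posz R)%R).
Proof.
rewrite code_letter /x_code; case: (leqP R z) => h; first by rewrite subzn.
by case e : (_ - _)%R => [k|//]; lia.
Qed.

Lemma fresh_start w z : fresh (column_at (start_view w) z).
Proof.
rewrite /fresh column_start /= eqxx; apply/forallP => i; apply/implyP => i1; rewrite ffunE.
by case: i i1 => -[|[|i]] //= _ _; rewrite nth_nil; case: z => // k; rewrite /= nth_nil.
Qed.

Lemma head_accepting w : size w <= q -> (tape_code 0 (column_at (vrun T (start_view w)) 0) == 2) = V w.
Proof.
move=> /computes[_]; rewrite vrun_view /output /tape_code insubT /= ffunE /=.
rewrite (_ : Sub _ _ = ord0); last exact: val_inj.
case: (tape_head _) => [[[]|y]|] //= [<-] //.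
Qed.

Lemma tableau_complete w : size w <= q -> V w -> exists s, legal s.
Proof.
move=> wq Vw; exists (fun t z => column_at (vrun t (start_view w)) (Posz z - Posz R)%R) => t z.
apply/negP => /and4P[tT z0 zR]; apply/negP; rewrite !negb_or; apply/and3P; split.
- rewrite negbK -near_cat /= column_step subrr; apply/eqP; congr next_column; congr column_at; lia.
- rewrite negb_and negbK; case: t tT => //= _.
  rewrite /starts fresh_start !tape_code_start /= x_codeE eqxx /=.
  case: (boolP (1 < K.+1)) => k1; last by rewrite if_same.
  rewrite !code_letter; case: ifP => [/andP[Rz zq]|out].
    rewrite !subzn ?(leqW Rz) //; apply/andP; split; first by case: ifP => // _; case: (nth _ _ _).
    by apply/implyP; case: ltnP => // h _; rewrite ltnNge (leq_trans h) // leq_sub2r.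
  case e : (_ - _)%R => [k|//]; rewrite ltnNge; case: leqP => // kw; lia.
rewrite !negb_and negbK; case: eqP => //= tE; case: eqP => //= zE.
by rewrite zE subrr -[odflt _ _]/(vrun t.+1 (start_view w)) tE head_accepting.
Qed.

(** The rules say nothing about the two ends of a row, and with each step this may affect one
    more entry at either side. The radius exceeds the number of steps, so that the middle
    of the last row is correct. *)
Lemma tableau_sound s : legal s -> exists2 w, size w <= q & V w.
Proof.
move=> L.
have st z : 0 < z -> z < R.*2 -> starts z (s 0 z) (s 0 z.+1).
  by move=> z0 zR; have := L 0 z; rewrite /bad T0 z0 zR /= !negb_or !negbK => /and3P[].
pose u k := tape_code 1 (s 0 (R + k)).
have stu k : k < R -> if k < q then (u k < 3) && ((u k == 0) ==> (u k.+1 == 0)) else u k == 0.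
  move=> kR; have := st (R + k); rewrite /starts leq_addr addKn /= -addnS => /(_ _ _)/and3P[] //; lia.
have u0 : exists k, (k <= q) && (u k == 0).
  by exists q; rewrite leqnn; have := stu q; rewrite ltnn; apply; lia.
(* The certificate ends at the first blank of the tape 1. *)
have [m /andP[mq um] mmin] := ex_minnP u0.
pose w := mkseq (fun k => u k == 2) m.
have uw k : k < R -> u k = if k < m then (nth false w k).+1 else 0.
  move=> kR; case: ltnP => km.
    rewrite nth_mkseq //; have := stu k kR; rewrite (leq_trans km) // => /andP[u3 _].
    have un0 : u k != 0 by apply/negP => k0; have := mmin k; rewrite k0 andbT [m <= k]leqNgt km => /(_ (ltnW (leq_trans km mq))).
    by case: (u k) u3 un0 => [|[|[|]]].
  elim: k km kR => [|k IH] km kR; first by move: km um; rewrite leqn0 => /eqP -> /eqP.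
  move: km; rewrite leq_eqVlt => /orP[/eqP <-|km]; first exact/eqP.
  have := stu k (ltnW kR); rewrite IH //; last by apply: ltnW.
  case: ifP => [_ /andP[_ /eqP//]|kq _]; have := stu k.+1 kR.
  by rewrite (_ : (k.+1 < q) = false); [move/eqP|lia].
have wq : size w <= q by rewrite size_mkseq.
have inj_code (a b : option symbol) : code a = code b -> code b < 3 -> a = b.
  by case: a => [[[]|?]|]; case: b => [[[]|?]|].
have row0 z : 0 < z -> z < R.*2 -> s 0 z = column_at (start_view w) (Posz z - Posz R)%R.
  move=> z0 zR; have /and3P[/andP[/eqP q0 /forallP blank] /eqP x0 w0] := st z z0 zR.
  have wz : tape_code 1 (s 0 z) = if 1 < K.+1 then code (letter w (Posz z - Posz R)%R) else 0.
    case: (boolP (1 < K.+1)) => k1; last by rewrite /tape_code insubF //; apply/negbTE.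
    rewrite code_letter; case: (leqP R z) w0 => Rz /= w0.
      rewrite subzn //; have := uw (z - R); rewrite /u subnKC // size_mkseq; apply.
      lia.
    by case e : (_ - _)%R => [k|//]; lia.
  rewrite column_start; case: (s 0 z) q0 blank x0 wz {w0} => st0 f /= -> blank x0 wz.
  congr pair; apply/ffunP => i; rewrite ffunE.
  case: i (blank i) => -[|[|i]] ik /= bl.
  - apply: inj_code; last by rewrite -/(letter _ _) code_letter; case: (_ - _)%R => // k; case: ifP => // _; case: (nth _ _ _).
    by rewrite -/(letter _ _) -x_codeE -x0 /tape_code insubT /=; congr (code (f _)); exact: val_inj.
  - apply: inj_code; last by rewrite -/(letter _ _) code_letter; case: (_ - _)%R => // k; case: ifP => // _; case: (nth _ _ _).
    by move: wz; rewrite ik /tape_code insubT.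
  by rewrite nth_nil (eqP bl); case: (_ - _)%R => // k; rewrite /= nth_nil.
have row t z : t <= T -> t < z -> z + t < R.*2 -> s t z = column_at (vrun t (start_view w)) (Posz z - Posz R)%R.
  elim: t z => [|t IH] z tT tz zR; first by apply: row0; lia.
  have := L t z; rewrite /bad tT (leq_trans _ tz) // (_ : z < R.*2) ?negb_or ?negbK; last by lia.
  case/and3P => /eqP -> _ _; rewrite /= column_step near_cat.
  rewrite !IH; try lia.
  rewrite subrr; congr next_column; congr column_at; lia.
exists w => //; rewrite -head_accepting //.
have := L T.-1 R; rewrite /bad prednK // eqxx leqnn /= (_ : 0 < R) 1?(_ : R < R.*2) ?negb_or ?eqxx ?negbK /=; try lia.
by case/and3P => _ _; rewrite row ?subrr //; lia.
Qed.
End Word.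
End Tableau.

(** * Local constraints on a grid as a CNF formula *)

(** A variable for each entry of the grid and each of its [G] possible values. The clauses are
    indexed by the places of windows together with their possible values, in two
    copies: the first says that the entry at the place has a value, the second excludes the
    values if they are [bad], and repeats the first otherwise. It does no harm if an entry has
    several values, since any choice among them satisfies the constraints. *)
Section GridCnf.
Variables (T Z G R : nat) (bad : nat -> nat -> nat -> nat -> nat -> nat -> nat -> bool).
Hypothesis G0 : 0 < G.
Hypothesis RZ : R < Z.
Hypothesis bad_in : forall t z a b c d e, bad t z a b c d e -> [/\ t < T, 0 < z & z.+1 < Z].
Definition grid_var (t z g : nat) : nat := (t * Z + z) * G + g.
Definition grid_vars : nat := T.+1 * Z * G.
Definition window_count : nat := T.+1 * Z * G ^ 5.
Definition grid_clauses : nat := 2 * window_count.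
(** The index of a clause is the index of the place followed by the values in the window, as five
    digits in base [G]. *)
Definition digit (i r : nat) : nat := r %/ G ^ i %% G.
Definition row_of (r : nat) : nat := r %/ G ^ 5 %/ Z.
Definition col_of (r : nat) : nat := r %/ G ^ 5 %% Z.
Definition excludes (r : nat) : bool :=
  bad (row_of r) (col_of r) (digit 4 r) (digit 3 r) (digit 2 r) (digit 1 r) (digit 0 r).
Definition in_window (r v : nat) : bool :=
  [|| v == grid_var (row_of r) R (digit 4 r), v == grid_var (row_of r) (col_of r).-1 (digit 3 r),
      v == grid_var (row_of r) (col_of r) (digit 2 r), v == grid_var (row_of r) (col_of r).+1 (digit 1 r) |
      v == grid_var (row_of r).+1 (col_of r) (digit 0 r)].
Definition grid_lit (s v : nat) : nat :=
  let r := s %% window_count in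
  if (window_count <= s) && excludes r then (if in_window r v then 2 else 0)
  else (v %/ G == r %/ G ^ 5).
Definition allowed (f : nat -> nat -> nat) : Prop :=
  forall t z, ~~ bad t z (f t R) (f t z.-1) (f t z) (f t z.+1) (f t.+1 z).

Lemma grid_lit3 s v : grid_lit s v < 3.
Proof. by rewrite /grid_lit; case: ifP => _; [case: ifP|case: (_ == _)]. Qed.
Lemma grid_var_lt t z g : t <= T -> z < Z -> g < G -> grid_var t z g < grid_vars.
Proof.
move=> tT zZ gG; rewrite /grid_var /grid_vars.
apply: (@leq_trans ((t * Z + z).+1 * G)); first by rewrite mulSn; lia.
rewrite leq_mul2r; apply/orP; right.
by apply: (@leq_trans (t.+1 * Z)); [rewrite mulSn; lia|rewrite leq_mul2r ltnS tT orbT].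
Qed.

Lemma grid_varK t z g : g < G -> grid_var t z g %/ G = t * Z + z.
Proof. by move=> gG; rewrite /grid_var divnMDl // divn_small // addn0. Qed.
Lemma digit_lt i r : digit i r < G. Proof. by rewrite ltn_mod. Qed.

Definition window (t z a b c d e : nat) : nat := (((((t * Z + z) * G + a) * G + b) * G + c) * G + d) * G + e.
Lemma windowK t z a b c d e : z < Z -> a < G -> b < G -> c < G -> d < G -> e < G ->
  let r := window t z a b c d e in
  [/\ row_of r = t, col_of r = z, digit 4 r = a, digit 3 r = b & [/\ digit 2 r = c, digit 1 r = d & digit 0 r = e]].
Proof.
move=> zZ aG bG cG dG eG /=.
have dm u v : v < G -> (u * G + v) %/ G = u by move=> vG; rewrite divnMDl // divn_small // addn0.
have mm u v : v < G -> (u * G + v) %% G = v by move=> vG; rewrite modnMDl modn_small.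
have pw u i : u %/ G ^ i.+1 = u %/ G %/ G ^ i by rewrite expnS divnMA.
have Z0 : 0 < Z by exact: leq_trans RZ.
rewrite /row_of /col_of /digit !pw /window.
rewrite !expn0 !divn1 !dm // !mm // divnMDl // modnMDl divn_small // modn_small // addn0.
by [].
Qed.

Lemma window_lt t z a b c d e : t <= T -> z < Z -> a < G -> b < G -> c < G -> d < G -> e < G ->
  window t z a b c d e < window_count.
Proof.
move=> tT zZ aG bG cG dG eG; rewrite /window /window_count !expnSr expn0 mul1n !mulnA.
have st u v N : u < N -> v < G -> u * G + v < N * G.
  by move=> uN vG; apply: (@leq_trans (u.+1 * G)); [rewrite mulSn; lia|rewrite leq_mul2r uN orbT].
do 5 (apply: (st) => //).
by apply: (@leq_trans (t.+1 * Z)); [rewrite mulSn; lia|rewrite leq_mul2r ltnS tT orbT].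
Qed.

Lemma grid_cnf : cnf_sat grid_vars grid_clauses grid_lit <->
  exists f : nat -> nat -> nat, (forall t z, f t z < G) /\ allowed f.
Proof.
have W0 : 0 < window_count by rewrite /window_count 2!muln_gt0 expn_gt0 G0 (leq_ltn_trans _ RZ).
split.
  case=> val sat.
  pose f t z := let g := find (fun g => val (grid_var t z g)) (iota 0 G) in if g < G then g else 0.
  have fG t z : f t z < G by rewrite /f; case: ifP.
  have fval t z : t <= T -> z < Z -> val (grid_var t z (f t z)).
    move=> tT zZ; have [||||||wr wc _ _ _] := @windowK t z 0 0 0 0 0 => //.
    have wl := @window_lt t z 0 0 0 0 0 tT zZ G0 G0 G0 G0 G0.
    have := sat (window t z 0 0 0 0 0); rewrite /grid_clauses => /(_ _)/hasP[|v]; first by lia.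
    rewrite mem_iota add0n => /andP[_ vlt]; rewrite /true_lit /grid_lit leqNgt wl /=.
    rewrite modn_small //; case: (v %/ G =P _) => //= vE; rewrite ?orbF => vv.
    have vE' : v = grid_var t z (v %% G).
      rewrite /grid_var {1}(divn_eq v G) vE; congr (_ * G + _).
      by rewrite -[X in _ = X * _ + _]wr -[X in _ = _ + X]wc; exact: divn_eq.
    have hs : has (fun g => val (grid_var t z g)) (iota 0 G).
      by apply/hasP; exists (v %% G); rewrite ?mem_iota ?ltn_mod // -vE'.
    have := nth_find 0 hs; rewrite /f; move: (hs); rewrite has_find size_iota => fl.
    by rewrite fl nth_iota.
  exists f; split=> // t z; apply/negP => B.
  have [tT z0 zZ] := bad_in B.
  have zZ' : z < Z by exact: ltnW.
  set r := window t z (f t R) (f t z.-1) (f t z) (f t z.+1) (f t.+1 z).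
  have [wr wc w4 w3 [w2 w1 w0]] := windowK t zZ' (fG t R) (fG t z.-1) (fG t z) (fG t z.+1) (fG t.+1 z).
  have wl := window_lt (ltnW tT) zZ' (fG t R) (fG t z.-1) (fG t z) (fG t z.+1) (fG t.+1 z).
  have := sat (window_count + r); rewrite /grid_clauses mul2n -addnn ltn_add2l => /(_ wl)/hasP[v _].
  rewrite /true_lit /grid_lit leq_addr modnDl modn_small // /excludes wr wc w4 w3 w2 w1 w0 B /=.
  rewrite /in_window wr wc w4 w3 w2 w1 w0; case: ifP => //= vin /negP; apply.
  have zp : z.-1 < Z by exact: leq_ltn_trans (leq_pred _) _.
  by case/or4P: vin => [/eqP->|/eqP->|/eqP->|/orP[]/eqP->]; apply: fval => //; exact: ltnW.
case=> f [fG al].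
exists (fun v => v %% G == f (v %/ G %/ Z) (v %/ G %% Z)) => s sl.
have Z0 : 0 < Z by exact: leq_trans RZ.
set r := s %% window_count.
have rl : r < window_count by rewrite ltn_mod.
have rT : row_of r <= T.
  by rewrite /row_of -ltnS !ltn_divLR ?expn_gt0 ?G0 // -/window_count.
have cZ : col_of r < Z by rewrite ltn_mod.
have valE t z g : z < Z -> g < G -> (grid_var t z g %% G == f (grid_var t z g %/ G %/ Z) (grid_var t z g %/ G %% Z)) = (g == f t z).
  by move=> zZ gG; rewrite grid_varK // divnMDl // modnMDl divn_small // addn0 [z %% Z]modn_small // /grid_var modnMDl modn_small.
case: (boolP ((window_count <= s) && excludes r)) => ex; last first.
  apply/hasP; exists (grid_var (row_of r) (col_of r) (f (row_of r) (col_of r))).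
    by rewrite mem_iota add0n grid_var_lt.
  rewrite /true_lit /grid_lit -/r (negbTE ex) valE // eqxx grid_varK // andbT.
  by rewrite -divn_eq eqxx.
case/andP: (ex) => _ B; have [tT z0 zZ] := bad_in B.
have H t z g : t <= T -> z < Z -> g < G -> in_window r (grid_var t z g) -> g != f t z ->
  has (true_lit grid_lit (fun v => v %% G == f (v %/ G %/ Z) (v %/ G %% Z)) s) (iota 0 grid_vars).
  move=> tT' zZ' gG iw gf; apply/hasP; exists (grid_var t z g); first by rewrite mem_iota add0n grid_var_lt.
  by rewrite /true_lit /grid_lit -/r ex iw valE // gf orbT.
have zp : (col_of r).-1 < Z by exact: leq_ltn_trans (leq_pred _) _.
apply: contraT => /negP nh.
have E t z g : t <= T -> z < Z -> g < G -> in_window r (grid_var t z g) -> g = f t z.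
  by move=> a b c d; apply/eqP; apply: contraT => ne; case: nh; exact: H d ne.
have e4 := E (row_of r) R (digit 4 r) (ltnW tT) RZ (digit_lt _ _).
have e3 := E (row_of r) (col_of r).-1 (digit 3 r) (ltnW tT) zp (digit_lt _ _).
have e2 := E (row_of r) (col_of r) (digit 2 r) (ltnW tT) cZ (digit_lt _ _).
have e1 := E (row_of r) (col_of r).+1 (digit 1 r) (ltnW tT) zZ (digit_lt _ _).
have e0 := E (row_of r).+1 (col_of r) (digit 0 r) tT cZ (digit_lt _ _).
have := al (row_of r) (col_of r).
rewrite -e4; last by rewrite /in_window eqxx ?orbT.
rewrite -e3; last by rewrite /in_window eqxx ?orbT.
rewrite -e2; last by rewrite /in_window eqxx ?orbT.
rewrite -e1; last by rewrite /in_window eqxx ?orbT.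
rewrite -e0; last by rewrite /in_window eqxx ?orbT.
by move: B; rewrite /excludes => ->.
Qed.
End GridCnf.

(** * The theorem of Cook and Levin *)

Lemma horner_nat_mono (p : {poly nat}) a b : a <= b -> p.[a]%R <= p.[b]%R.
Proof.
move=> ab; elim/poly_ind: p => [|p c IH]; first by rewrite !horner0.
by rewrite !hornerD !hornerMX !hornerC !natrDE !natrME leq_add // leq_mul.
Qed.

Lemma outputs_within_le (M : machine) t t' ws o : outputs_within M t ws o -> t <= t' -> outputs_within M t' ws o.
Proof.
case=> hlt out /subnKC <-; rewrite /outputs_within.
suff -> : run (t + (t' - t)) (initial M ws) = run t (initial M ws) by [].
by elim: (t' - t) => [|k IH]; rewrite ?addn0 // addnS /run iterS -/(run _ _) IH hlt.
Qed.

Section CookLevin.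
Variables (M : machine) (p q : {poly nat}).
Definition width := #|{: column M}|.
Definition blank_column : column M := (tm_start M, [ffun=> None]).
Definition col_dec (a : nat) : column M := nth blank_column (enum {: column M}) a.
Definition col_enc (c : column M) : nat := enum_rank c.
Lemma col_encK c : col_dec (col_enc c) = c. Proof. exact: nth_enum_rank. Qed.
Lemma col_enc_lt c : col_enc c < width. Proof. exact: ltn_ord. Qed.

Definition guess (x : word) : nat := (q.[size x])%R.
Definition steps (x : word) : nat := ((p.[(size x + (q.[size x])%R)%N])%R).+1.
Definition radius (x : word) : nat := (steps x + guess x).+1.
Definition span (x : word) : nat := (radius x).*2.+1.
(** The conditions on entries are tables in the codes of the entries, which makes them
    definable. *)
Definition wrong_step (k a b c d e : nat) : bool :=
  tab false 4 (fun k => tab false width (fun a => tab false width (fun b => tab false width (fun c =>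
  tab false width (fun d => tab false width (fun e =>
    col_dec e != next_column k (col_dec a) (col_dec b) (col_dec c) (col_dec d)) e) d) c) b) a) k.
Definition code_of (i a : nat) : nat := tab 0 width (fun a => tape_code i (col_dec a)) a.
Definition fresh_col (a : nat) : bool := tab false width (fun a => fresh (col_dec a)) a.
Definition starts_col x (z c d : nat) : bool :=
  [&& fresh_col c, code_of 0 c == x_code x (radius x) z &
      if (radius x <= z) && (z - radius x < guess x) then (code_of 1 c < 3) && ((code_of 1 c == 0) ==> (code_of 1 d == 0))
      else code_of 1 c == 0].
Definition bad_col x (t z a b c d e : nat) : bool :=
  [&& t < steps x, 0 < z, z < radius x + radius x &
   [|| wrong_step (cat (radius x) z) a b c d e, (t == 0) && ~~ starts_col x z c d
     | [&& t.+1 == steps x, z == radius x & code_of 0 e != 2]]].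

Lemma bad_colE x t z a b c d e : a < width -> b < width -> c < width -> d < width -> e < width ->
  bad_col x t z a b c d e =
  bad x (guess x) (steps x) (radius x) t z (col_dec a) (col_dec b) (col_dec c) (col_dec d) (col_dec e).
Proof.
move=> aw bw cw dw ew; rewrite /bad_col /bad /starts_col /starts /fresh_col /code_of /wrong_step -addnn.
have c4 : cat (radius x) z < 4 by rewrite /cat; do 3 (case: ifP => // _).
by rewrite /tab c4 aw bw cw dw ew.
Qed.

Definition cl_vars x := grid_vars (steps x) (span x) width.
Definition cl_clauses x := grid_clauses (steps x) (span x) width.
Definition cl_lit x := grid_lit (steps x) (span x) width (radius x) (bad_col x).

Lemma dfn_guess : dfn (fun x w e => guess x). Proof. rewrite /guess; dfn_auto ltac:(fail). Qed.
Lemma dfn_steps : dfn (fun x w e => steps x). Proof. rewrite /steps; dfn_auto ltac:(fail). Qed.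
Ltac cl_ext := idtac; lazymatch goal with
  | |- dfn (fun x w e => guess x) => exact dfn_guess
  | |- dfn (fun x w e => steps x) => exact dfn_steps
  | |- _ => assumption end.
Lemma dfn_radius : dfn (fun x w e => radius x).
Proof. rewrite /radius; dfn_auto cl_ext. Qed.
Lemma dfn_span : dfn (fun x w e => span x).
Proof.
apply: (dfn_ext (F := fun x w e => (radius x + radius x).+1)) => [x w e|]; first by rewrite /span addnn.
by apply: dfn_succ; apply: dfn_add; exact: dfn_radius.
Qed.
Ltac cl_ext ::= idtac; lazymatch goal with
  | |- dfn (fun x w e => guess x) => exact dfn_guess
  | |- dfn (fun x w e => steps x) => exact dfn_steps
  | |- dfn (fun x w e => radius x) => exact dfn_radius
  | |- dfn (fun x w e => span x) => exact dfn_span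
  | |- _ => assumption end.
Lemma dfn_cl_vars : dfn (fun x w e => cl_vars x).
Proof. rewrite /cl_vars /grid_vars; dfn_auto cl_ext. Qed.
Lemma dfn_window_count : dfn (fun x w e => window_count (steps x) (span x) width).
Proof. rewrite /window_count; dfn_auto cl_ext. Qed.
Lemma dfn_cl_clauses : dfn (fun x w e => cl_clauses x).
Proof. by apply: dfn_mul; [exact: dfn_const|exact: dfn_window_count]. Qed.

Lemma dfnb_wrong_step A1 A2 A3 A4 A5 A6 : dfn A1 -> dfn A2 -> dfn A3 -> dfn A4 -> dfn A5 -> dfn A6 ->
  dfnb (fun x w e => wrong_step (A1 x w e) (A2 x w e) (A3 x w e) (A4 x w e) (A5 x w e) (A6 x w e)).
Proof.
move=> h1 h2 h3 h4 h5 h6; rewrite /wrong_step.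
by do 6 (apply: dfnb_tab => [//|? _]); exact: dfnb_const.
Qed.

Lemma dfn_code_of i A : dfn A -> dfn (fun x w e => code_of i (A x w e)).
Proof. by move=> hA; apply: dfn_tab => // k _; exact: dfn_const. Qed.
Lemma dfnb_fresh_col A : dfn A -> dfnb (fun x w e => fresh_col (A x w e)).
Proof. by move=> hA; apply: dfnb_tab => // k _; exact: dfnb_const. Qed.
Lemma dfn_x_code A : dfn A -> dfn (fun x w e => x_code x (radius x) (A x w e)).
Proof. move=> hA; rewrite /x_code; dfn_auto cl_ext. Qed.
Lemma dfn_cat A : dfn A -> dfn (fun x w e => cat (radius x) (A x w e)).
Proof. move=> hA; rewrite /cat; dfn_auto cl_ext. Qed.
Ltac cl_ext2 := idtac; lazymatch goal with
  | |- dfn (fun x w e => cat (radius x) (@?A x w e)) => apply (@dfn_cat A)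
  | |- dfn (fun x w e => x_code x (radius x) (@?A x w e)) => apply (@dfn_x_code A)
  | |- dfn (fun x w e => code_of ?i (@?A x w e)) => apply (@dfn_code_of i A)
  | |- dfnb (fun x w e => fresh_col (@?A x w e)) => apply (@dfnb_fresh_col A)
  | |- dfnb (fun x w e => wrong_step (@?A x w e) (@?B x w e) (@?C x w e) (@?D x w e) (@?E x w e) (@?F x w e)) => apply (@dfnb_wrong_step A B C D E F)
  | |- _ => cl_ext end.
Lemma dfnb_bad_col A1 A2 A3 A4 A5 A6 A7 : dfn A1 -> dfn A2 -> dfn A3 -> dfn A4 -> dfn A5 -> dfn A6 -> dfn A7 ->
  dfnb (fun x w e => bad_col x (A1 x w e) (A2 x w e) (A3 x w e) (A4 x w e) (A5 x w e) (A6 x w e) (A7 x w e)).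
Proof.
move=> h1 h2 h3 h4 h5 h6 h7; rewrite /bad_col /starts_col; dfn_auto cl_ext2.
Qed.
Ltac cl_ext3 := idtac; lazymatch goal with
  | |- dfn (fun x w e => window_count (steps x) (span x) width) => exact dfn_window_count
  | |- dfnb (fun x w e => bad_col x (@?A x w e) (@?B x w e) (@?C x w e) (@?D x w e) (@?E x w e) (@?F x w e) (@?G x w e)) =>
      apply (@dfnb_bad_col A B C D E F G)
  | |- _ => cl_ext end.
Lemma dfn_cl_lit : dfn (fun x w e => cl_lit x (e 0) (e 1)).
Proof.
apply: (dfn_ext (F := fun x w e => grid_lit (steps x) (span x) width (radius x) (bad_col x) (e 0) (e 1))) => //.
rewrite /grid_lit /in_window /grid_var /excludes /row_of /col_of /digit; dfn_auto cl_ext3.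
Qed.

Lemma cl_sat (V : word -> word -> bool) x :
  (forall x w, outputs_within M (p.[(size x + size w)%N])%R [:: x; w] [:: V x w]) ->
  cnf_sat (cl_vars x) (cl_clauses x) (cl_lit x) <-> exists2 w, size w <= guess x & V x w.
Proof.
move=> comp.
have G0 : 0 < width by apply: leq_ltn_trans (col_enc_lt blank_column).
have RZ : radius x < span x by rewrite /span -addnn; lia.
rewrite /cl_vars grid_cnf //; last first.
  by move=> t z a b c d e /and4P[tT z0 zR _]; rewrite /span -addnn ltnS.
have RT : steps x + guess x < radius x by rewrite /radius.
have cw w : size w <= guess x -> outputs_within M (steps x) [:: x; w] [:: V x w].
  move=> wq; apply: outputs_within_le (comp x w) _; apply: leqW; apply: horner_nat_mono.
  by rewrite leq_add2l.
split.
  case=> f [fG al]; apply: (@tableau_sound M x (guess x) (steps x) (radius x) isT RT (V x) cw (fun t z => col_dec (f t z))) => //.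
  by move=> t z; rewrite -bad_colE //; exact: al.
case=> w wq Vw; have [s L] := @tableau_complete M x (guess x) (steps x) (radius x) isT RT (V x) cw w wq Vw.
exists (fun t z => col_enc (s t z)); split=> [t z|t z]; first exact: col_enc_lt.
by rewrite bad_colE ?col_enc_lt // !col_encK; exact: L.
Qed.
End CookLevin.

(** Everything in the formula that depends on the instance is definable; the machine only enters
    through finite tables. *)
Lemma cook_levin (P : problem) : in_NP P -> exists (nv ncl : word -> nat) (lit : word -> nat -> nat -> nat),
  [/\ [/\ dfn (fun x w e => nv x), dfn (fun x w e => ncl x) & dfn (fun x w e => lit x (e 0) (e 1))],
      forall x r v, lit x r v < 3 & forall I : instance P, yes I <-> cnf_sat (nv (encode I)) (ncl (encode I)) (lit (encode I))].
Proof.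
case=> V [M [p comp]] [q NP].
exists (cl_vars M p q), (cl_clauses M p q), (cl_lit M p q); split.
- by split; [exact: dfn_cl_vars|exact: dfn_cl_clauses|exact: dfn_cl_lit].
- by move=> x r v; exact: grid_lit3.
by move=> I; rewrite (cl_sat q (encode I) comp); exact: NP.
Qed.

(** * The reduction *)

Lemma encode_ordinal n (e : nat -> nat -> bool) :
  encode_digraph (fun a b : 'I_n => e a b) =
  mkseq (fun k => (k < n) || (n < k) && e ((k - n.+1) %/ n) ((k - n.+1) %% n)) (n.+1 + n * n).
Proof.
apply: (@eq_from_nth _ false) => [|k]; rewrite size_encode card_ord ?size_mkseq // => kl.
rewrite nth_mkseq // nth_cat size_nseq card_ord; case: ltnP => kn /=; first by rewrite nth_nseq kn.
move: kl; rewrite -(subnKC kn); move: (k - n) => {k kn} k; rewrite addKn.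
case: k => [|k] kl; first by rewrite addn0 ltnn.
rewrite -addSnnS addKn ltn_addr //=; rewrite -addSnnS ltn_add2l in kl.
have n0 : 0 < n by case: n kl.
have i0 : 'I_n := Ordinal n0.
have dn : k %/ n < n by rewrite ltn_divLR.
have mn : k %% n < n by rewrite ltn_mod.
have := @nth_grid _ _ (fun a b : 'I_n => e a b) (enum 'I_n) (enum 'I_n) i0 i0 (k %/ n) (k %% n).
by rewrite size_enum_ord -divn_eq dn mn !nth_enum_ord // => ->.
Qed.

Lemma dfn_gidx m W I J D P : dfn W -> dfn I -> dfn J -> dfnb D -> dfn P ->
  dfn (fun x w e => gidx (W x w e) m (I x w e) (J x w e) (D x w e) (P x w e)).
Proof.
move=> hW hI hJ hD hP.
pose F x w e := let: (w', i, j, d, p) := (W x w e, I x w e, J x w e, D x w e, P x w e) in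
  if p == 0 then (i * w'.+1 + j) * (2 * m).+1
  else if p == 1 then ((i + d) * w'.+1 + (j + ~~ d)) * (2 * m).+1
  else (i * w'.+1 + j) * (2 * m).+1 + (d * m + (p - 2)).+1.
apply: (dfn_ext (F := F)) => [x w e|]; last by rewrite /F; dfn_auto ltac:(assumption).
by rewrite /F /gidx; case: (P x w e) => [|[|p]] //=; rewrite !subSS subn0.
Qed.

(** The contents of slots and tiles are finite tables as well, and the arcs of the host graph are
    found by a bounded search for a slot that contains both ends. *)
Definition slot_table m (A : rel 'I_m.+2) (t p q : nat) : bool :=
  tab false 4 (fun t => tab false m.+2 (fun p => tab false m.+2 (fun q => slot_rel A t (inord p) (inord q)) q) p) t.
Lemma slot_tableE m (A : rel 'I_m.+2) t (p q : 'I_m.+2) : slot_table A t p q = slot_rel A t p q.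
Proof. by rewrite /slot_table /tab !ltn_ord !inord_val; case: t => [|[|[|[|t]]]]. Qed.
Lemma dfnb_slot_table m (A : rel 'I_m.+2) F G H : dfn F -> dfn G -> dfn H ->
  dfnb (fun x w e => slot_table A (F x w e) (G x w e) (H x w e)).
Proof. by move=> hF hG hH; do 3 (apply: dfnb_tab => [//|? _]); exact: dfnb_const. Qed.

Definition tile_table (t i j d : nat) : nat :=
  tab 0 6 (fun t => tab 0 20 (fun i => tab 0 20 (fun j => tab 0 2 (fun d => tile_slot t (i, j) (d == 1)) d) j) i) t.
Lemma tile_tableE t i j d : t < 6 -> i < 20 -> j < 20 -> d < 2 -> tile_table t i j d = tile_slot t (i, j) (d == 1).
Proof. by rewrite /tile_table /tab => -> -> -> ->. Qed.
Lemma dfn_tile_table F G H K : dfn F -> dfn G -> dfn H -> dfn K ->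
  dfn (fun x w e => tile_table (F x w e) (G x w e) (H x w e) (K x w e)).
Proof. by move=> hF hG hH hK; do 4 (apply: dfn_tab => [//|? _]); exact: dfn_const. Qed.

Section Karp.
Variables (nv ncl : word -> nat) (lit : word -> nat -> nat -> nat).
Hypotheses (dfn_nv : dfn (fun x w e => nv x)) (dfn_ncl : dfn (fun x w e => ncl x)).
Hypothesis dfn_lit : dfn (fun x w e => lit x (e 0) (e 1)).
Hypothesis lit3 : forall x r v, lit x r v < 3.
Variables (m : nat) (A : rel 'I_m.+2).
Definition rows x := 20 * (ncl x).+1.
Definition cols x := 20 * (nv x).+2.
Definition order x := (rows x).+1 * (cols x).+1 * (2 * m).+1.
Definition tile_of x (i j : nat) : nat := cnf_tile (nv x) (lit x) (i %/ 20) (j %/ 20).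
Definition arc_of x (a b : nat) : bool :=
  has (fun i => has (fun j => has (fun d => has (fun p => has (fun q =>
    [&& a == gidx (cols x) m i j (d == 1) p, b == gidx (cols x) m i j (d == 1) q
      & slot_table A (tile_table (tile_of x i j) (i %% 20) (j %% 20) d) p q])
    (iota 0 m.+2)) (iota 0 m.+2)) (iota 0 2)) (iota 0 (cols x))) (iota 0 (rows x)).
Definition karp_bit x (k : nat) : bool :=
  (k < order x) || (order x < k) && arc_of x ((k - (order x).+1) %/ order x) ((k - (order x).+1) %% order x).
Definition karp x := mkseq (karp_bit x) ((order x).+1 + order x * order x).

Lemma arc_ofE x a b : arc_of x a b = host_arc A (rows x) (cols x) (grid_slot (cnf_tile (nv x) (lit x))) a b.
Proof.
have tE i j d : i < rows x -> j < cols x -> d < 2 -> tile_table (tile_of x i j) (i %% 20) (j %% 20) d =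
    grid_slot (cnf_tile (nv x) (lit x)) i j (d == 1).
  move=> ih jw d2; rewrite tile_tableE ?ltn_mod //.
  by apply: (@cnf_tile6 _ (ncl x)) => //; rewrite ltn_divLR // mulnC.
apply/idP/host_arcP.
  case/hasP => i; rewrite mem_iota => /andP[_ ih] /hasP[j]; rewrite mem_iota => /andP[_ jw].
  case/hasP => d; rewrite mem_iota => /andP[_ d2] /hasP[p]; rewrite mem_iota => /andP[_ pm].
  case/hasP => q; rewrite mem_iota => /andP[_ qm] /and3P[/eqP -> /eqP ->].
  rewrite tE // (slot_tableE A _ (Ordinal pm) (Ordinal qm)) => s.
  by exists i, j, (d == 1), (Ordinal pm), (Ordinal qm).
case=> i [j [d [p [q [ih jw -> -> s]]]]].
apply/hasP; exists i; first by rewrite mem_iota.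
apply/hasP; exists j; first by rewrite mem_iota.
apply/hasP; exists (nat_of_bool d); first by case: d {s}.
apply/hasP; exists (val p); first by rewrite mem_iota ltn_ord.
apply/hasP; exists (val q); first by rewrite mem_iota ltn_ord.
have -> : (nat_of_bool d == 1) = d by case: d {s}.
have d2 : d < 2 by case: d {s}.
by rewrite !eqxx tE // slot_tableE; case: d s {d2}.
Qed.

Lemma karp_encode x (A_anti : forall p q, A p q -> ~~ A q p) :
  karp x = encode_digraph (@Defs.arc (cnf_graph (nv x) (ncl x) (lit x) A_anti)).
Proof.
rewrite -[RHS]/(encode_digraph (fun a b : 'I_(order x) => host_arc A (rows x) (cols x) (grid_slot (cnf_tile (nv x) (lit x))) a b)).
rewrite encode_ordinal; apply: eq_mkseq => k.
by rewrite /karp_bit arc_ofE.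
Qed.

Ltac karp_ext := idtac; lazymatch goal with
  | |- dfn (fun x w e => nv x) => exact dfn_nv
  | |- dfn (fun x w e => ncl x) => exact dfn_ncl
  | |- dfn (fun x w e => lit x (@?F x w e) (@?G x w e)) => apply (@dfn_call2 (fun x w => lit x) F G dfn_lit)
  | |- dfnb (fun x w e => slot_table A (@?F x w e) (@?G x w e) (@?H x w e)) => apply (@dfnb_slot_table m A F G H)
  | |- dfn (fun x w e => tile_table (@?F x w e) (@?G x w e) (@?H x w e) (@?K x w e)) => apply (@dfn_tile_table F G H K)
  | |- dfn (fun x w e => gidx (@?F x w e) m (@?G x w e) (@?H x w e) (@?K x w e) (@?L x w e)) =>
     apply (@dfn_gidx m F G H K L)
  | |- _ => assumption end.
Lemma dfn_order : dfn (fun x w e => order x).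
Proof. rewrite /order /rows /cols; dfn_auto karp_ext. Qed.
Lemma dfn_arc_of : dfnb (fun x w e => arc_of x (e 0) (e 1)).
Proof. rewrite /arc_of /tile_of /cnf_tile /rows /cols; dfn_auto karp_ext. Qed.
Ltac karp_ext2 := idtac; lazymatch goal with
  | |- dfn (fun x w e => order x) => exact dfn_order
  | |- dfnb (fun x w e => arc_of x (@?F x w e) (@?G x w e)) => apply (@dfn_call2 (fun x w => arc_of x) F G dfn_arc_of)
  end.
Lemma karp_poly : poly_time_fun karp.
Proof.
apply: (dfn_poly_time_fun (L := fun x => (order x).+1 + order x * order x)); first by dfn_auto karp_ext2.
by rewrite /karp_bit; dfn_auto karp_ext2.
Qed.
End Karp.

Theorem theorem3p15 (R : realType) :
  (exists D : planar_oriented_graph R, ~ dicolourable 2 (sval D)) ->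
  NP_complete (planar_dicolourability R 2).
Proof.
move=> /slot_gadget[m [A [A_anti A_force A_allow A_draw]]]; split; first exact: dicolourability_NP.
move=> P /cook_levin[nv [ncl [lit [[dnv dncl dlit] lit3 sat]]]].
exists (karp nv ncl lit A); first exact: karp_poly.
move=> I; set x := encode I.
pose D := cnf_graph (nv x) (ncl x) (lit x) A_anti.
have pD : planar R D by exact: host_planar.
exists (exist _ D pD); first exact: karp_encode.
by rewrite sat -(cnf_graphP (fun r v _ _ => lit3 x r v) A_anti A_force A_allow).
Qed.
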